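(* Let $\mu$ be a finite positive Borel measure on $\mathbb{T}$ and let $u$ be an inner function. If $\operatorname{supp}(\mu)\cap\sigma(u)=\emptyset$, then the embedding $K_u\hookrightarrow\mathcal{D}(\mu)$ holds.
   Context: $\mathbb{D}$ is the open unit disk in $\mathbb{C}$, $\mathbb{T}=\partial\mathbb{D}$, $dA$ is two-dimensional Lebesgue measure, and $H^2(\mathbb{D})$ is the usual Hardy space. An inner function is a bounded analytic function $u$ on $\mathbb{D}$ whose boundary values satisfy $|u|=1$ a.e. on $\mathbb{T}$. The model space is $K_u=H^2(\mathbb{D})\ominus uH^2(\mathbb{D})$, with the $H^2$ norm. The boundary spectrum of $u$ is $\sigma(u)=\{\lambda\in\mathbb{T}:\liminf_{z\to\lambda}|u(z)|<1\}$, where $z$ ranges over $\mathbb{D}$. For inner $u$ this equals $\{\lambda\in\mathbb{T}:\liminf_{z\to\lambda}|u(z)|=0\}$ and is a closed set. The Poisson integral of $\mu$ is $P\mu(z)=\int_{\mathbb{T}}\frac{1-|z|^2}{|\lambda-z|^2}\,d\mu(\lambda)$, $z\in\mathbb{D}$. For $f$ holomorphic on $\mathbb{D}$, the harmonically weighted Dirichlet integral is $D_\mu(f)=\frac1\pi\int_{\mathbb{D}}|f'(z)|^2P\mu(z)\,dA(z)$. The harmonically weighted Dirichlet space is $\mathcal{D}(\mu)=\{f\text{ holomorphic on }\mathbb{D}: D_\mu(f)<\infty\}$, with norm given by $\|f\|_\mu^2=\|f\|_{H^2}^2+D_\mu(f)$. The embedding $K_u\hookrightarrow\mathcal{D}(\mu)$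 holds means: $K_u\subseteq\mathcal{D}(\mu)$ and there is $C>0$ with $\|f\|_{H^2}^2+D_\mu(f)\le C\|f\|_{H^2}^2$ for all $f\in K_u$. *)

(* Defs.v *)
From HB Require Import structures.
From mathcomp Require Import all_boot all_order all_algebra.
From mathcomp Require Import all_classical all_reals all_analysis.
From mathcomp Require Import complex.

Set Implicit Arguments.
Unset Strict Implicit.
Unset Printing Implicit Defensive.

Import Order.TTheory GRing.Theory Num.Theory.
Import numFieldNormedType.Exports.
Import ComplexField.Normc.

Local Open Scope classical_set_scope.
Local Open Scope ring_scope.
Local Open Scope complex_scope.

(* The topology of the numeric field [R[i]], i.e. that of the modulus. *)
HB.instance Definition _ (R : realType) := NormedModule.copy R[i] R[i]^o.

(* C with its Borel sigma-algebra. *)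
Definition borelC (R : realType) := g_sigma_algebraType (@open R[i]).

Section Defs.
Variable R : realType.
Implicit Types (f g u : R[i] -> R[i]) (z w l : R[i]) (r t : R).
Implicit Types (mu : {finite_measure set (borelC R) -> \bar R}).

Definition unit_disk : set R[i] := [set z | normc z < 1].
Definition unit_circle : set R[i] := [set z | normc z = 1].

Definition expi t : R[i] := cos t +i* sin t.

(* Functions on the disk are total functions on C whose values outside the
   disk are never used.  Derivatives are over the field R[i], hence complex. *)
Definition holomorphic f := forall z, unit_disk z -> derivable f z 1.

Definition circle_mean f r : \bar R :=
  ((2 * pi)^-1)%R%:E *
  \int[lebesgue_measure]_(t in `[0%R, (2 * pi)%R]) ((normc (f (r%:C * expi t)) ^+ 2)%:E).

Definition hardy_normsq f : \bar R :=
  ereal_sup [set circle_mean f r | r in [set r | 0 <= r < 1]].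

Definition hardy_space : set (R[i] -> R[i]) :=
  [set f | holomorphic f /\ (hardy_normsq f < +oo)%E].

Definition circle_dot f g r : R[i] :=
  let h t := f (r%:C * expi t) * conjc (g (r%:C * expi t)) in
  (2 * pi)^-1%:C *
  (Rintegral lebesgue_measure `[0, 2 * pi] (fun t => complex.Re (h t)) +i*
   Rintegral lebesgue_measure `[0, 2 * pi] (fun t => complex.Im (h t))).

(* For f and g in H^2 the limit of [circle_dot f g r] as r -> 1 exists and
   is the inner product of H^2 (it polarizes [hardy_normsq]). *)
Definition hardy_orthogonal f g : Prop :=
  circle_dot f g r @[r --> (1 : R)^'-] --> (0 : R[i]).

(* Boundary values are radial limits: they exist almost everywhere and agree
   with nontangential limits for every bounded analytic function. *)
Definition inner u :=
  [/\ holomorphic u,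
      exists M : R, forall z, unit_disk z -> normc (u z) <= M
    & {ae (@lebesgue_measure R), forall t, `[0, 2 * pi]%classic t ->
        exists2 w, u (r%:C * expi t) @[r --> (1 : R)^'-] --> w & normc w = 1}].

Definition model_space u : set (R[i] -> R[i]) :=
  [set f | hardy_space f /\
    forall g, hardy_space g -> hardy_orthogonal f (u \* g)].

Definition boundary_spectrum u : set R[i] :=
  [set l | unit_circle l /\
    (limf_einf (fun z => (normc (u z))%:E) (within unit_disk (nbhs l)) < 1)%E].

(* A Borel measure on the circle is a Borel measure on C for which the
   complement of the circle is null. *)
Definition on_circle mu := mu (~` unit_circle) = 0%E.

Definition measure_support mu : set R[i] :=
  [set l | forall U : set R[i], open U -> U l -> (0 < mu U)%E].

Definition poisson mu z : \bar R :=
  \int[mu]_(w in unit_circle) (((1 - normc z ^+ 2) / normc (w - z) ^+ 2)%:E).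

Definition dirichlet_integral mu f : \bar R :=
  (pi^-1)%R%:E *
  \int[lebesgue_measure \x lebesgue_measure]_(p in
      [set p : R * R | unit_disk (p.1 +i* p.2)])
    ((normc (derive1 f (p.1 +i* p.2)) ^+ 2)%:E * poisson mu (p.1 +i* p.2)).

Definition dirichlet_space mu : set (R[i] -> R[i]) :=
  [set f | holomorphic f /\ (dirichlet_integral mu f < +oo)%E].

Definition embeds u mu :=
  model_space u `<=` dirichlet_space mu /\
  exists2 C : R, 0 < C & forall f, model_space u f ->
    (hardy_normsq f + dirichlet_integral mu f <= C%:E * hardy_normsq f)%E.

End Defs.

Arguments unit_disk {R}.
Arguments unit_circle {R}.

(* Main.v *)
From HB Require Import structures.
Require Import Defs.
From mathcomp Require Import all_boot all_order all_algebra.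
From mathcomp Require Import all_classical all_reals all_analysis.
From mathcomp Require Import measurable_realfun complex ring lra zify.

(** Cover the circle by small arcs.  A point outside the support of mu has a
    mu-null neighbourhood.  At any other point l the inner function u is bounded
    below near l, and the functions f of the model space have bounded
    derivatives there: |f'|^2 <= C |f|^2_{H^2} on the part of the disk near l
    ([model_derivative_bound]).  For w near l this bounds |f'(z)|^2 P(z, w) by
    C |f|^2_{H^2} P(z, w) when z is near l too, and when z is far from l the
    Poisson kernel P(z, w) is at most a constant times 1 - |z|^2.  By
    compactness ([absorbed_circle])

      |f'|^2 P mu <= C |f|^2_{H^2} P mu + K (1 - |z|^2) |f'|^2

    on the disk.  Both terms on the right have integrals at most a constant
    times |f|^2_{H^2}: the area integral of P(., w) is at most 4 pi
    ([poisson_kernel_mass]), and that of (1 - |z|^2) |f'|^2 is estimated by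
    Parseval's identity ([littlewood_paley]).

    The derivative bound comes from the orthogonality of f to u H^2.  On the unit
    circle the argument reads as follows.  By Cauchy's formula the conjugate of
    f'(w) is the mean of conj(f) k with a kernel k that is singular only near w.
    Off an arc around l the kernel is bounded.  On the arc write conj(f) as
    u conj(f) / u; orthogonality says that u conj(f) has only positive frequencies,
    so that it extends to a function g of H^2, and the integral of g k / u can be
    moved into the disk by Goursat's theorem, away from the singularity of k.
    Growth of the order (1 - |z|)^(-1/2) for g is integrable along the two radial
    edges.  To have conj(f) on circles inside the disk, f is replaced by its
    Taylor polynomials; orthogonality then holds up to the tail of f
    ([model_tail]), at the price of a constant depending on w that disappears in
    the limit ([local_bound]).

    The complex analysis on the disk rests on Goursat's theorem for parametrized
    rectangles ([goursat]), and the area integrals on the invariance of area under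
    rotations, a rotation being a product of three shears
    ([ge0_integral_rotation]). *)

Set Implicit Arguments.
Unset Strict Implicit.
Unset Printing Implicit Defensive.

Import Order.TTheory GRing.Theory Num.Theory.
Import numFieldNormedType.Exports.
Import ComplexField.Normc.

Local Open Scope classical_set_scope.
Local Open Scope ring_scope.
Local Open Scope complex_scope.

(** * Complex numbers and the unit circle *)

Section ComplexBasics.
Variable R : realType.
Implicit Types (z w : R[i]) (t r : R).

Lemma normc_ge0 z : 0 <= normc z.
Proof. by case: z => a b /=; rewrite sqrtr_ge0. Qed.

Lemma normrE_normc z : `|z| = (normc z)%:C.
Proof. by rewrite normc_def; case: z. Qed.

Lemma normc_real r : normc r%:C = `|r|.
Proof. by rewrite /= expr0n /= addr0 sqrtr_sqr. Qed.

Lemma normc_sqr z : normc z ^+ 2 = complex.Re z ^+ 2 + complex.Im z ^+ 2.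
Proof. by case: z => a b /=; rewrite sqr_sqrtr // addr_ge0 // sqr_ge0. Qed.

Lemma normc_conj z : normc (conjc z) = normc z.
Proof. by case: z => a b /=; rewrite sqrrN. Qed.

(* Morphism properties of conjugation with [conjc] itself as head symbol. *)
Lemma conjcM z w : conjc (z * w) = conjc z * conjc w.
Proof. exact: rmorphM. Qed.

Lemma conjcD z w : conjc (z + w) = conjc z + conjc w.
Proof. exact: rmorphD. Qed.

Lemma conjcN z : conjc (- z) = - conjc z.
Proof. exact: rmorphN. Qed.

Lemma conjcR r : conjc r%:C = r%:C :> R[i].
Proof. exact: conjc_real. Qed.

Lemma conjc_invol z : conjc (conjc z) = z.
Proof. exact: conjcK. Qed.

Lemma conjcX z n : conjc (z ^+ n) = conjc z ^+ n.
Proof. exact: rmorphXn. Qed.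

Lemma conjc_sum (I : Type) (s : seq I) (F : I -> R[i]) :
  conjc (\sum_(i <- s) F i) = \sum_(i <- s) conjc (F i).
Proof. exact: rmorph_sum. Qed.

Lemma mulJc z : z * conjc z = (normc z ^+ 2)%:C.
Proof. by rewrite -sqr_normc normrE_normc rmorphXn. Qed.

Lemma normc_Re z : `|complex.Re z| <= normc z.
Proof.
rewrite -(@ler_pXn2r _ 2) ?nnegrE ?normc_ge0 // normc_sqr real_normK ?num_real //.
by rewrite lerDl sqr_ge0.
Qed.

Lemma normc_Im z : `|complex.Im z| <= normc z.
Proof.
rewrite -(@ler_pXn2r _ 2) ?nnegrE ?normc_ge0 // normc_sqr real_normK ?num_real //.
by rewrite lerDr sqr_ge0.
Qed.

Lemma normc_le_ReIm z : normc z <= `|complex.Re z| + `|complex.Im z|.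
Proof.
have -> : z = (complex.Re z)%:C + 'i * (complex.Im z)%:C by exact: complexE.
rewrite (le_trans (le_normcD _ _)) // normcM !normc_real.
have -> : normc 'i = 1 :> R by rewrite /= expr0n expr1n add0r sqrtr1.
by rewrite mul1r; case: z => a b /=; rewrite !mul0r !mul1r ?subr0 ?addr0 ?add0r.
Qed.

Lemma normcX z n : normc (z ^+ n) = normc z ^+ n.
Proof.
elim: n => [|n IH]; first by rewrite !expr0 normc1.
by rewrite !exprS normcM IH.
Qed.

Lemma normc_eq0 z : (normc z == 0) = (z == 0).
Proof.
by apply/eqP/eqP => [/eq0_normc //|->]; rewrite normc0.
Qed.

Lemma normc_gt0 z : (0 < normc z) = (z != 0).
Proof. by rewrite lt_def normc_ge0 andbT normc_eq0. Qed.

Lemma normcB z w : normc (z - w) = normc (w - z).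
Proof. by rewrite -normcN opprB. Qed.

Lemma le_normcB z w : normc z - normc w <= normc (z - w).
Proof. by rewrite lerBlDr (le_trans _ (le_normcD _ _)) // subrK. Qed.

Lemma normc_sum (I : Type) (s : seq I) (P : pred I) (F : I -> R[i]) :
  normc (\sum_(i <- s | P i) F i) <= \sum_(i <- s | P i) normc (F i).
Proof.
elim/big_ind2 : _ => //; first by rewrite normc0.
by move=> x1 x2 y1 y2 h1 h2; rewrite (le_trans (le_normcD _ _)) // lerD.
Qed.

Lemma expiD s t : expi (s + t) = expi s * expi t :> R[i].
Proof. by rewrite /expi sinD cosD; apply/eqP; rewrite eq_complex /=; apply/andP; split; apply/eqP; ring. Qed.

Lemma expi0 : expi 0 = 1 :> R[i].
Proof. by rewrite /expi sin0 cos0. Qed.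

Lemma normc_expi t : normc (expi t) = 1.
Proof. by rewrite /= cos2Dsin2 sqrtr1. Qed.

Lemma expi_neq0 t : expi t != 0.
Proof. by rewrite -normc_gt0 normc_expi. Qed.

Lemma conj_expi t : conjc (expi t) = expi (- t).
Proof. by rewrite /expi cosN sinN. Qed.

Lemma expiMn t n : expi (t *+ n) = expi t ^+ n.
Proof.
by elim: n => [|n IH]; rewrite ?mulr0n ?expi0 // mulrS expiD IH exprS.
Qed.

Lemma expi2pi : expi (2 * pi) = 1 :> R[i].
Proof. by rewrite /expi mulr_natl cos2pi sin2pi. Qed.

Lemma expiD2pi t : expi (t + 2 * pi) = expi t.
Proof. by rewrite expiD expi2pi mulr1. Qed.

Lemma normc_polar r t : normc (r%:C * expi t) = `|r|.
Proof. by rewrite normcM normc_expi normc_real mulr1. Qed.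

(** The topology of the modulus, read with real radii. *)
Lemma nbhs_normcP z (A : set R[i]) :
  nbhs z A <-> exists2 e : R, 0 < e & forall w, normc (w - z) < e -> A w.
Proof.
split.
  move/nbhs_ballP => [e /= e0 H].
  have er : e = (complex.Re e)%:C by rewrite RRe_real // gtr0_real.
  exists (complex.Re e); first by move: e0; rewrite er ltcR.
  move=> w hw; apply: H; rewrite -ball_normE /= distrC normrE_normc er.
  by rewrite ltcR.
move=> [e e0 H]; apply/nbhs_ballP; exists e%:C => /=; first by rewrite ltcR.
move=> w; rewrite -ball_normE /= distrC normrE_normc ltcR; exact: H.
Qed.

Lemma near_normcP z (P : R[i] -> Prop) :
  (\forall w \near z, P w) <->
  exists2 e : R, 0 < e & forall w, normc (w - z) < e -> P w.
Proof. exact: nbhs_normcP. Qed.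

Lemma cvg_normcP (T : Type) (F : set_system T) (FF : Filter F) (f : T -> R[i]) z :
  f @ F --> z <-> forall e : R, 0 < e -> \forall x \near F, normc (f x - z) < e.
Proof.
split=> [h e e0|h].
  have := h [set w | normc (w - z) < e]; apply.
  by apply/nbhs_normcP; exists e.
move=> A /nbhs_normcP [e e0 H]; have := h e e0; rewrite !nbhs_simpl.
by apply: filterS => x; exact: H.
Qed.

Lemma Re_continuous : continuous (@complex.Re R).
Proof.
move=> z; apply/(cvgrPdist_lt (FF := nbhs_filter z)) => e e0; apply/near_normcP; exists e => // w hw.
by rewrite distrC -raddfB (le_lt_trans (normc_Re _)).
Qed.

Lemma Im_continuous : continuous (@complex.Im R).
Proof.
move=> z; apply/(cvgrPdist_lt (FF := nbhs_filter z)) => e e0; apply/near_normcP; exists e => // w hw.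
by rewrite distrC -raddfB (le_lt_trans (normc_Im _)).
Qed.

Lemma normc_continuous : continuous (@normc R).
Proof.
move=> z; apply/(cvgrPdist_lt (FF := nbhs_filter z)) => e e0; apply/near_normcP; exists e => // w hw.
rewrite (le_lt_trans _ hw) // ler_norml normcB le_normcB andbT.
by rewrite lerNl opprB normcB le_normcB.
Qed.

Lemma cvg_ReIm (T : Type) (F : set_system T) (FF : Filter F) (f g : T -> R) a b :
  f @ F --> a -> g @ F --> b -> (fun x => f x +i* g x) @ F --> a +i* b.
Proof.
move=> /cvgrPdist_lt hf /cvgrPdist_lt hg; apply/cvg_normcP => e e0.
have e2 : 0 < e / 2 by rewrite divr_gt0.
have := hf _ e2; have := hg _ e2; apply: filterS2 => x h1 h2.
rewrite (le_lt_trans (normc_le_ReIm _)) //= (splitr e) ltrD //.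
  by rewrite distrC.
by rewrite distrC.
Qed.

Lemma real_complex_continuous : continuous (fun r : R => r%:C).
Proof. by move=> r; apply: cvg_ReIm; [exact: cvg_id|exact: cvg_cst]. Qed.

Lemma conjc_continuous : continuous (@conjc R).
Proof.
move=> z; apply/(cvg_normcP (nbhs_filter z)) => e e0; apply/near_normcP; exists e => // w hw.
by rewrite -rmorphB normc_conj.
Qed.

Lemma expi_continuous : continuous (@expi R).
Proof.
by move=> t; apply: cvg_ReIm; [exact: continuous_cos|exact: continuous_sin].
Qed.

(** Complex differentiability with an explicit modulus, the form in which it is
    used throughout. *)
Lemma derivable_normcP (f : R[i] -> R[i]) z : derivable f z 1 ->
  forall e : R, 0 < e -> exists2 d : R, 0 < d & forall w, normc (w - z) < d ->
    normc (f w - f z - derive1 f z * (w - z)) <= e * normc (w - z).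
Proof.
move=> hf e e0.
have h : (fun h : R[i] => h^-1 *: (f (h *: 1 + z) - f z)) @ 0^' --> derive1 f z.
  rewrite derive1E; exact: hf.
move/cvg_normcP : h => /(_ e e0).
rewrite near_withinE => /near_normcP [d d0 H]; exists d => // w hw.
have [->|wz] := eqVneq w z; first by rewrite !subrr mulr0 subr0 normc0 mulr0.
have wz0 : w - z != 0 by rewrite subr_eq0.
have := H (w - z); rewrite subr0 => /(_ hw wz0) /ltW.
rewrite -(ler_pM2r (x := normc (w - z))) ?normc_gt0 //.
rewrite -normcM mulrBl; congr (normc (_ - _) <= _).
by rewrite /GRing.scale /= mulr1 subrK mulrAC mulVf // mul1r.
Qed.

Lemma derivable_continuous_pt (f : R[i] -> R[i]) z :
  derivable f z 1 -> {for z, continuous f}.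
Proof. by move/derivable1_diffP/differentiable_continuous. Qed.

End ComplexBasics.

(** * Integrals of complex functions of a real variable *)

(** Continuity at every point of [a, b], from both sides.  Locked so that
    trivial steps do not unfold it down to neighborhood filters. *)
HB.lock Definition cont_on (R : realType) (T : topologicalType) (a b : R)
    (h : R -> T) : Prop :=
  forall t, a <= t <= b -> {for t, continuous h}.
Arguments cont_on {R T} a b h.

Section CurveIntegral.
Variable R : realType.
Implicit Types (a b c t : R).

Lemma cont_onP (T : topologicalType) a b (h : R -> T) :
  cont_on a b h <-> forall t, a <= t <= b -> {for t, continuous h}.
Proof. by rewrite cont_on.unlock. Qed.

Lemma cont_onS (T : topologicalType) a b c d (h : R -> T) :
  a <= c -> d <= b -> cont_on a b h -> cont_on c d h.
Proof.
move=> ac db /cont_onP H; apply/cont_onP => t /andP[ct td]; apply: H.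
by rewrite (le_trans ac) //= (le_trans td).
Qed.

Lemma cont_on_comp (T U : topologicalType) a b (h : R -> T) (g : T -> U) :
  (forall t, a <= t <= b -> {for h t, continuous g}) ->
  cont_on a b h -> cont_on a b (fun t => g (h t)).
Proof.
by move=> hg /cont_onP hh; apply/cont_onP => t ht; apply: continuous_comp; [exact: hh|exact: hg].
Qed.

Definition rInt a b (f : R -> R) : R :=
  Rintegral (@lebesgue_measure R) `[a, b] f.

Definition cInt a b (h : R -> R[i]) : R[i] :=
  rInt a b (fun t => complex.Re (h t)) +i* rInt a b (fun t => complex.Im (h t)).

Lemma cont_on_integrable a b (f : R -> R) :
  cont_on a b f -> (@lebesgue_measure R).-integrable `[a, b] (EFin \o f).
Proof.
move=> /cont_onP H; apply: continuous_compact_integrable; first exact: segment_compact.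
by apply: continuous_in_subspaceT => t; rewrite inE /= in_itv => /H.
Qed.

Lemma rIntD a b (f : R -> R) (g : R -> R) : cont_on a b f -> cont_on a b g ->
  rInt a b (fun t => f t + g t) = rInt a b f + rInt a b g.
Proof. by move=> hf hg; rewrite /rInt RintegralD //; exact: cont_on_integrable. Qed.

Lemma rIntZ a b (k : R) (f : R -> R) : cont_on a b f ->
  rInt a b (fun t => k * f t) = k * rInt a b f.
Proof. by move=> hf; rewrite /rInt RintegralZl //; exact: cont_on_integrable. Qed.

Lemma rInt_le a b (f : R -> R) (g : R -> R) : cont_on a b f -> cont_on a b g ->
  (forall t, a <= t <= b -> f t <= g t) -> rInt a b f <= rInt a b g.
Proof.
move=> hf hg fg; apply: le_Rintegral.
- exact: measurable_itv.
- exact: cont_on_integrable.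
- exact: cont_on_integrable.
- by move=> t /=; rewrite in_itv /= => /fg.
Qed.

Lemma rInt_cst a b (k : R) : a <= b -> rInt a b (fun=> k) = k * (b - a).
Proof.
move=> ab; rewrite /rInt Rintegral_cst; last exact: measurable_itv.
congr (_ * _); rewrite -[RHS]/(fine (b - a)%:E); congr fine.
apply: (etrans (lebesgue_measure_itv _)); rewrite /= lte_fin.
by case: ltgtP ab => // -> _; rewrite subrr.
Qed.

Lemma rInt_eq a b (f : R -> R) (g : R -> R) : (forall t, a <= t <= b -> f t = g t) ->
  rInt a b f = rInt a b g.
Proof.
by move=> fg; apply: eq_Rintegral => t; rewrite inE /= in_itv /= => /fg.
Qed.

Lemma rInt_split a b c (f : R -> R) : a <= b -> b <= c -> cont_on a c f ->
  rInt a c f = rInt a b f + rInt b c f.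
Proof.
move=> ab bc hf; have intf := cont_on_integrable hf.
have := Rintegral_itvB (x := b) intf; rewrite !bnd_simp => /(_ ab bc) E.
have E2 : rInt b c f = Rintegral (@lebesgue_measure R) `]b, c] f.
  apply/esym/Rintegral_itv_obnd_cbnd; apply: integrableS intf => //.
  by apply: subset_itvr; rewrite bnd_simp.
have E3 : rInt a c f - rInt a b f = rInt b c f by rewrite E2; exact: E.
by rewrite -E3 addrC subrK.
Qed.

Lemma rInt_ge0 a b (f : R -> R) : (forall t, a <= t <= b -> 0 <= f t) -> 0 <= rInt a b f.
Proof. by move=> H; apply: Rintegral_ge0 => t /=; rewrite in_itv => /H. Qed.

Lemma rInt_itv1 a (f : R -> R) : rInt a a f = 0.
Proof. by rewrite /rInt set_itv1 Rintegral_set1. Qed.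

Lemma rInt_FTC a b (f F : R -> R) : a <= b -> cont_on a b f ->
  (forall t, a <= t <= b -> is_derive t 1 F (f t)) ->
  rInt a b f = F b - F a.
Proof.
rewrite le_eqVlt => /predU1P[<- _ _|ab /[dup] /cont_onP hf hf' hF]; first by rewrite rInt_itv1 subrr.
rewrite /rInt /Rintegral (@continuous_FTC2 _ _ F) //.
- by apply: continuous_in_subspaceT => t; rewrite inE /= in_itv => /hf.
- have hc t : a <= t <= b -> {for t, continuous F}.
    by move=> /hF [d _]; apply: differentiable_continuous; apply/derivable1_diffP.
  split => [t||].
  + rewrite in_itv /= => /andP[h1 h2].
    by have [] : is_derive t 1 F (f t) by apply: hF; rewrite !ltW.
  + by apply: cvg_at_right_filter; apply: hc; rewrite lexx ltW.
  + by apply: cvg_at_left_filter; apply: hc; rewrite lexx ltW.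
- move=> t; rewrite in_itv /= => /andP[h1 h2].
  have : is_derive t 1 F (f t) by apply: hF; rewrite !ltW.
  by move=> h; rewrite derive1E derive_val.
Qed.

Lemma cont_on_Re a b (h : R -> R[i]) :
  cont_on a b h -> cont_on a b (fun t => complex.Re (h t)).
Proof. by apply: cont_on_comp => t _; exact: Re_continuous. Qed.

Lemma cont_on_Im a b (h : R -> R[i]) :
  cont_on a b h -> cont_on a b (fun t => complex.Im (h t)).
Proof. by apply: cont_on_comp => t _; exact: Im_continuous. Qed.

Lemma cont_on_normc a b (h : R -> R[i]) :
  cont_on a b h -> cont_on a b (fun t => normc (h t)).
Proof. by apply: cont_on_comp => t _; exact: normc_continuous. Qed.

Lemma cont_on_conj a b (h : R -> R[i]) :
  cont_on a b h -> cont_on a b (fun t => conjc (h t)).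
Proof. by apply: cont_on_comp => t _; exact: conjc_continuous. Qed.

Lemma cont_on_cst (T : topologicalType) a b (k : T) : cont_on a b (fun=> k).
Proof. by apply/cont_onP => t _; exact: cvg_cst. Qed.

Lemma cont_onD (K : numFieldType) (V : normedModType K) a b (f g : R -> V) :
  cont_on a b f -> cont_on a b g -> cont_on a b (fun t => f t + g t).
Proof. by move=> /cont_onP hf /cont_onP hg; apply/cont_onP => t ht; apply: cvgD; [exact: hf|exact: hg]. Qed.

Lemma cont_onN (K : numFieldType) (V : normedModType K) a b (f : R -> V) :
  cont_on a b f -> cont_on a b (fun t => - f t).
Proof. by move=> /cont_onP hf; apply/cont_onP => t ht; apply: cvgN; exact: hf. Qed.

Lemma cont_onM (K : numFieldType) a b (f g : R -> K) :
  cont_on a b f -> cont_on a b g -> cont_on a b (fun t => f t * g t).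
Proof. by move=> /cont_onP hf /cont_onP hg; apply/cont_onP => t ht; apply: cvgM; [exact: hf|exact: hg]. Qed.

Lemma cont_onV (K : numFieldType) a b (f : R -> K) :
  (forall t, a <= t <= b -> f t != 0) ->
  cont_on a b f -> cont_on a b (fun t => (f t)^-1).
Proof. by move=> nz /cont_onP hf; apply/cont_onP => t ht; apply: cvgV; [exact: nz|exact: hf]. Qed.

Lemma cont_on_sum (K : numFieldType) (V : normedModType K) a b (I : Type)
    (s : seq I) (F : I -> R -> V) :
  (forall i, cont_on a b (F i)) -> cont_on a b (fun t => \sum_(i <- s) F i t).
Proof.
move=> hF; elim: s => [|i s IH].
  by under eq_fun do rewrite big_nil; exact: cont_on_cst.
by under eq_fun do rewrite big_cons; exact: cont_onD.
Qed.

Lemma cont_onX (K : numFieldType) a b (f : R -> K) n :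
  cont_on a b f -> cont_on a b (fun t => f t ^+ n).
Proof.
move=> hf; elim: n => [|n IH].
  by under eq_fun do rewrite expr0; exact: cont_on_cst.
by under eq_fun do rewrite exprS; exact: cont_onM.
Qed.

Lemma cont_on_expi a b : cont_on a b (@expi R).
Proof. by apply/cont_onP => t _; exact: expi_continuous. Qed.

(* Copies at the complex numbers, where unification need not search for the
   normed-module structure. *)
Lemma ccont_cst a b (k : R[i]) : cont_on a b (fun=> k).
Proof. exact: cont_on_cst. Qed.

Lemma ccontD a b (f g : R -> R[i]) :
  cont_on a b f -> cont_on a b g -> cont_on a b (fun t => f t + g t).
Proof. exact: (@cont_onD R[i] R[i]). Qed.

Lemma ccontN a b (f : R -> R[i]) : cont_on a b f -> cont_on a b (fun t => - f t).
Proof. exact: (@cont_onN R[i] R[i]). Qed.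

Lemma ccontB a b (f g : R -> R[i]) :
  cont_on a b f -> cont_on a b g -> cont_on a b (fun t => f t - g t).
Proof. by move=> hf hg; apply: ccontD => //; exact: ccontN. Qed.

Lemma ccontM a b (f g : R -> R[i]) :
  cont_on a b f -> cont_on a b g -> cont_on a b (fun t => f t * g t).
Proof. exact: (@cont_onM R[i]). Qed.

Lemma ccontV a b (f : R -> R[i]) : (forall t, a <= t <= b -> f t != 0) ->
  cont_on a b f -> cont_on a b (fun t => (f t)^-1).
Proof. exact: (@cont_onV R[i]). Qed.

Lemma ccontX a b (f : R -> R[i]) n :
  cont_on a b f -> cont_on a b (fun t => f t ^+ n).
Proof. exact: (@cont_onX R[i]). Qed.

Lemma ccont_sum a b (I : Type) (s : seq I) (F : I -> R -> R[i]) :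
  (forall i, cont_on a b (F i)) -> cont_on a b (fun t => \sum_(i <- s) F i t).
Proof. exact: (@cont_on_sum R[i] R[i]). Qed.

Lemma ccontZ a b z (f : R -> R[i]) : cont_on a b f -> cont_on a b (fun t => z * f t).
Proof. by move=> hf; apply: ccontM => //; exact: ccont_cst. Qed.

Lemma ccont_real a b : cont_on a b (fun t : R => t%:C).
Proof. by apply/cont_onP => t _; exact: real_complex_continuous. Qed.

Lemma cont_on_circle a b r (f : R[i] -> R[i]) :
  (forall t, a <= t <= b -> {for r%:C * expi t, continuous f}) ->
  cont_on a b (fun t => f (r%:C * expi t)).
Proof.
move=> H; apply/cont_onP => t ht; apply: (@continuous_comp _ _ _ (fun t => r%:C * expi t) f).
  by apply: cvgM; [exact: cvg_cst|exact: expi_continuous].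
exact: H.
Qed.

Lemma eq_cInt a b (h k : R -> R[i]) : (forall t, a <= t <= b -> h t = k t) ->
  cInt a b h = cInt a b k.
Proof. by move=> H; congr (_ +i* _); apply: rInt_eq => t /H ->. Qed.

Lemma cIntD a b (h k : R -> R[i]) : cont_on a b h -> cont_on a b k ->
  cInt a b (fun t => h t + k t) = cInt a b h + cInt a b k.
Proof.
move=> hh hk; apply/eqP; rewrite eq_complex /=; apply/andP; split; apply/eqP.
  rewrite -rIntD; try exact: cont_on_Re.
  by apply: rInt_eq => t _; rewrite raddfD.
rewrite -rIntD; try exact: cont_on_Im.
by apply: rInt_eq => t _; rewrite raddfD.
Qed.

Lemma cIntZ a b z (h : R -> R[i]) : cont_on a b h ->
  cInt a b (fun t => z * h t) = z * cInt a b h.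
Proof.
move=> hh; have hRe := cont_on_Re hh; have hIm := cont_on_Im hh.
case: z => x y; apply/eqP; rewrite eq_complex /=; apply/andP; split; apply/eqP.
  rewrite -rIntZ // -mulNr -rIntZ // -rIntD.
  - by apply: rInt_eq => t _; case: (h t) => p q /=; rewrite mulNr.
  - by apply: cont_onM => //; exact: cont_on_cst.
  - by apply: cont_onM => //; exact: cont_on_cst.
rewrite -rIntZ // -rIntZ // -rIntD.
- by apply: rInt_eq => t _; case: (h t) => p q /=.
- by apply: cont_onM => //; exact: cont_on_cst.
- by apply: cont_onM => //; exact: cont_on_cst.
Qed.

Lemma cIntN a b (h : R -> R[i]) : cont_on a b h -> cInt a b (fun t => - h t) = - cInt a b h.
Proof.
move=> hh; rewrite -mulN1r -cIntZ //; apply: eq_cInt => t _.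
by rewrite mulN1r.
Qed.

Lemma cIntB a b (h k : R -> R[i]) : cont_on a b h -> cont_on a b k ->
  cInt a b (fun t => h t - k t) = cInt a b h - cInt a b k.
Proof. by move=> hh hk; rewrite cIntD ?cIntN //; exact: cont_onN. Qed.

Lemma cInt0 a b : cInt a b (fun=> 0) = 0.
Proof.
have E : cInt a b (fun=> 0 * 0) = 0 * cInt a b (fun=> 0).
  by rewrite cIntZ //; exact: cont_on_cst.
by move: E; rewrite !mul0r.
Qed.

Lemma cInt_sum a b (I : Type) (s : seq I) (F : I -> R -> R[i]) :
  (forall i, cont_on a b (F i)) ->
  cInt a b (fun t => \sum_(i <- s) F i t) = \sum_(i <- s) cInt a b (F i).
Proof.
move=> hF; elim: s => [|i s IH].
  rewrite big_nil (@eq_cInt _ _ _ (fun=> 0)) ?cInt0 // => t _.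
  by rewrite big_nil.
rewrite big_cons -IH -cIntD //; last exact: cont_on_sum.
by apply: eq_cInt => t _; rewrite big_cons.
Qed.

Lemma cInt_split a b c (h : R -> R[i]) : a <= b -> b <= c -> cont_on a c h ->
  cInt a c h = cInt a b h + cInt b c h.
Proof.
move=> ab bc hh; apply/eqP; rewrite eq_complex /=; apply/andP; split; apply/eqP.
  by apply: rInt_split => //; exact: cont_on_Re.
by apply: rInt_split => //; exact: cont_on_Im.
Qed.

Lemma cInt_real a b (f : R -> R) : cInt a b (fun t => (f t)%:C) = (rInt a b f)%:C.
Proof.
congr (_ +i* _); transitivity (rInt a b (fun=> 0)); first exact: rInt_eq.
by rewrite /rInt /Rintegral integral0.
Qed.

(** The triangle inequality: test the integral against its own direction. *)
Lemma cInt_le a b (h : R -> R[i]) : cont_on a b h ->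
  normc (cInt a b h) <= rInt a b (fun t => normc (h t)).
Proof.
move=> hh; set I := cInt a b h.
have [I0|I0] := eqVneq I 0.
  by rewrite I0 normc0; apply: rInt_ge0 => t _; exact: normc_ge0.
rewrite -(ler_pM2l (x := normc I)) ?normc_gt0 // -expr2.
have -> : normc I ^+ 2 = complex.Re (conjc I * I) by rewrite mulrC mulJc.
rewrite {2}/I -cIntZ // -rIntZ; last exact: cont_on_normc.
have -> : complex.Re (cInt a b (fun t => conjc I * h t)) =
  rInt a b (fun t => complex.Re (conjc I * h t)) by [].
have hk : cont_on a b (fun t => conjc I * h t).
  by apply: cont_onM => //; exact: cont_on_cst.
apply: rInt_le; first exact: cont_on_Re.
  by apply: cont_onM; [exact: cont_on_cst|exact: cont_on_normc].
move=> t _; rewrite (le_trans (ler_norm _)) // (le_trans (normc_Re _)) //.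
by rewrite normcM normc_conj.
Qed.

Lemma cInt_le_cst a b (h : R -> R[i]) K : a <= b -> cont_on a b h ->
  (forall t, a <= t <= b -> normc (h t) <= K) ->
  normc (cInt a b h) <= K * (b - a).
Proof.
move=> ab hh hK; rewrite (le_trans (cInt_le hh)) // -rInt_cst //.
by apply: rInt_le => //; [exact: cont_on_normc|exact: cont_on_cst].
Qed.

(** Componentwise, so that the rules for real derivatives apply. *)
Definition is_cderive (F : R -> R[i]) t (d : R[i]) :=
  is_derive t 1 (fun s => complex.Re (F s)) (complex.Re d) /\
  is_derive t 1 (fun s => complex.Im (F s)) (complex.Im d).

Lemma cInt_FTC a b (h F : R -> R[i]) : a <= b -> cont_on a b h ->
  (forall t, a <= t <= b -> is_cderive F t (h t)) ->
  cInt a b h = F b - F a.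
Proof.
move=> ab hh hF; apply/eqP; rewrite eq_complex; apply/andP; split; apply/eqP.
  rewrite raddfB /=; apply: (rInt_FTC (F := fun s => complex.Re (F s))) => //.
    exact: cont_on_Re.
  by move=> t /hF [].
rewrite raddfB /=; apply: (rInt_FTC (F := fun s => complex.Im (F s))) => //.
  exact: cont_on_Im.
by move=> t /hF [].
Qed.

Lemma is_cderive_cst z t : is_cderive (fun=> z) t 0.
Proof. by split; exact: is_derive_cst. Qed.

Lemma is_cderiveD (F G : R -> R[i]) t d e : is_cderive F t d -> is_cderive G t e ->
  is_cderive (fun s => F s + G s) t (d + e).
Proof.
move=> [F1 F2] [G1 G2]; split.
  rewrite raddfD; under eq_fun do rewrite raddfD; exact: is_deriveD.
rewrite raddfD; under eq_fun do rewrite raddfD; exact: is_deriveD.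
Qed.

Lemma ReD (x y : R[i]) : complex.Re (x + y) = complex.Re x + complex.Re y.
Proof. by case: x y => ? ? []. Qed.

Lemma ImD (x y : R[i]) : complex.Im (x + y) = complex.Im x + complex.Im y.
Proof. by case: x y => ? ? []. Qed.

Lemma ReM (x y : R[i]) : complex.Re (x * y) =
  complex.Re x * complex.Re y - complex.Im x * complex.Im y.
Proof. by case: x y => ? ? []. Qed.

Lemma ImM (x y : R[i]) : complex.Im (x * y) =
  complex.Re x * complex.Im y + complex.Im x * complex.Re y.
Proof. by case: x y => ? ? []. Qed.

Lemma is_cderiveM (F G : R -> R[i]) t d e : is_cderive F t d -> is_cderive G t e ->
  is_cderive (fun s => F s * G s) t (F t * e + d * G t).
Proof.
move=> [F1 F2] [G1 G2]; split.
  under eq_fun do rewrite ReM; apply: is_derive_eq.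
  by rewrite ReD !ReM /GRing.scale /=; ring.
under eq_fun do rewrite ImM; apply: is_derive_eq.
by rewrite ImD !ImM /GRing.scale /=; ring.
Qed.

Lemma is_cderive_expi t : is_cderive (@expi R) t ('i * expi t).
Proof.
split; apply: is_derive_eq.
  by rewrite /expi /= !mul0r mul1r sub0r.
by rewrite /expi /= !mul0r mul1r add0r.
Qed.

Lemma is_cderive_real t : is_cderive (fun s : R => s%:C) t 1.
Proof. by split; [exact: is_derive_id|exact: is_derive_cst]. Qed.

End CurveIntegral.

(** * Goursat's theorem *)

Section Bisection.
Variable R : realType.

(** Lebesgue-number argument behind Goursat's theorem.  A subadditive function
    of rectangles that is infinitesimal compared with the square of the size
    near every point vanishes: otherwise repeated quartering keeps a fraction
    4^-n of its value on rectangles that shrink to a point. *)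
Lemma bisection_le0 (N : R -> R -> R -> R -> R) A B C D :
  A <= B -> C <= D ->
  (forall a m b c k d, A <= a <= m -> m <= b <= B -> C <= c <= k ->
     k <= d <= D -> N a b c d <= N a m c k + N m b c k + N a m k d + N m b k d) ->
  (forall x t, A <= x <= B -> C <= t <= D -> forall e, 0 < e ->
     exists2 dl, 0 < dl & forall a b c d, A <= a <= x -> x <= b <= B ->
       C <= c <= t -> t <= d <= D -> b - a < dl -> d - c < dl ->
       N a b c d <= e * ((b - a) + (d - c)) ^+ 2) ->
  N A B C D <= 0.
Proof.
move=> AB CD Nsub Nloc; rewrite leNgt; apply/negP => eta0.
set eta := N A B C D in eta0.
pose mid (x y : R) := (x + y) / 2.
pose Nq (q : R * R * R * R) := N q.1.1.1 q.1.1.2 q.1.2 q.2.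
pose step (q : R * R * R * R) : R * R * R * R :=
  let: (a, b, c, d) := q in
  let m := mid a b in let k := mid c d in
  if Nq q / 4 <= N a m c k then (a, m, c, k)
  else if Nq q / 4 <= N m b c k then (m, b, c, k)
  else if Nq q / 4 <= N a m k d then (a, m, k, d) else (m, b, k, d).
pose q n := iter n step (A, B, C, D).
have qS n : q n.+1 = step (q n) by [].
pose ok (p : R * R * R * R) := [/\ A <= p.1.1.1 <= p.1.1.2, p.1.1.2 <= B,
  C <= p.1.2 <= p.2 & p.2 <= D].
have stepP p : ok p -> [/\ ok (step p),
    (step p).1.1.2 - (step p).1.1.1 = (p.1.1.2 - p.1.1.1) / 2 /\
    (step p).2 - (step p).1.2 = (p.2 - p.1.2) / 2,
    p.1.1.1 <= (step p).1.1.1 /\ (step p).1.1.2 <= p.1.1.2,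
    p.1.2 <= (step p).1.2 /\ (step p).2 <= p.2 & Nq p / 4 <= Nq (step p)].
  case: p => [[[a b] c] d] [/= /andP[Aa ab] bB /andP[Cc cd] dD].
  rewrite /step /=; set m := mid a b; set k := mid c d.
  have am : a <= m by rewrite /m /mid; lra.
  have mb : m <= b by rewrite /m /mid; lra.
  have ck : c <= k by rewrite /k /mid; lra.
  have kd : k <= d by rewrite /k /mid; lra.
  have em : m = (a + b) / 2 by [].
  have ek : k = (c + d) / 2 by [].
  have H : Nq (a, b, c, d) <= N a m c k + N m b c k + N a m k d + N m b k d.
    by apply: Nsub; apply/andP.
  have wa : m - a = (b - a) / 2 by rewrite em; field.
  have wb : b - m = (b - a) / 2 by rewrite em; field.
  have wc : k - c = (d - c) / 2 by rewrite ek; field.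
  have wd : d - k = (d - c) / 2 by rewrite ek; field.
  have Am := le_trans Aa am; have mB := le_trans mb bB.
  have Ck := le_trans Cc ck; have kD := le_trans kd dD.
  case: ifPn => [h1|]; last rewrite -ltNge => h1.
    by rewrite /ok /= Aa am Cc ck mB kD; split; rewrite ?lexx.
  case: ifPn => [h2|]; last rewrite -ltNge => h2.
    by rewrite /ok /= Am mb Cc ck bB kD; split; rewrite ?lexx.
  case: ifPn => [h3|]; last rewrite -ltNge => h3.
    by rewrite /ok /= Aa am Ck kd mB dD; split; rewrite ?lexx.
  rewrite /ok /= Am mb Ck kd bB dD; split; rewrite ?lexx //.
  by move: H h1 h2 h3; rewrite /Nq /=; set x1 := N a b c d;
     set x2 := N a m c k; set x3 := N m b c k; set x4 := N a m k d;
     set x5 := N m b k d; clear => *; lra.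
have qok n : ok (q n).
  elim: n => [|n IH]; last by rewrite qS; case: (stepP _ IH).
  by split => /=; rewrite ?lexx ?andbT.
have wid n : (q n).1.1.2 - (q n).1.1.1 = (B - A) / 2 ^+ n /\
             (q n).2 - (q n).1.2 = (D - C) / 2 ^+ n.
  elim: n => [|n [I1 I2]]; first by rewrite expr0 !divr1.
  rewrite qS; case: (stepP _ (qok n)) => _ [-> ->] _ _ _.
  by rewrite I1 I2 exprS; split; field; rewrite expf_neq0.
have big n : eta / 4 ^+ n <= Nq (q n).
  elim: n => [|n IH]; first by rewrite expr0 divr1.
  rewrite qS; case: (stepP _ (qok n)) => _ _ _ _; apply: le_trans.
  rewrite (_ : eta / _ = (eta / 4 ^+ n) / 4); first by lra.
  by rewrite exprS; field; rewrite expf_neq0.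
(* Nested intervals have a common point: the supremum of the left ends. *)
have nest (f g : R * R * R * R -> R) :
    (forall n, f (q n) <= g (q n)) ->
    (forall n, f (q n) <= f (q n.+1)) -> (forall n, g (q n.+1) <= g (q n)) ->
    exists x, forall n, f (q n) <= x <= g (q n).
  move=> fg f1 g1.
  have fm n p : f (q n) <= f (q (n + p)%N).
    by elim: p => [|p IH]; rewrite ?addn0 // addnS (le_trans IH).
  have gm n p : g (q (n + p)%N) <= g (q n).
    by elim: p => [|p IH]; rewrite ?addn0 // addnS (le_trans _ IH).
  have fgm n p : f (q p) <= g (q n).
    by rewrite (le_trans (fm p n)) // addnC (le_trans (fg _)).
  exists (sup (range (fun n => f (q n)))) => n; apply/andP; split.
    apply: ub_le_sup; last by exists n.
    by exists (g (q n)) => _ [p _ <-].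
  apply: ge_sup; first by exists (f (q 0)), 0%N.
  by move=> _ [p _ <-].
have [x hx] : exists x, forall n, (q n).1.1.1 <= x <= (q n).1.1.2.
  apply: (nest (fun p => p.1.1.1) (fun p => p.1.1.2)) => n.
  - by case: (qok n) => /andP[].
  - by rewrite qS; case: (stepP _ (qok n)) => _ _ [].
  - by rewrite qS; case: (stepP _ (qok n)) => _ _ [].
have [t ht] : exists t, forall n, (q n).1.2 <= t <= (q n).2.
  apply: (nest (fun p => p.1.2) (fun p => p.2)) => n.
  - by case: (qok n) => _ _ /andP[].
  - by rewrite qS; case: (stepP _ (qok n)) => _ _ _ [].
  - by rewrite qS; case: (stepP _ (qok n)) => _ _ _ [].
pose sz := (B - A) + (D - C).
have sz0 : 0 <= sz by rewrite /sz; lra.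
pose e := eta / (2 * (sz ^+ 2 + 1)).
have s1 : 0 < sz ^+ 2 + 1 by rewrite ltr_wpDl ?sqr_ge0.
have e0 : 0 < e by rewrite divr_gt0 // mulr_gt0.
have [dl dl0 H] := Nloc x t (hx 0%N) (ht 0%N) _ e0.
have [n hn] : exists n, sz / 2 ^+ n < dl.
  exists (Num.bound (sz / dl)); rewrite ltr_pdivrMr ?exprn_gt0 //.
  rewrite mulrC -ltr_pdivrMr //.
  have := archi_boundP (divr_ge0 sz0 (ltW dl0)) => /lt_trans; apply.
  by rewrite -natrX ltr_nat ltn_expl.
have [w1 w2] := wid n; case: (qok n) => /andP[g1 g2] g3 /andP[g4 g5] g6.
have /andP[x1 x2] := hx n; have /andP[t1 t2] := ht n.
have p2 : 0 < 2 ^+ n :> R by rewrite exprn_gt0.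
have hw1 : (B - A) / 2 ^+ n <= sz / 2 ^+ n.
  by rewrite ler_pM2r ?invr_gt0 // /sz; lra.
have hw2 : (D - C) / 2 ^+ n <= sz / 2 ^+ n.
  by rewrite ler_pM2r ?invr_gt0 // /sz; lra.
have Hn : Nq (q n) <= e * ((B - A) / 2 ^+ n + (D - C) / 2 ^+ n) ^+ 2.
  rewrite -w1 -w2; apply: H; rewrite ?g1 ?x1 ?x2 ?g3 ?g4 ?t1 ?t2 ?g6 //.
    by rewrite w1 (le_lt_trans hw1).
  by rewrite w2 (le_lt_trans hw2).
have := le_trans (big n) Hn; apply/negP; rewrite -ltNge.
rewrite -mulrDl -/sz expr_div_n -exprM mulnC exprM.
rewrite (_ : 2 ^+ 2 = 4 :> R); last by rewrite expr2; lra.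
rewrite mulrA ltr_pM2r ?invr_gt0 ?exprn_gt0 // /e.
rewrite mulrAC ltr_pdivrMr ?mulr_gt0 // ltr_pM2l //; lra.
Qed.

End Bisection.

Section Goursat.
Variable R : realType.
Implicit Types (a b c d s t : R).

(** Along an edge, an affine integrand is a derivative; only the error of the
    affine approximation is left. *)
Lemma edge_estimate (psi : R[i] -> R[i]) (g g' : R -> R[i]) c d (z0 A B : R[i])
    (e L : R) :
  c <= d -> 0 <= e ->
  (forall t, c <= t <= d -> is_cderive g t (g' t)) -> cont_on c d g ->
  cont_on c d g' ->
  (forall t, c <= t <= d -> {for g t, continuous psi}) ->
  (forall t, c <= t <= d -> normc (psi (g t) - A - B * (g t - z0)) <= e) ->
  (forall t, c <= t <= d -> normc (g' t) <= L) ->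
  normc (cInt c d (fun t => psi (g t) * g' t) -
    (((A - B * z0) * g d + B / 2 * (g d * g d)) -
     ((A - B * z0) * g c + B / 2 * (g c * g c)))) <= e * L * (d - c).
Proof.
move=> cd e0 hg cg cg' cpsi hpsi hL.
have cpg : cont_on c d (fun t => psi (g t)) by apply: cont_on_comp.
have caf : cont_on c d (fun t => (A + B * (g t - z0)) * g' t).
  apply: ccontM => //; apply: ccontD; first exact: ccont_cst.
  apply: ccontM; first exact: ccont_cst.
  by apply: ccontD => //; exact: ccont_cst.
rewrite -(@cInt_FTC _ c d (fun t => (A + B * (g t - z0)) * g' t)
   (fun t => (A - B * z0) * g t + B / 2 * (g t * g t))) //; last first.
  move=> t /hg dg.
  rewrite (_ : (A + _) * g' t = ((A - B * z0) * g' t + 0 * g t) +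
     (B / 2 * (g t * g' t + g' t * g t) + 0 * (g t * g t))); last by field.
  apply: is_cderiveD; apply: is_cderiveM => //; try exact: is_cderive_cst.
  exact: is_cderiveM.
rewrite -cIntB //; last exact: ccontM.
apply: cInt_le_cst => //.
  apply: ccontD; first exact: ccontM.
  exact: ccontN.
move=> t ht; rewrite -mulrBl normcM ler_pM ?normc_ge0 ?hL //.
by rewrite opprD addrA hpsi.
Qed.

(** The defect of this identity is additive over subrectangles.  Near each
    point psi is affine up to an error that is infinitesimal compared with the
    size, so by [edge_estimate] the defect is infinitesimal compared with its
    square, and [bisection_le0] applies. *)
Theorem goursat (psi : R[i] -> R[i]) (F Fs Ft : R -> R -> R[i]) s1 s2 t1 t2 L :
  s1 <= s2 -> t1 <= t2 ->
  (forall s t, s1 <= s <= s2 -> t1 <= t <= t2 ->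
     [/\ is_cderive (F s) t (Ft s t), is_cderive (F^~ t) s (Fs s t),
         normc (Ft s t) <= L, normc (Fs s t) <= L & derivable psi (F s t) 1]) ->
  (forall s, s1 <= s <= s2 -> cont_on t1 t2 (F s) /\ cont_on t1 t2 (Ft s)) ->
  (forall t, t1 <= t <= t2 -> cont_on s1 s2 (F^~ t) /\ cont_on s1 s2 (Fs^~ t)) ->
  cInt t1 t2 (fun t => psi (F s2 t) * Ft s2 t) -
  cInt t1 t2 (fun t => psi (F s1 t) * Ft s1 t) =
  cInt s1 s2 (fun s => psi (F s t2) * Fs s t2) -
  cInt s1 s2 (fun s => psi (F s t1) * Fs s t1).
Proof.
move=> s12 t12 H cF_t cF_s.
pose Et s c d := cInt c d (fun t => psi (F s t) * Ft s t).
pose Es t a b := cInt a b (fun s => psi (F s t) * Fs s t).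
pose Phi a b c d := (Et b c d - Et a c d) - (Es d a b - Es c a b).
have cEt s : s1 <= s <= s2 -> cont_on t1 t2 (fun t => psi (F s t) * Ft s t).
  move=> hs; have [c1 c2] := cF_t s hs; apply: ccontM => //.
  apply: cont_on_comp c1 => t ht; apply: derivable_continuous_pt.
  by case: (H s t hs ht).
have cEs t : t1 <= t <= t2 -> cont_on s1 s2 (fun s => psi (F s t) * Fs s t).
  move=> ht; have [c1 c2] := cF_s t ht; apply: ccontM => //.
  apply: cont_on_comp c1 => s hs; apply: derivable_continuous_pt.
  by case: (H s t hs ht).
have EtD s c k d : s1 <= s <= s2 -> t1 <= c <= k -> k <= d <= t2 ->
    Et s c d = Et s c k + Et s k d.
  move=> hs /andP[h1 h2] /andP[h3 h4]; apply: cInt_split => //.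
  exact: cont_onS (cEt s hs).
have EsD t a m b : t1 <= t <= t2 -> s1 <= a <= m -> m <= b <= s2 ->
    Es t a b = Es t a m + Es t m b.
  move=> ht /andP[h1 h2] /andP[h3 h4]; apply: cInt_split => //.
  exact: cont_onS (cEs t ht).
have L0 : 0 <= L.
  have := H s1 t1; rewrite !lexx s12 t12 => /(_ isT isT) [_ _ h _ _].
  exact: le_trans (normc_ge0 _) h.
have lipt s t t' : s1 <= s <= s2 -> t1 <= t -> t <= t' -> t' <= t2 ->
    normc (F s t' - F s t) <= L * (t' - t).
  move=> hs h1 tt' h2; have [_ c2] := cF_t s hs.
  have hb x : t <= x <= t' -> t1 <= x <= t2.
    by move=> /andP[p1 p2]; rewrite (le_trans h1) //= (le_trans p2).
  rewrite -(@cInt_FTC _ t t' (Ft s)) //; last first.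
  - by move=> x /hb hx; case: (H s x hs hx).
  - exact: cont_onS c2.
  apply: cInt_le_cst => //; first exact: cont_onS c2.
  by move=> x /hb hx; case: (H s x hs hx).
have lips t s s' : t1 <= t <= t2 -> s1 <= s -> s <= s' -> s' <= s2 ->
    normc (F s' t - F s t) <= L * (s' - s).
  move=> ht h1 ss' h2; have [_ c2] := cF_s t ht.
  have hb x : s <= x <= s' -> s1 <= x <= s2.
    by move=> /andP[p1 p2]; rewrite (le_trans h1) //= (le_trans p2).
  rewrite -(@cInt_FTC _ s s' (Fs^~ t)  (F^~ t)) //; last first.
  - by move=> x /hb hx; case: (H x t hx ht).
  - exact: cont_onS c2.
  apply: cInt_le_cst => //; first exact: cont_onS c2.
  by move=> x /hb hx; case: (H x t hx ht).
have lip s s' t t' a b c d : s1 <= a -> b <= s2 -> t1 <= c -> d <= t2 ->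
    a <= s <= b -> a <= s' <= b -> c <= t <= d -> c <= t' <= d ->
    normc (F s t - F s' t') <= L * ((b - a) + (d - c)).
  move=> s1a bs2 t1c dt2 /andP[as_ sb] /andP[as' s'b] /andP[ct td] /andP[ct' t'd].
  have hs : s1 <= s <= s2 by lra.
  have ht' : t1 <= t' <= t2 by lra.
  have -> : F s t - F s' t' = (F s t' - F s' t') + (F s t - F s t') by ring.
  rewrite (le_trans (le_normcD _ _)) // mulrDr lerD //.
    have [h|/ltW h] := leP s s'.
      rewrite normcB (le_trans (lips _ _ _ ht' _ h _)) //; try lra.
      by rewrite ler_wpM2l //; lra.
    rewrite (le_trans (lips _ _ _ ht' _ h _)) //; try lra.
    by rewrite ler_wpM2l //; lra.
  have [h|/ltW h] := leP t t'.
    rewrite normcB (le_trans (lipt _ _ _ hs _ h _)) //; try lra.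
    by rewrite ler_wpM2l //; lra.
  rewrite (le_trans (lipt _ _ _ hs _ h _)) //; try lra.
  by rewrite ler_wpM2l //; lra.
suff : normc (Phi s1 s2 t1 t2) <= 0.
  rewrite le_eqVlt ltNge normc_ge0 orbF normc_eq0 subr_eq0 => /eqP.
  by [].
apply: (bisection_le0 (N := fun a b c d => normc (Phi a b c d))) => //.
  move=> a m b c k d am mb ck kd.
  have E : Phi a b c d = Phi a m c k + Phi m b c k + Phi a m k d + Phi m b k d.
    move: am mb ck kd => /andP[a1 a2] /andP[b1 b2] /andP[c1 c2] /andP[d1 d2].
    rewrite /Phi (EtD a c k d) ?(EtD b c k d) ?(EsD c a m b) ?(EsD d a m b);
      first (by ring); apply/andP; split; lra.
  rewrite E; do 3 (rewrite (le_trans (le_normcD _ _)) // lerD2r).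
move=> x t hx ht e e0.
pose e1 := e / (2 * (L ^+ 2 + 1)).
have L1 : 0 < L ^+ 2 + 1 by rewrite ltr_wpDl ?sqr_ge0.
have e10 : 0 < e1 by rewrite divr_gt0 // mulr_gt0.
pose z0 := F x t; pose B := derive1 psi z0; pose A := psi z0.
have hpsi : derivable psi z0 1 by case: (H x t hx ht).
have [dl dl0 Hd] := derivable_normcP hpsi e10.
exists (dl / (2 * (L + 1))); first by rewrite divr_gt0 // mulr_gt0 // ltr_wpDl.
move=> a b c d /andP[s1a ax] /andP[xb bs2] /andP[t1c ct] /andP[td dt2] ba dc.
have sz : L * ((b - a) + (d - c)) < dl.
  have Lp : 0 < L + 1 by rewrite ltr_wpDl.
  rewrite ltr_pdivlMr ?mulr_gt0 // in ba; rewrite ltr_pdivlMr ?mulr_gt0 // in dc.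
  nra.
have close s' t' : a <= s' <= b -> c <= t' <= d ->
    normc (psi (F s' t') - A - B * (F s' t' - z0)) <=
    e1 * (L * ((b - a) + (d - c))).
  move=> hs' ht'.
  have h : normc (F s' t' - z0) <= L * ((b - a) + (d - c)).
    by apply: lip => //; apply/andP.
  rewrite (le_trans (Hd _ _)) //; first exact: le_lt_trans sz.
  by rewrite ler_wpM2l // ltW.
pose P z := (A - B * z0) * z + B / 2 * (z * z).
have ab : a <= b by lra.
have cd : c <= d by lra.
have sz0 : 0 <= e1 * (L * ((b - a) + (d - c))).
  apply: mulr_ge0; first exact: ltW.
  by apply: mulr_ge0 => //; apply: addr_ge0; rewrite subr_ge0.
have het s : a <= s <= b -> normc (Et s c d - (P (F s d) - P (F s c))) <=
    e1 * (L * ((b - a) + (d - c))) * L * (d - c).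
  move=> hs; have hs' : s1 <= s <= s2 by lra.
  have hb y : c <= y <= d -> t1 <= y <= t2 by lra.
  have [c1 c2] := cF_t s hs'.
  apply: (@edge_estimate psi (F s) (Ft s) c d z0 A B _ L cd sz0).
  - by move=> y /hb hy; case: (H s y hs' hy).
  - exact: cont_onS c1.
  - exact: cont_onS c2.
  - move=> y /hb hy; apply: derivable_continuous_pt; by case: (H s y hs' hy).
  - by move=> y hy; exact: close.
  - by move=> y /hb hy; case: (H s y hs' hy).
have hes y : c <= y <= d -> normc (Es y a b - (P (F b y) - P (F a y))) <=
    e1 * (L * ((b - a) + (d - c))) * L * (b - a).
  move=> hy; have hy' : t1 <= y <= t2 by lra.
  have hb s : a <= s <= b -> s1 <= s <= s2 by lra.
  have [c1 c2] := cF_s y hy'.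
  apply: (@edge_estimate psi (F^~ y) (Fs^~ y) a b z0 A B _ L ab sz0).
  - by move=> s /hb hs; case: (H s y hs hy').
  - exact: cont_onS c1.
  - exact: cont_onS c2.
  - move=> s /hb hs; apply: derivable_continuous_pt; by case: (H s y hs hy').
  - by move=> s hs; exact: close.
  - by move=> s /hb hs; case: (H s y hs hy').
have E : Phi a b c d =
    ((Et b c d - (P (F b d) - P (F b c))) - (Et a c d - (P (F a d) - P (F a c))))
  - ((Es d a b - (P (F b d) - P (F a d))) - (Es c a b - (P (F b c) - P (F a c)))).
  by rewrite /Phi; ring.
have hB (z w : R[i]) k l : normc z <= k -> normc w <= l -> normc (z - w) <= k + l.
  move=> h1 h2; rewrite (le_trans (le_normcD _ _)) // normcN lerD //.
have F1 : a <= b <= b by rewrite ab lexx.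
have F2 : a <= a <= b by rewrite ab lexx.
have F3 : c <= d <= d by rewrite cd lexx.
have F4 : c <= c <= d by rewrite cd lexx.
rewrite E (le_trans (hB _ _ _ _ (hB _ _ _ _ (het b F1) (het a F2))
                      (hB _ _ _ _ (hes d F3) (hes c F4)))) //.
set u := (b - a) + (d - c).
rewrite (_ : _ + _ = 2 * e1 * L ^+ 2 * u ^+ 2); last by rewrite /u; ring.
rewrite ler_wpM2r ?sqr_ge0 // /e1.
rewrite (_ : _ * _ = (e * L ^+ 2) / (L ^+ 2 + 1)); last first.
  by field; rewrite gt_eqF.
by rewrite ler_pdivrMr // ler_wpM2l ?(ltW e0) // lerDl.
Qed.

End Goursat.

(** * Cauchy's formula *)

Section Cauchy.
Variable R : realType.
Implicit Types (a b c d s t r : R) (f g : R[i] -> R[i]) (z w : R[i]).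

(* Complex instances of the rules for derivatives. *)
Lemma cderD f g z : derivable f z 1 -> derivable g z 1 ->
  derivable (fun x => f x + g x) z 1.
Proof. exact: derivableD. Qed.

Lemma cderB f g z : derivable f z 1 -> derivable g z 1 ->
  derivable (fun x => f x - g x) z 1.
Proof. exact: derivableB. Qed.

Lemma cderM f g z : derivable f z 1 -> derivable g z 1 ->
  derivable (fun x => f x * g x) z 1.
Proof. exact: derivableM. Qed.

Lemma cderV f z : f z != 0 -> derivable f z 1 ->
  derivable (fun x => (f x)^-1) z 1.
Proof. exact: (@derivableV R[i] R[i] f). Qed.

Lemma cder_cst (k : R[i]) z : derivable (fun=> k) z 1.
Proof. exact: derivable_cst. Qed.

Lemma cder_id z : derivable (fun x => x) z 1.
Proof. exact: derivable_id. Qed.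

Lemma cderX f z n : derivable f z 1 -> derivable (fun x => f x ^+ n) z 1.
Proof.
move=> hf; elim: n => [|n IH].
  by under eq_fun do rewrite expr0; exact: cder_cst.
by under eq_fun do rewrite exprS; exact: cderM.
Qed.

Lemma cder_sum (I : Type) (s : seq I) (F : I -> R[i] -> R[i]) z :
  (forall i, derivable (F i) z 1) ->
  derivable (fun x => \sum_(i <- s) F i x) z 1.
Proof.
move=> hF; elim: s => [|i s IH].
  by under eq_fun do rewrite big_nil; exact: cder_cst.
by under eq_fun do rewrite big_cons; exact: (cderD (hF i) IH).
Qed.

Lemma derivable_divB f z w : z != w -> derivable f z 1 ->
  derivable (fun x => f x / (x - w)) z 1.
Proof.
move=> zw hf; apply: (cderM hf); apply: cderV; first by rewrite subr_eq0.
by apply: cderB; [exact: cder_id|exact: cder_cst].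
Qed.

(** Goursat's theorem on the annular sectors swept by circular arcs whose centre
    and radius move linearly. *)
Lemma goursat_arc (psi : R[i] -> R[i]) (c0 c1 : R[i]) r0 r1 s1 s2 t1 t2
  (F := fun s t => (c0 + s%:C * c1) + (r0 + s * r1)%:C * expi t) :
  s1 <= s2 -> t1 <= t2 ->
  (forall s t, s1 <= s <= s2 -> t1 <= t <= t2 -> derivable psi (F s t) 1) ->
  cInt t1 t2 (fun t => psi (F s2 t) * ((r0 + s2 * r1)%:C * ('i * expi t))) -
  cInt t1 t2 (fun t => psi (F s1 t) * ((r0 + s1 * r1)%:C * ('i * expi t))) =
  cInt s1 s2 (fun s => psi (F s t2) * (c1 + r1%:C * expi t2)) -
  cInt s1 s2 (fun s => psi (F s t1) * (c1 + r1%:C * expi t1)).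
Proof.
move=> s12 t12 hpsi.
pose L := normc c1 + (`|r0| + (`|s1| + `|s2|) * `|r1|) + `|r1|.
have nexpi t : normc ('i * expi t) = 1 :> R.
  by rewrite normcM normc_expi mulr1 /= expr0n expr1n add0r sqrtr1.
apply: (@goursat _ psi F (fun s t => c1 + r1%:C * expi t)
  (fun s t => (r0 + s * r1)%:C * ('i * expi t)) s1 s2 t1 t2 L) => //.
- move=> s t hs ht; split; last exact: hpsi.
  + rewrite -[X in is_cderive _ _ X]addr0 addrC; apply: is_cderiveD.
      exact: is_cderive_cst.
    rewrite -[X in is_cderive _ _ X]addr0 -(mul0r (expi t)).
    by apply: is_cderiveM; [exact: is_cderive_cst|exact: is_cderive_expi].
  + have dr k : is_cderive (fun s : R => s%:C * k) s k.
      rewrite -[X in is_cderive _ _ X]add0r -(mulr0 s%:C) -{2}(mul1r k).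
      by apply: is_cderiveM; [exact: is_cderive_real|exact: is_cderive_cst].
    apply: is_cderiveD.
      rewrite -[X in is_cderive _ _ X]add0r.
      by apply: is_cderiveD; [exact: is_cderive_cst|].
    rewrite -[X in is_cderive _ _ X]add0r.
    rewrite (_ : (fun x : R => (r0 + x * r1)%:C * expi t) =
      (fun x : R => r0%:C * expi t + x%:C * (r1%:C * expi t))).
      by apply: is_cderiveD; [exact: is_cderive_cst|].
    by apply/funext => x; rewrite rmorphD rmorphM mulrDl mulrA.
  + rewrite normcM nexpi mulr1 normc_real /L (le_trans (ler_normD _ _)) //.
    rewrite normrM -addrA ler_wpDl ?normc_ge0 // -addrA lerD2l ler_wpDr //.
    apply: ler_wpM2r => //; move: hs => /andP[h1 h2].
    have := ler_norm s2; have := ler_norm (- s1); rewrite normrN => h3 h4.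
    by rewrite ler_norml; have := normr_ge0 s1; have := normr_ge0 s2; lra.
  + rewrite (le_trans (le_normcD _ _)) // normc_polar /L -addrA lerD2l.
    by rewrite lerDr addr_ge0 // mulr_ge0 // addr_ge0.
- move=> s hs; split.
    by apply: ccontD; [exact: ccont_cst|apply: ccontZ; exact: cont_on_expi].
  by do 2 apply: ccontZ; exact: cont_on_expi.
- move=> t ht; split; last exact: ccont_cst.
  apply: ccontD.
    apply: ccontD; first exact: ccont_cst.
    by apply: ccontM; [exact: ccont_real|exact: ccont_cst].
  apply: ccontM; last exact: ccont_cst.
  apply: (cont_on_comp (h := fun s => r0 + s * r1)).
    by move=> *; exact: real_complex_continuous.
  apply: cont_onD; first exact: cont_on_cst.
  apply: cont_onM; last exact: cont_on_cst.
  by apply/cont_onP => x _; exact: cvg_id.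
Qed.

(** [goursat_arc] for circles centred at the origin, applied to phi(z) / z: dz / z
    is i dt along the arcs and dx / x along the radial edges. *)
Lemma goursat_sector (phi : R[i] -> R[i]) x1 x2 t1 t2 :
  0 < x1 -> x1 <= x2 -> t1 <= t2 ->
  (forall x t, x1 <= x <= x2 -> t1 <= t <= t2 ->
     derivable phi (x%:C * expi t) 1) ->
  'i * (cInt t1 t2 (fun t => phi (x2%:C * expi t)) -
        cInt t1 t2 (fun t => phi (x1%:C * expi t))) =
  cInt x1 x2 (fun x => phi (x%:C * expi t2) / x%:C) -
  cInt x1 x2 (fun x => phi (x%:C * expi t1) / x%:C).
Proof.
move=> x10 x12 t12 hphi.
have nz x t : x1 <= x -> x%:C * expi t != 0.
  move=> hx; rewrite mulf_neq0 ?expi_neq0 //.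
  by rewrite -normc_gt0 normc_real normr_gt0 gt_eqF // (lt_le_trans x10).
have := @goursat_arc (fun z => phi z / (z - 0)) 0 0 0 1 x1 x2 t1 t2 x12 t12.
have FE (x t : R) : 0 + x%:C * 0 + (0 + x * 1)%:C * expi t = x%:C * expi t.
  by rewrite mulr0 !add0r mulr1.
move=> H; rewrite mulrBr -!cIntZ; last first.
- apply: cont_on_circle => t ht; apply: derivable_continuous_pt.
  by apply: hphi; rewrite ?lexx ?x12.
- apply: cont_on_circle => t ht; apply: derivable_continuous_pt.
  by apply: hphi; rewrite ?lexx ?x12.
have tr x : x1 <= x -> cInt t1 t2 (fun t => 'i * phi (x%:C * expi t)) =
   cInt t1 t2 (fun t => phi (0 + x%:C * 0 + (0 + x * 1)%:C * expi t) /
      (0 + x%:C * 0 + (0 + x * 1)%:C * expi t - 0) *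
      ((0 + x * 1)%:C * ('i * expi t))).
  move=> hx; apply: eq_cInt => t ht; rewrite FE subr0 add0r mulr1.
  have n0 := nz x t hx; rewrite mulf_eq0 negb_or in n0.
  case/andP: n0 => n1 n2.
  by set p := phi _; field; rewrite n1 n2.
have tr2 t : cInt x1 x2 (fun x => phi (x%:C * expi t) / x%:C) =
   cInt x1 x2 (fun x => phi (0 + x%:C * 0 + (0 + x * 1)%:C * expi t) /
      (0 + x%:C * 0 + (0 + x * 1)%:C * expi t - 0) * (0 + 1%:C * expi t)).
  apply: eq_cInt => x /andP[hx _]; rewrite FE subr0 add0r mul1r.
  have n0 := nz x t hx; rewrite mulf_eq0 negb_or in n0.
  case/andP: n0 => n1 n2.
  by set p := phi _; field; rewrite n1 n2.
rewrite (tr x2) // (tr x1) // (tr2 t2) (tr2 t1); apply: H => s t hs ht.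
rewrite FE; apply: derivable_divB; last exact: hphi.
by apply: nz; case/andP: hs.
Qed.

(** The starting angle is a parameter so that an arc on which the integrand
    needs special treatment can be put inside the period. *)
Definition cmean a r (phi : R[i] -> R[i]) : R[i] :=
  (2 * pi)^-1%:C * cInt a (a + 2 * pi) (fun t => phi (r%:C * expi t)).

Let pi2 : 0 < 2 * pi :> R. Proof. by rewrite mulr_gt0 // pi_gt0. Qed.

(** The circle of radius r around 0 is deformed, through circles that contain w,
    to arbitrarily small circles around w. *)
Lemma cauchy_formula f a r w : holomorphic f -> normc w < r -> r < 1 ->
  cmean a r (fun z => f z * (z / (z - w))) = f w.
Proof.
move=> hf wr r1.
have r0 : 0 < r by rewrite (le_lt_trans (normc_ge0 w)).
have w1 : normc w < 1 by rewrite (lt_trans wr).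
have a2 : a <= a + 2 * pi by rewrite lerDl ltW.
(* F s interpolates between the circle around w (s = 0) and that around 0. *)
have shrink e : 0 < e -> e < r - normc w ->
    cInt a (a + 2 * pi) (fun t => let z := r%:C * expi t in f z * (z / (z - w)))
    = cInt a (a + 2 * pi) (fun t => f (w + e%:C * expi t)).
  move=> e0 er.
  pose F (s t : R) : R[i] := (w + s%:C * - w) + (e + s * (r - e))%:C * expi t.
  have Fw s t : 0 <= s <= 1 -> F s t != w.
    move=> /andP[s0 s1]; rewrite -subr_eq0 -normc_gt0.
    have -> : F s t - w = (e + s * (r - e))%:C * expi t - s%:C * w.
      by rewrite /F; ring.
    rewrite (lt_le_trans _ (le_normcB _ _)) // normc_polar normcM normc_real.
    by rewrite !ger0_norm; have := normc_ge0 w; nra.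
  have FD s t : 0 <= s <= 1 -> unit_disk (F s t).
    move=> /andP[s0 s1]; rewrite /unit_disk /mkset.
    have -> : F s t = (1 - s)%:C * w + (e + s * (r - e))%:C * expi t.
      by rewrite /F rmorphB /=; ring.
    rewrite (le_lt_trans (le_normcD _ _)) // normc_polar normcM normc_real.
    by rewrite !ger0_norm; have := normc_ge0 w; nra.
  have F0 t : F 0 t = w + e%:C * expi t.
    by rewrite /F !mul0r !addr0.
  have F1 t : F 1 t = r%:C * expi t.
    by rewrite /F !mul1r subrr add0r addrC subrK.
  have H : cInt a (a + 2 * pi) (fun t => f (F 1 t) / (F 1 t - w) *
        ((e + 1 * (r - e))%:C * ('i * expi t))) =
      cInt a (a + 2 * pi) (fun t => f (F 0 t) / (F 0 t - w) *
        ((e + 0 * (r - e))%:C * ('i * expi t))).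
    apply/eqP; rewrite -subr_eq0; apply/eqP.
    rewrite (@goursat_arc (fun z => f z / (z - w)) w (- w) e (r - e) 0 1 a
      (a + 2 * pi) ler01 a2).
      rewrite (_ : cInt 0 1 _ = cInt 0 1
        (fun s => f (F s a) / (F s a - w) * (- w + (r - e)%:C * expi a))) ?subrr //.
      by apply: eq_cInt => s _; rewrite /F !expiD2pi.
    move=> s t hs ht; apply: derivable_divB; first exact: Fw.
    by apply: hf; exact: FD.
  have i0 : 'i != 0 :> R[i] by rewrite eq_complex /= oner_eq0 andbF.
  apply: (mulfI i0); rewrite -!cIntZ; last first.
  - apply: (cont_on_comp (h := fun t => r%:C * expi t)
      (g := fun z => f z * (z / (z - w)))); last first.
      by apply: ccontZ; exact: cont_on_expi.
    move=> t _; apply: derivable_continuous_pt.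
    have d1 : derivable f (r%:C * expi t) 1.
      by apply: hf; rewrite /unit_disk /mkset normc_polar gtr0_norm.
    apply: (cderM d1); apply: derivable_divB; last exact: cder_id.
    by rewrite -(F1 t); apply: Fw; rewrite ler01 lexx.
  - apply: (cont_on_comp (h := fun t => w + e%:C * expi t)); last first.
      by apply: ccontD; [exact: ccont_cst|apply: ccontZ; exact: cont_on_expi].
    move=> t _; apply: derivable_continuous_pt; apply: hf.
    by rewrite -F0; apply: FD; rewrite lexx ler01.
  transitivity (cInt a (a + 2 * pi) (fun t => f (F 1 t) / (F 1 t - w) *
        ((e + 1 * (r - e))%:C * ('i * expi t)))).
    apply: eq_cInt => t _; rewrite F1 mul1r (_ : e + (r - e) = r); last by ring.
    have alg (I p x E q : R[i]) : I * (p * (x * E * q)) = p * q * (x * (I * E)).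
      by ring.
    exact: alg.
  rewrite H; apply: eq_cInt => t _; rewrite F0 mul0r addr0.
  rewrite (_ : w + e%:C * expi t - w = e%:C * expi t); last by ring.
  have n1 := @expi_neq0 R t.
  have n2 : e%:C != 0 :> R[i] by rewrite -normc_gt0 normc_real gtr0_norm.
  have alg (I p x E : R[i]) : x != 0 -> E != 0 -> p / (x * E) * (x * (I * E)) = I * p.
    by move=> x0 E0; field; rewrite x0 E0.
  exact: alg.
rewrite /cmean; set I := cInt _ _ _.
have hI e : 0 < e -> normc (I - (2 * pi)%:C * f w) <= e.
  move=> e0; have w1' : unit_disk w by [].
  have := derivable_continuous_pt (hf w w1').
  move/(cvg_normcP (nbhs_filter w)) => /(_ (e / (2 * pi))).
  rewrite divr_gt0 // => /(_ isT) /near_normcP [d d0 hd].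
  pose e1 := Num.min (d / 2) ((r - normc w) / 2).
  have e10 : 0 < e1 by rewrite lt_min !divr_gt0 // subr_gt0.
  have e1d : e1 < d by rewrite gt_min; apply/orP; left; lra.
  have e1r : e1 < r - normc w by rewrite gt_min; apply/orP; right; lra.
  rewrite /I (shrink e1) //.
  have cw : cont_on a (a + 2 * pi) (fun=> f w) by exact: ccont_cst.
  have ce : cont_on a (a + 2 * pi) (fun t => f (w + e1%:C * expi t)).
    apply: (cont_on_comp (h := fun t => w + e1%:C * expi t)); last first.
      by apply: ccontD; [exact: ccont_cst|apply: ccontZ; exact: cont_on_expi].
    move=> t _; apply: derivable_continuous_pt; apply: hf.
    rewrite /unit_disk /mkset (le_lt_trans (le_normcD _ _)) // normc_polar.
    by rewrite gtr0_norm // (lt_trans _ r1) // -ltrBrDl.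
  have -> : (2 * pi)%:C * f w = cInt a (a + 2 * pi) (fun=> f w).
    rewrite -[RHS]/(cInt _ _ (fun t => f w)).
    rewrite -(eq_cInt (h := fun t => f w * (1%:C))); last by move=> t _; rewrite mulr1.
    rewrite cIntZ; last exact: ccont_cst.
    by rewrite cInt_real rInt_cst // mul1r addrAC subrr add0r mulrC.
  rewrite -cIntB // (le_trans (cInt_le_cst (K := e / (2 * pi)) a2 _ _)) //.
  - exact: ccontB.
  - move=> t _; apply/ltW/hd; rewrite addrAC subrr add0r normc_polar.
    by rewrite gtr0_norm.
  - by rewrite addrAC subrr add0r divfK // gt_eqF.
have -> : I = (2 * pi)%:C * f w.
  apply/eqP; rewrite -subr_eq0 -normc_eq0 eq_le normc_ge0 andbT.
  by apply/ler_addgt0Pl => e /hI; rewrite addr0.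
by rewrite mulrA -rmorphM mulVf ?gt_eqF // mul1r.
Qed.

Lemma mean_value f a r : holomorphic f -> 0 < r -> r < 1 -> cmean a r f = f 0.
Proof.
move=> hf r0 r1; rewrite -(@cauchy_formula f a r 0) ?normc0 //.
congr (_ * _); apply: eq_cInt => t _; rewrite subr0 divff ?mulr1 //.
by rewrite -normc_gt0 normc_polar gtr0_norm.
Qed.

End Cauchy.

(** * Means over circles *)

Section CircleMeans.
Variable R : realType.
Implicit Types (a b r : R) (f g h phi psi : R[i] -> R[i]) (z w : R[i]).

Let pi2 : 0 < 2 * pi :> R. Proof. by rewrite mulr_gt0 // pi_gt0. Qed.
Let pi2a a : a <= a + 2 * pi. Proof. by rewrite lerDl (ltW pi2). Qed.

Lemma holB f g : holomorphic f -> holomorphic g -> holomorphic (fun z => f z - g z).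
Proof. by move=> hf hg z hz; apply: cderB; [exact: hf|exact: hg]. Qed.

Lemma holM f g : holomorphic f -> holomorphic g -> holomorphic (fun z => f z * g z).
Proof. by move=> hf hg z hz; apply: cderM; [exact: hf|exact: hg]. Qed.

Lemma hol_cst (k : R[i]) : holomorphic (fun=> k).
Proof. by move=> z hz; exact: cder_cst. Qed.

Lemma hol_id : holomorphic (fun z : R[i] => z).
Proof. by move=> z hz; exact: cder_id. Qed.

Lemma holX f n : holomorphic f -> holomorphic (fun z => f z ^+ n).
Proof. by move=> hf z hz; apply: cderX; exact: hf. Qed.

Lemma hol_sum (I : Type) (s : seq I) (F : I -> R[i] -> R[i]) :
  (forall i, holomorphic (F i)) -> holomorphic (fun z => \sum_(i <- s) F i z).
Proof. by move=> hF z hz; apply: cder_sum => i; exact: hF. Qed.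

Lemma disk_polar r (t : R) : 0 <= r -> r < 1 -> unit_disk (r%:C * expi t).
Proof. by move=> r0 r1; rewrite /unit_disk /mkset normc_polar ger0_norm. Qed.

Lemma hol_circle f a b r : holomorphic f -> 0 <= r -> r < 1 ->
  cont_on a b (fun t => f (r%:C * expi t)).
Proof.
move=> hf r0 r1; apply: cont_on_circle => t _; apply: derivable_continuous_pt.
by apply: hf; exact: disk_polar.
Qed.

(** The side condition under which means over circles are linear. *)
Definition on_circ a r phi := cont_on a (a + 2 * pi) (fun t => phi (r%:C * expi t)).

Lemma cmean_ext a r phi psi : 0 <= r -> (forall z, normc z = r -> phi z = psi z) ->
  cmean a r phi = cmean a r psi.
Proof.
move=> r0 H; congr (_ * _); apply: eq_cInt => t _; apply: H.
by rewrite normc_polar ger0_norm.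
Qed.

Lemma cmeanD a r phi psi : on_circ a r phi -> on_circ a r psi ->
  cmean a r (fun z => phi z + psi z) = cmean a r phi + cmean a r psi.
Proof. by move=> h1 h2; rewrite /cmean cIntD // mulrDr. Qed.

Lemma cmeanB a r phi psi : on_circ a r phi -> on_circ a r psi ->
  cmean a r (fun z => phi z - psi z) = cmean a r phi - cmean a r psi.
Proof. by move=> h1 h2; rewrite /cmean cIntB // mulrBr. Qed.

Lemma cmeanZ a r k phi : on_circ a r phi ->
  cmean a r (fun z => k * phi z) = k * cmean a r phi.
Proof. by move=> h1; rewrite /cmean cIntZ // mulrCA. Qed.

Lemma cmean_sum a r (I : Type) (s : seq I) (F : I -> R[i] -> R[i]) :
  (forall i, on_circ a r (F i)) ->
  cmean a r (fun z => \sum_(i <- s) F i z) = \sum_(i <- s) cmean a r (F i).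
Proof. by move=> hF; rewrite /cmean cInt_sum // mulr_sumr. Qed.

Lemma cmean_conj a r phi : on_circ a r phi ->
  cmean a r (fun z => conjc (phi z)) = conjc (cmean a r phi).
Proof.
move=> h1; rewrite /cmean conjcM; congr (_ * _); first exact/esym/conjcR.
rewrite /cInt; congr (_ +i* _).
  by apply: rInt_eq => t _; case: (phi _).
rewrite -mulN1r -rIntZ; last exact: cont_on_Im.
by apply: rInt_eq => t _; case: (phi _) => x y /=; rewrite mulN1r.
Qed.

Definition rmean a r (g : R[i] -> R) : R :=
  (2 * pi)^-1 * rInt a (a + 2 * pi) (fun t => g (r%:C * expi t)).

Lemma cmean_le a r phi : on_circ a r phi ->
  normc (cmean a r phi) <= rmean a r (fun z => normc (phi z)).
Proof.
move=> h1; rewrite /cmean /rmean normcM normc_real ger0_norm ?invr_ge0 ?(ltW pi2) //.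
by apply: ler_wpM2l; [rewrite invr_ge0 (ltW pi2)|exact: cInt_le].
Qed.

Lemma cmean_le_cst a r phi K : on_circ a r phi ->
  (forall t, a <= t <= a + 2 * pi -> normc (phi (r%:C * expi t)) <= K) ->
  normc (cmean a r phi) <= K.
Proof.
move=> h1 H; rewrite (le_trans (cmean_le h1)) // /rmean.
rewrite mulrC ler_pdivrMr // (le_trans (rInt_le (g := fun=> K) _ _ _)) //.
- exact: cont_on_normc.
- exact: cont_on_cst.
- by rewrite rInt_cst // addrAC subrr add0r.
Qed.

Definition msq a r phi : R := rmean a r (fun z => normc (phi z) ^+ 2).

Lemma msqE a r phi : (msq a r phi)%:C = cmean a r (fun z => phi z * conjc (phi z)).
Proof.
rewrite /msq /rmean /cmean rmorphM; congr (_ * _).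
apply: (etrans (esym (cInt_real _ _ _))).
by apply: eq_cInt => t _; rewrite mulJc.
Qed.

Lemma msq_ge0 a r phi : 0 <= msq a r phi.
Proof.
rewrite /msq /rmean mulr_ge0 ?invr_ge0 ?(ltW pi2) //.
by apply: rInt_ge0 => t _; rewrite sqr_ge0.
Qed.

Lemma msq_le a r phi K : 0 <= r -> on_circ a r phi ->
  (forall z, normc z = r -> normc (phi z) ^+ 2 <= K) -> msq a r phi <= K.
Proof.
move=> r0 h1 H; rewrite /msq /rmean mulrC ler_pdivrMr //.
rewrite (le_trans (rInt_le (g := fun=> K) _ _ _)) //.
- by apply: cont_onX; exact: cont_on_normc.
- exact: cont_on_cst.
- by move=> t _; apply: H; rewrite normc_polar ger0_norm.
- by rewrite rInt_cst // addrAC subrr add0r.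
Qed.

Lemma msq_leM a r phi psi M : 0 <= r -> on_circ a r phi -> on_circ a r psi ->
  (forall z, normc z = r -> normc (phi z) <= M * normc (psi z)) ->
  msq a r phi <= M ^+ 2 * msq a r psi.
Proof.
move=> r0 h1 h2 H; rewrite /msq /rmean mulrCA; apply: ler_wpM2l; first by rewrite invr_ge0 (ltW pi2).
have c2 : cont_on a (a + 2 * pi) (fun t => normc (psi (r%:C * expi t)) ^+ 2).
  by apply: cont_onX; exact: cont_on_normc.
rewrite -rIntZ //; apply: rInt_le.
- by apply: cont_onX; exact: cont_on_normc.
- by apply: cont_onM => //; exact: cont_on_cst.
move=> t _; have h := H (r%:C * expi t); rewrite normc_polar ger0_norm // in h.
have {}h := h erefl; rewrite -exprMn ler_pXn2r // nnegrE ?normc_ge0 //.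
exact: le_trans (normc_ge0 _) h.
Qed.

Lemma discr_le (A B C : R) : 0 <= C ->
  (forall l, 0 <= A + 2 * l * B + l ^+ 2 * C) -> B ^+ 2 <= A * C.
Proof.
rewrite le_eqVlt => /predU1P[<-|C0] H.
  have [->|B0] := eqVneq B 0; first by rewrite expr0n mulr0.
  have := H (- (A + 1) / (2 * B)); rewrite mulr0 addr0.
  rewrite (_ : 2 * _ * B = - (A + 1)); last by field.
  by rewrite opprD addrA subrr add0r oppr_ge0 ler10.
have := H (- B / C).
rewrite (_ : _ + _ = (A * C - B ^+ 2) / C); last by field; rewrite gt_eqF.
by rewrite pmulr_lge0 ?invr_gt0 // subr_ge0.
Qed.

Lemma rInt_CauchySchwarz a b (f g : R -> R) : cont_on a b f -> cont_on a b g ->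
  rInt a b (fun t => f t * g t) ^+ 2 <=
  rInt a b (fun t => f t ^+ 2) * rInt a b (fun t => g t ^+ 2).
Proof.
move=> hf hg; apply: discr_le => [|l].
  by apply: rInt_ge0 => t _; exact: sqr_ge0.
have hfg := cont_onM hf hg; have hf2 := cont_onX 2 hf; have hg2 := cont_onX 2 hg.
have hk (k : R) (F : R -> R) : cont_on a b F -> cont_on a b (fun t => k * F t).
  by move=> hF; apply: cont_onM => //; exact: cont_on_cst.
rewrite -!rIntZ // -!rIntD //; try exact: hk.
- apply: rInt_ge0 => t _.
  rewrite (_ : _ + _ = (f t + l * g t) ^+ 2) ?sqr_ge0 //; by ring.
- by apply: cont_onD => //; exact: hk.
Qed.

Lemma cmean_CauchySchwarz a r phi psi : on_circ a r phi -> on_circ a r psi ->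
  normc (cmean a r (fun z => phi z * psi z)) ^+ 2 <= msq a r phi * msq a r psi.
Proof.
move=> h1 h2; have n1 := cont_on_normc h1; have n2 := cont_on_normc h2.
have h12 : on_circ a r (fun z => phi z * psi z) by exact: ccontM.
have h := cmean_le h12; have h0 := le_trans (normc_ge0 _) h.
apply: (@le_trans _ _ (rmean a r (fun z => normc (phi z * psi z)) ^+ 2)).
  by rewrite ler_pXn2r // nnegrE normc_ge0.
rewrite /msq /rmean.
rewrite mulrACA exprMn; apply: ler_wpM2l; first exact: sqr_ge0.
have := rInt_CauchySchwarz n1 n2; apply: le_trans; rewrite le_eqVlt; apply/orP; left.
by apply/eqP; congr (_ ^+ 2); apply: rInt_eq => t _; rewrite normcM.
Qed.

(** Goursat's theorem on one full turn: the two radial edges cancel. *)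
Lemma cmean_annulus a x1 x2 phi : 0 < x1 -> x1 <= x2 ->
  (forall z, x1 <= normc z <= x2 -> derivable phi z 1) ->
  cmean a x1 phi = cmean a x2 phi.
Proof.
move=> x10 x12 H; have a2 := pi2a a.
have := @goursat_sector R phi x1 x2 a (a + 2 * pi) x10 x12 a2.
have -> : cInt x1 x2 (fun x => phi (x%:C * expi (a + 2 * pi)) / x%:C) =
          cInt x1 x2 (fun x => phi (x%:C * expi a) / x%:C).
  by apply: eq_cInt => x _; rewrite expiD2pi.
rewrite subrr => E.
have i0 : 'i != 0 :> R[i] by rewrite eq_complex /= oner_eq0 andbF.
have /E/eqP : forall x t, x1 <= x <= x2 -> a <= t <= a + 2 * pi ->
    derivable phi (x%:C * expi t) 1.
  move=> x t hx _; apply: H; rewrite normc_polar ger0_norm //.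
  by case/andP: hx => hx _; rewrite (le_trans (ltW x10)).
by rewrite mulf_eq0 (negPf i0) /= subr_eq0 => /eqP; rewrite /cmean => ->.
Qed.

Lemma cmean_monomial a r n : 0 < r -> r < 1 ->
  cmean a r (fun z => z ^+ n) = (n == 0%N)%:R.
Proof.
move=> r0 r1; rewrite mean_value ?expr0n //; apply: holX; exact: hol_id.
Qed.

Lemma circ_mono a r n : 0 <= r -> r < 1 -> on_circ a r (fun z => z ^+ n).
Proof. by move=> r0 r1; apply: hol_circle => //; apply: holX; exact: hol_id. Qed.

Lemma cmean_orth a r m n : 0 < r -> r < 1 ->
  cmean a r (fun z => z ^+ m * conjc (z ^+ n)) = ((m == n)%:R * r ^+ (2 * n))%:C.
Proof.
move=> r0 r1; have r0' := ltW r0.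
have zz k z : normc z = r -> z ^+ k * conjc (z ^+ k) = (r ^+ (2 * k))%:C.
  by move=> zr; rewrite mulJc normcX zr -exprM mulnC.
wlog nm : m n / (n <= m)%N => [hw|].
  have [/hw //|/ltnW mn] := leqP n m.
  have E := hw _ _ mn.
  have -> : cmean a r (fun z => z ^+ m * conjc (z ^+ n)) =
      conjc (cmean a r (fun z => z ^+ n * conjc (z ^+ m))).
    rewrite -cmean_conj; last first.
      by apply: (ccontM (circ_mono _ _ _ _) (cont_on_conj (circ_mono _ _ _ _))).
    by apply: cmean_ext => // z _; rewrite conjcM conjc_invol mulrC.
  rewrite E; apply: (etrans (conjcR _)); rewrite eq_sym.
  by case: eqVneq => [->//|_]; rewrite !mul0r.
have -> : cmean a r (fun z => z ^+ m * conjc (z ^+ n)) =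
   cmean a r (fun z => (r ^+ (2 * n))%:C * z ^+ (m - n)).
  apply: cmean_ext => // z /(zz n) zr.
  by rewrite -{1}(subnK nm) exprD -mulrA zr mulrC.
rewrite cmeanZ; last exact: circ_mono.
rewrite cmean_monomial // subn_eq0 rmorphM mulrC; congr (_ * _).
by rewrite rmorph_nat eqn_leq nm andbT.
Qed.

(** Parseval's identity, from the orthogonality of monomials. *)
Lemma msq_psum a r (c : nat -> R[i]) N : 0 < r -> r < 1 ->
  msq a r (fun z => \sum_(n < N) c n * z ^+ n) =
  \sum_(n < N) normc (c n) ^+ 2 * r ^+ (2 * n).
Proof.
move=> r0 r1; have r0' := ltW r0; apply: complexI; rewrite msqE.
have hm n : on_circ a r (fun z => c n * z ^+ n).
  by apply: ccontZ; exact: circ_mono.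
have hmn m n : on_circ a r (fun z => z ^+ m * conjc (z ^+ n)).
  by apply: (ccontM (circ_mono _ _ _ _) (cont_on_conj (circ_mono _ _ _ _))).
have -> : cmean a r (fun z => (\sum_(n < N) c n * z ^+ n) *
      conjc (\sum_(n < N) c n * z ^+ n)) =
   cmean a r (fun z => \sum_(m < N) \sum_(n < N)
      (c m * conjc (c n)) * (z ^+ m * conjc (z ^+ n))).
  apply: cmean_ext => // z _; rewrite conjc_sum mulr_suml.
  apply: eq_bigr => m _; rewrite mulr_sumr; apply: eq_bigr => n _.
  by rewrite conjcM mulrACA.
rewrite cmean_sum; last first.
  by move=> m; apply: ccont_sum => n; exact: (ccontZ _ (hmn m n)).
rewrite rmorph_sum /=; apply: eq_bigr => m _.
rewrite cmean_sum; last by move=> n; exact: (ccontZ _ (hmn m n)).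
rewrite (bigD1 m) //= big1 ?addr0 => [|n nm].
  rewrite cmeanZ // cmean_orth // eqxx mul1r mulJc; exact/esym/rmorphM.
rewrite cmeanZ // cmean_orth // eq_sym.
have -> : (n == m :> nat) = false by apply/negbTE; rewrite (inj_eq val_inj).
by rewrite mul0r mulr0.
Qed.

End CircleMeans.

(** * Taylor series *)

Section Taylor.
Variable R : realType.
Implicit Types (a b r t : R) (f g h : R[i] -> R[i]) (z w : R[i]) (c : nat -> R[i]).

Let pi2 : 0 < 2 * pi :> R. Proof. by rewrite mulr_gt0 // pi_gt0. Qed.
Let pi2a : 0 <= 0 + 2 * pi :> R. Proof. by rewrite add0r ltW. Qed.

(* Morphism properties of the embedding of the reals. *)
Lemma rcM (x y : R) : (x * y)%:C = x%:C * y%:C. Proof. exact: rmorphM. Qed.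
Lemma rc_sum (I : Type) (s : seq I) (F : I -> R) :
  (\sum_(i <- s) F i)%:C = \sum_(i <- s) (F i)%:C.
Proof. exact: rmorph_sum. Qed.

(** The radius 1/2 is arbitrary, by [coefE]. *)
Definition coef f n : R[i] := cmean 0 2^-1 (fun z => f z / z ^+ n).

Definition psum c N z : R[i] := \sum_(n < N) c n * z ^+ n.

Lemma coefE f r n : holomorphic f -> 0 < r -> r < 1 ->
  cmean 0 r (fun z => f z / z ^+ n) = coef f n.
Proof.
move=> hf r0 r1.
have H x1 x2 : 0 < x1 -> x1 <= x2 -> x2 < 1 ->
    cmean 0 x1 (fun z => f z / z ^+ n) = cmean 0 x2 (fun z => f z / z ^+ n).
  move=> x10 x12 x21; apply: cmean_annulus => // z /andP[h1 h2].
  apply: cderM; first by apply: hf; exact: le_lt_trans h2 x21.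
  apply: cderV; last by apply: cderX; exact: cder_id.
  by rewrite expf_neq0 // -normc_gt0 (lt_le_trans x10).
have h0 : 0 < 2^-1 :> R by rewrite invr_gt0.
have h1 : 2^-1 < 1 :> R by rewrite invf_lt1 // ltr1n.
by have [h|/ltW h] := leP r 2^-1; rewrite /coef; [|symmetry]; exact: H.
Qed.

Lemma conj_mono r n z : 0 < r -> normc z = r ->
  conjc (z ^+ n) = (r ^+ (2 * n))%:C / z ^+ n.
Proof.
move=> r0 zr; have zn : z ^+ n != 0 by rewrite expf_neq0 // -normc_gt0 zr.
apply: (mulfI zn); rewrite mulJc normcX zr -exprM mulnC mulrCA divff //.
by rewrite mulr1.
Qed.

Lemma hol_circ a f r : holomorphic f -> 0 <= r -> r < 1 -> on_circ a r f.
Proof. by move=> hf r0 r1; exact: hol_circle. Qed.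

Lemma coef_conj f r n : holomorphic f -> 0 < r -> r < 1 ->
  cmean 0 r (fun z => f z * conjc (z ^+ n)) = (r ^+ (2 * n))%:C * coef f n.
Proof.
move=> hf r0 r1; rewrite -(@coefE f r n) // -cmeanZ; last first.
  apply: ccontM; first exact: hol_circ (ltW r0) r1.
  apply: ccontV; last exact: circ_mono (ltW r0) r1.
  by move=> t _; rewrite expf_neq0 // -normc_gt0 normc_polar normr_gt0 gt_eqF.
apply: cmean_ext => [|z zr]; first exact: ltW.
by rewrite (conj_mono _ r0 zr) mulrCA.
Qed.

Lemma hol_psum c N : holomorphic (psum c N).
Proof.
by apply: hol_sum => n; apply: holM; [exact: hol_cst|apply: holX; exact: hol_id].
Qed.

Lemma bounded_circle f r : holomorphic f -> 0 <= r -> r < 1 ->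
  exists2 K, 0 <= K &
    forall t, 0 <= t <= 0 + 2 * pi -> normc (f (r%:C * expi t)) <= K.
Proof.
move=> hf r0 r1; have h := cont_on_normc (hol_circle 0 (0 + 2 * pi) hf r0 r1).
have h' : {within `[0, 0 + 2 * pi : R], continuous
    (fun t : R => normc (f (r%:C * expi t)))}.
  apply: continuous_in_subspaceT => t; rewrite inE /= in_itv.
  by move/cont_onP : h; apply.
have [s _ hs] := EVT_max pi2a h'.
exists (normc (f (r%:C * expi s))); first exact: normc_ge0.
by move=> t ht; apply: hs; rewrite in_itv.
Qed.

Lemma geom_sum (x : R[i]) N : x != 1 ->
  (1 - x)^-1 - \sum_(n < N) x ^+ n = x ^+ N / (1 - x).
Proof.
move=> x1; have nz : 1 - x != 0 by rewrite subr_eq0 eq_sym.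
apply: (mulIf nz); rewrite mulrBl mulVf // divfK //.
rewrite (_ : (\sum_(n < N) _) * _ = 1 - x ^+ N); first by rewrite opprB addrC subrK.
have := subrX1 x N; rewrite mulrC => E.
by rewrite -(opprB x 1) mulrN -E opprB.
Qed.

(** Remainder in Taylor's formula, by expanding Cauchy's kernel. *)
Lemma taylor_rem f r K w N : holomorphic f -> normc w < r -> r < 1 ->
  (forall t, 0 <= t <= 0 + 2 * pi -> normc (f (r%:C * expi t)) <= K) ->
  normc (f w - psum (coef f) N w) <=
    K * (normc w / r) ^+ N * (r / (r - normc w)).
Proof.
move=> hf wr r1 hK; have r0 : 0 < r := le_lt_trans (normc_ge0 w) wr.
have r0' := ltW r0.
have znz z : normc z = r -> z != 0 by move=> zr; rewrite -normc_gt0 zr.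
have zw z : normc z = r -> z - w != 0.
  move=> zr; rewrite -normc_gt0 (lt_le_trans _ (le_normcB _ _)) //.
  by rewrite zr subr_gt0.
have pr t : normc (r%:C * expi t) = r by rewrite normc_polar ger0_norm.
have cid : on_circ 0 r (fun z => z) by exact: (hol_circ 0 (@hol_id R) r0' r1).
have cf : on_circ 0 r f by exact: hol_circ.
have cVn n : on_circ 0 r (fun z => (z ^+ n)^-1).
  apply: ccontV; last exact: circ_mono.
  by move=> t _; rewrite expf_neq0 // znz.
have cK : on_circ 0 r (fun z => z / (z - w)).
  apply: ccontM => //; apply: ccontV => [t _|]; first exact: zw.
  by apply: ccontB => //; exact: ccont_cst.
have crem : on_circ 0 r (fun z => f z * ((w / z) ^+ N * (z / (z - w)))).
  apply: ccontM => //; apply: ccontM => //; apply: ccontX.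
  by apply: ccontZ; apply: ccontV => // t _; exact: znz.
have -> : f w - psum (coef f) N w =
    cmean 0 r (fun z => f z * ((w / z) ^+ N * (z / (z - w)))).
  rewrite -(@cauchy_formula R f 0 r w) //.
  have -> : psum (coef f) N w =
      cmean 0 r (fun z => \sum_(n < N) w ^+ n * (f z / z ^+ n)).
    rewrite cmean_sum => [|n]; last exact: (ccontZ _ (ccontM cf (cVn n))).
    apply: eq_bigr => n _; rewrite cmeanZ; last exact: (ccontM cf (cVn n)).
    by rewrite coefE // mulrC.
  rewrite -cmeanB; last 2 first.
  - exact: (ccontM cf cK).
  - by apply: ccont_sum => n; exact: (ccontZ _ (ccontM cf (cVn n))).
  apply: cmean_ext => // z zr; have z0 := znz z zr; have zw0 := zw z zr.
  have x1 : w / z != 1.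
    by rewrite -subr_eq0 -(divff z0) -mulrBl mulf_neq0 ?invr_eq0 // -opprB oppr_eq0.
  have -> : z / (z - w) = (1 - w / z)^-1.
    apply: (mulfI zw0); rewrite mulrCA divff // mulr1.
    have -> : z - w = z * (1 - w / z) by rewrite mulrBr mulr1 mulrCA divff // mulr1.
    by rewrite -mulrA divff ?mulr1 // subr_eq0 eq_sym.
  rewrite -(geom_sum _ x1) mulrBr; congr (_ - _).
  rewrite mulr_sumr; apply: eq_bigr => n _.
  by rewrite expr_div_n mulrCA mulrA.
apply: cmean_le_cst => // t ht; set z := r%:C * expi t.
rewrite normcM normcM normcX -mulrA.
have -> : normc (w / z) = normc w / r by rewrite normcM normcV pr.
apply: ler_pM; [exact: normc_ge0| |exact: hK|].
  by rewrite mulr_ge0 ?normc_ge0 // exprn_ge0 // divr_ge0 ?normc_ge0.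
apply: ler_wpM2l; first by rewrite exprn_ge0 // divr_ge0 ?normc_ge0.
rewrite normcM normcV pr; apply: ler_wpM2l => //.
rewrite lef_pV2 ?posrE ?normc_gt0 ?zw ?subr_gt0 ?pr //.
by rewrite (le_trans _ (le_normcB _ _)) // pr.
Qed.

Lemma taylor_unif f rho : holomorphic f -> 0 <= rho -> rho < 1 ->
  forall e, 0 < e -> exists N0, forall N w, (N0 <= N)%N -> normc w <= rho ->
    normc (f w - psum (coef f) N w) <= e.
Proof.
move=> hf rho0 rho1 e e0; have [r rr r1] : exists2 r, rho < r & r < 1.
  by exists ((rho + 1) / 2); lra.
have r0 : 0 < r by lra.
have [K K0 hK] := bounded_circle hf (ltW r0) r1.
pose C := K * (r / (r - rho)).
have C0 : 0 <= C.
  by rewrite mulr_ge0 // divr_ge0 ?subr_ge0 ?(ltW r0) ?(ltW rr).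
have q1 : `|rho / r| < 1.
  rewrite ger0_norm; first by rewrite ltr_pdivrMr // mul1r.
  by apply: divr_ge0 => //; exact: ltW.
have /cvgrPdist_le /(_ (e / (C + 1))) := cvg_expr q1.
rewrite divr_gt0 ?ltr_wpDl // => /(_ isT) [N0 _ hN0].
exists N0 => N w N0N wr.
have wr' : normc w < r := le_lt_trans wr rr.
have := hN0 N N0N; rewrite /= sub0r normrN ger0_norm ?exprn_ge0 ?divr_ge0 ?(ltW r0) //.
move=> hq; rewrite (le_trans (taylor_rem N hf wr' r1 hK)) //.
apply: (@le_trans _ _ (C * (rho / r) ^+ N)).
  have rn : 0 <= r / (r - normc w).
    by rewrite divr_ge0 ?subr_ge0 ?(ltW r0) ?(ltW wr').
  have nr : 0 <= normc w / r by rewrite divr_ge0 ?normc_ge0 ?(ltW r0).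
  rewrite /C mulrAC; apply: ler_pM.
  - exact: mulr_ge0.
  - exact: exprn_ge0.
  - apply: ler_wpM2l => //; apply: ler_wpM2l; first exact: ltW.
    by rewrite lef_pV2 ?posrE ?subr_gt0 // lerB.
  - have wrr : normc w / r <= rho / r by rewrite ler_pM2r ?invr_gt0.
    by apply: lerXn2r => //; rewrite nnegrE // (le_trans nr).
rewrite (le_trans (ler_wpM2l C0 hq)) // mulrA ler_pdivrMr ?ltr_wpDl //.
by rewrite mulrC ler_wpM2l ?(ltW e0) // lerDl.
Qed.

Lemma cauchy_estimate h r K w : holomorphic h -> normc w < r -> r < 1 ->
  (forall t, 0 <= t <= 0 + 2 * pi -> normc (h (r%:C * expi t)) <= K) ->
  normc (derive1 h w) <= 2 * K / (r - normc w) ^+ 2.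
Proof.
move=> hh wr r1 hK; have r0 : 0 < r := le_lt_trans (normc_ge0 w) wr.
have r0' := ltW r0; pose d := r - normc w; have d0 : 0 < d by rewrite subr_gt0.
have pr t : normc (r%:C * expi t) = r by rewrite normc_polar ger0_norm.
have K0 : 0 <= K by apply: le_trans (normc_ge0 _) (hK 0 _); rewrite lexx.
have zw v z : normc v < r -> normc z = r -> z - v != 0.
  move=> vr zr; rewrite -normc_gt0 (lt_le_trans _ (le_normcB _ _)) //.
  by rewrite zr subr_gt0.
have cid : on_circ 0 r (fun z => z) by exact: (hol_circ 0 (@hol_id R) r0' r1).
have ch : on_circ 0 r h by exact: hol_circ.
have cK v : normc v < r -> on_circ 0 r (fun z => (z - v)^-1).
  move=> vr; apply: ccontV => [t _|]; first exact: zw.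
  by apply: ccontB => //; exact: ccont_cst.
have lip v : normc (v - w) <= d / 2 ->
    normc (h v - h w) <= 2 * K / d ^+ 2 * normc (v - w).
  move=> vw; have vr : normc v <= r - d / 2.
    rewrite -(subrK w v) (le_trans (le_normcD _ _)) //.
    have -> : r = d + normc w by rewrite /d subrK.
    by move: vw; lra.
  have vr' : normc v < r by rewrite (le_lt_trans vr) // ltrBlDr ltrDl divr_gt0.
  rewrite -(@cauchy_formula R h 0 r v) // -(@cauchy_formula R h 0 r w) //.
  have c1 v' : normc v' < r -> on_circ 0 r (fun z => h z * (z / (z - v'))).
    by move=> v'r; apply: ccontM => //; apply: ccontM => //; exact: cK.
  rewrite -cmeanB; [|exact: c1|exact: c1].
  apply: cmean_le_cst; first by apply: ccontB; exact: c1.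
  move=> t ht; move: (pr t) (hK t ht); move: (r%:C * expi t) => z zr hKz.
  have zv := zw v z vr' zr; have zw' := zw w z wr zr.
  have -> : h z * (z / (z - v)) - h z * (z / (z - w)) =
      h z * z * (v - w) * ((z - v)^-1 * (z - w)^-1).
    by set p := h z; field; rewrite zv zw'.
  rewrite !normcM !normcV zr mulrAC; apply: ler_wpM2r; first exact: normc_ge0.
  apply: (@le_trans _ _ (K * 1 * ((d / 2)^-1 * d^-1))); last first.
    by rewrite le_eqVlt; apply/orP; left; apply/eqP; field; rewrite gt_eqF.
  have zwd : d <= normc (z - w) by rewrite (le_trans _ (le_normcB _ _)) // zr.
  have zvd : d / 2 <= normc (z - v).
    by rewrite (le_trans _ (le_normcB _ _)) // zr; lra.
  apply: ler_pM.
  - by rewrite mulr_ge0 ?normc_ge0.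
  - by rewrite mulr_ge0 ?invr_ge0 ?normc_ge0.
  - by apply: ler_pM; rewrite ?normc_ge0 // ltW.
  - by apply: ler_pM; rewrite ?invr_ge0 ?normc_ge0 // lef_pV2 ?posrE ?normc_gt0 ?zv
      ?zw' ?divr_gt0.
have dw : derivable h w 1 by apply: hh; exact: lt_trans wr r1.
apply/ler_addgt0Pl => e e0.
have [dl dl0 Hd] := derivable_normcP dw e0.
pose x := Num.min (dl / 2) (d / 2).
have x0 : 0 < x by rewrite lt_min !divr_gt0.
have xd : x < dl by rewrite gt_min; apply/orP; left; lra.
have xd2 : x <= d / 2 by rewrite ge_min lexx orbT.
have nx : normc (w + x%:C - w) = x by rewrite addrAC subrr add0r normc_real gtr0_norm.
have := Hd (w + x%:C); rewrite nx => /(_ xd) h1.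
have := lip (w + x%:C); rewrite nx => /(_ xd2) h2.
rewrite -(ler_pM2r x0) -{1}nx -normcM.
have -> : derive1 h w * (w + x%:C - w) = (h (w + x%:C) - h w) -
    (h (w + x%:C) - h w - derive1 h w * (w + x%:C - w)) by ring.
rewrite (le_trans (le_normcD _ _)) // normcN addrC mulrDl lerD //.
Qed.

(** Cauchy's estimate applied to the uniformly small Taylor remainder. *)
Lemma taylor_deriv f w : holomorphic f -> unit_disk w ->
  forall e, 0 < e -> exists N0, forall N, (N0 <= N)%N ->
    normc (derive1 f w - derive1 (psum (coef f) N) w) <= e.
Proof.
move=> hf w1 e e0; have [r wr r1] : exists2 r, normc w < r & r < 1.
  move: w1; rewrite /unit_disk /mkset => w1.
  by exists ((normc w + 1) / 2); lra.
have r0 : 0 < r := le_lt_trans (normc_ge0 w) wr.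
have d0 : 0 < r - normc w by rewrite subr_gt0.
have e1 : 0 < e * (r - normc w) ^+ 2 / 2.
  by rewrite divr_gt0 // mulr_gt0 // exprn_gt0.
have [N0 hN] := taylor_unif hf (ltW r0) r1 e1.
exists N0 => N N0N.
have -> : derive1 f w - derive1 (psum (coef f) N) w =
    derive1 (fun z => f z - psum (coef f) N z) w.
  by rewrite !derive1E deriveB //; [exact: hf|exact: hol_psum].
have hfp : holomorphic (fun z => f z - psum (coef f) N z).
  exact: (holB hf (@hol_psum (coef f) N)).
rewrite (le_trans (cauchy_estimate (K := e * (r - normc w) ^+ 2 / 2) hfp wr r1 _)) //.
  by move=> t ht; apply: hN => //; rewrite normc_polar ger0_norm // ltW.
by rewrite mulrCA divff // mulr1 mulfK // expf_neq0 // gt_eqF.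
Qed.

(** Pythagoras: the Taylor polynomial is the orthogonal projection. *)
Lemma msq_pythagoras f r N : holomorphic f -> 0 < r -> r < 1 ->
  msq 0 r f = msq 0 r (fun z => f z - psum (coef f) N z) +
    \sum_(n < N) normc (coef f n) ^+ 2 * r ^+ (2 * n).
Proof.
move=> hf r0 r1; have r0' := ltW r0.
rewrite -(msq_psum 0) //.
set p := psum (coef f) N; pose h z := f z - p z.
have hp : holomorphic p := @hol_psum (coef f) N.
have hh : holomorphic h := holB hf hp.
have cp : on_circ 0 r p := hol_circ 0 hp r0' r1.
have cf : on_circ 0 r f := hol_circ 0 hf r0' r1.
have ch : on_circ 0 r h := hol_circ 0 hh r0' r1.
have cm n : on_circ 0 r (fun z => z ^+ n) by exact: circ_mono.
have orth n : (n < N)%N -> cmean 0 r (fun z => h z * conjc (z ^+ n)) = 0.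
  move=> nN.
  have -> : cmean 0 r (fun z => h z * conjc (z ^+ n)) =
      cmean 0 r (fun z => f z * conjc (z ^+ n)) -
      cmean 0 r (fun z => p z * conjc (z ^+ n)).
    rewrite -cmeanB.
    - by apply: cmean_ext => // z _; rewrite /h mulrBl.
    - exact: (ccontM cf (cont_on_conj (cm n))).
    - exact: (ccontM cp (cont_on_conj (cm n))).
  rewrite coef_conj //.
  have -> : cmean 0 r (fun z => p z * conjc (z ^+ n)) =
      cmean 0 r (fun z => \sum_(m < N) coef f m * (z ^+ m * conjc (z ^+ n))).
    by apply: cmean_ext => // z _; rewrite mulr_suml; apply: eq_bigr => m _; rewrite mulrA.
  have cmn m : on_circ 0 r (fun z => z ^+ m * conjc (z ^+ n)).
    exact: (ccontM (cm m) (cont_on_conj (cm n))).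
  rewrite cmean_sum => [|m]; last exact: (ccontZ _ (cmn m)).
  rewrite (bigD1 (Ordinal nN)) //= big1 => [|m mn].
    by rewrite cmeanZ // cmean_orth // eqxx mul1r addr0 mulrC subrr.
  rewrite cmeanZ // cmean_orth //.
  have -> : (m == n :> nat) = false by apply/negbTE; exact: mn.
  by rewrite mul0r mulr0.
have orthp : cmean 0 r (fun z => h z * conjc (p z)) = 0.
  have -> : cmean 0 r (fun z => h z * conjc (p z)) =
      cmean 0 r (fun z => \sum_(n < N) conjc (coef f n) * (h z * conjc (z ^+ n))).
    apply: cmean_ext => // z _; rewrite conjc_sum mulr_sumr.
    by apply: eq_bigr => n _; rewrite conjcM mulrCA.
  have chn n : on_circ 0 r (fun z => h z * conjc (z ^+ n)).
    exact: (ccontM ch (cont_on_conj (cm n))).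
  rewrite cmean_sum => [|n]; last exact: (ccontZ _ (chn n)).
  by rewrite big1 // => n _; rewrite cmeanZ // orth // mulr0.
apply: complexI; rewrite rmorphD /= -/h.
have -> : (msq 0 r f)%:C = cmean 0 r (fun z => f z * conjc (f z)) by exact: msqE.
have -> : (msq 0 r h)%:C = cmean 0 r (fun z => h z * conjc (h z)) by exact: msqE.
have -> : (msq 0 r p)%:C = cmean 0 r (fun z => p z * conjc (p z)) by exact: msqE.
have orthp' : cmean 0 r (fun z => p z * conjc (h z)) = 0.
  have -> : cmean 0 r (fun z => p z * conjc (h z)) =
      cmean 0 r (fun z => conjc (h z * conjc (p z))).
    by apply: cmean_ext => // z _; rewrite conjcM conjc_invol mulrC.
  rewrite cmean_conj ?orthp ?conjc0 //.
  exact: (ccontM ch (cont_on_conj cp)).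
have cc g1 g2 : on_circ 0 r g1 -> on_circ 0 r g2 ->
    on_circ 0 r (fun z => g1 z * conjc (g2 z)).
  by move=> c1 c2; exact: (ccontM c1 (cont_on_conj c2)).
have -> : cmean 0 r (fun z => f z * conjc (f z)) =
   (cmean 0 r (fun z => h z * conjc (h z)) + cmean 0 r (fun z => h z * conjc (p z)))
   + (cmean 0 r (fun z => p z * conjc (h z)) + cmean 0 r (fun z => p z * conjc (p z))).
  rewrite -cmeanD; [|exact: cc|exact: cc].
  rewrite -cmeanD; [|exact: cc|exact: cc].
  rewrite -cmeanD.
  - apply: cmean_ext => // z _.
    have -> : f z = h z + p z by rewrite /h subrK.
    by rewrite conjcD; ring.
  - exact: (ccontD (cc _ _ ch ch) (cc _ _ ch cp)).
  - exact: (ccontD (cc _ _ cp ch) (cc _ _ cp cp)).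
by rewrite orthp orthp' !addr0 add0r.
Qed.

End Taylor.

(** * Hardy norms and orthogonality *)

Section HardySpace.
Variable R : realType.
Implicit Types (r t : R) (f g h u : R[i] -> R[i]) (z w : R[i]) (c : nat -> R[i]).

Let pi2 : 0 < 2 * pi :> R. Proof. by rewrite mulr_gt0 // pi_gt0. Qed.

Lemma left1_le (g : R -> R) rho B : {for 1, continuous g} -> rho < 1 ->
  (forall r, rho < r -> r < 1 -> g r <= B) -> g 1 <= B.
Proof.
move=> hg rho1 H.
have c1 : g r @[r --> (1 : R)^'-] --> g 1 by apply: cvg_at_left_filter; exact: hg.
have c2 : B @[r --> (1 : R)^'-] --> B by exact: cvg_cst.
apply: (ler_cvg_to c1 c2); near=> r; apply: H; near: r.
  exact: nbhs_left_gt.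
exact: nbhs_left_lt.
Unshelve. all: by end_near. Qed.

Definition sqsum c N : R := \sum_(n < N) normc (c n) ^+ 2.

Lemma sqsum_ge0 c N : 0 <= sqsum c N.
Proof. by apply: sumr_ge0 => n _; exact: sqr_ge0. Qed.

Lemma sqsum_mono c : {homo sqsum c : m n / (m <= n)%N >-> m <= n}.
Proof.
apply: homo_leq => //; first exact: le_trans.
by move=> n; rewrite /sqsum big_ord_recr /= lerDl sqr_ge0.
Qed.

Lemma weighted_cont c N :
  {for 1, continuous (fun r : R => \sum_(n < N) normc (c n) ^+ 2 * r ^+ (2 * n))}.
Proof.
have : cont_on 1 1 (fun r : R => \sum_(n < N) normc (c n) ^+ 2 * r ^+ (2 * n)).
  apply: cont_on_sum => n; apply: cont_onM; first exact: cont_on_cst.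
  by apply: cont_onX; apply/cont_onP => x _; exact: cvg_id.
by move/cont_onP; apply; rewrite lexx.
Qed.

Lemma weighted1 c N : \sum_(n < N) normc (c n) ^+ 2 * 1 ^+ (2 * n) = sqsum c N.
Proof. by apply: eq_bigr => n _; rewrite expr1n mulr1. Qed.

Lemma weighted_le c N r : 0 <= r -> r <= 1 ->
  \sum_(n < N) normc (c n) ^+ 2 * r ^+ (2 * n) <= sqsum c N.
Proof.
move=> r0 r1; apply: ler_sum => n _; rewrite -[leRHS]mulr1.
by apply: ler_wpM2l; [exact: sqr_ge0|exact: exprn_ile1].
Qed.

(** Bessel's inequality in the limit of circles of radius 1. *)
Lemma sqsum_coef_le f B N : holomorphic f ->
  (forall r, 0 < r -> r < 1 -> msq 0 r f <= B) -> sqsum (coef f) N <= B.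
Proof.
move=> hf H; rewrite -weighted1.
apply: (@left1_le (fun r => \sum_(n < N) normc (coef f n) ^+ 2 * r ^+ (2 * n)) 0) => //.
  exact: weighted_cont.
move=> r r0 r1; rewrite (le_trans _ (H r r0 r1)) // (msq_pythagoras N hf r0 r1).
by rewrite lerDr msq_ge0.
Qed.

Lemma circle_meanE f r : holomorphic f -> 0 <= r -> r < 1 ->
  circle_mean f r = (msq 0 r f)%:E.
Proof.
move=> hf r0 r1; rewrite /circle_mean /msq /rmean /rInt /Rintegral add0r EFinM.
congr (_ * _)%E; rewrite fineK //.
apply: integrable_fin_num; first exact: measurable_itv.
apply: cont_on_integrable; apply: cont_onX; apply: cont_on_normc.
exact: hol_circle.
Qed.

(** Parseval's identity, from [msq_pythagoras] on circles whose radius tends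
    to 1. *)
Lemma hardy_parseval f : hardy_space f -> exists T : R,
  [/\ hardy_normsq f = T%:E, forall N, sqsum (coef f) N <= T,
      forall r, 0 <= r -> r < 1 -> msq 0 r f <= T
    & forall e, 0 < e -> exists N0, forall N, (N0 <= N)%N ->
        T <= sqsum (coef f) N + e].
Proof.
move=> [hf fin].
have ub r : 0 <= r -> r < 1 -> ((msq 0 r f)%:E <= hardy_normsq f)%E.
  move=> r0 r1; rewrite -circle_meanE //; apply: ereal_sup_ubound.
  by exists r => //=; rewrite r0.
have n0 : (0 <= hardy_normsq f)%E.
  by apply: le_trans (ub 0 _ _) => //; rewrite lee_fin msq_ge0.
exists (fine (hardy_normsq f)).
have E : hardy_normsq f = (fine (hardy_normsq f))%:E by rewrite fineK // ge0_fin_numE.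
have hT r : 0 <= r -> r < 1 -> msq 0 r f <= fine (hardy_normsq f).
  by move=> r0 r1; rewrite -lee_fin -E; exact: ub.
split => // [N|e e0].
  by apply: sqsum_coef_le => // r r0 r1; apply: hT => //; exact: ltW.
have [S0 hS0] : exists S0, (forall N, sqsum (coef f) N <= S0) /\
    exists N0, S0 <= sqsum (coef f) N0 + e.
  pose A := range (sqsum (coef f)).
  have supA : has_sup A.
    split; first by exists (sqsum (coef f) 0), 0%N.
    exists (fine (hardy_normsq f)) => _ [N _ <-].
    by apply: sqsum_coef_le => // r r0 r1; apply: hT => //; exact: ltW.
  exists (sup A); split => [N|].
    by apply: ub_le_sup; [case: supA|exists N].
  have [_ [N _ <-] h] := sup_adherent e0 supA.
  by exists N; move: h; rewrite ltrBlDr => /ltW.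
have [hS [N0 hN0]] := hS0.
exists N0 => N N0N.
apply: (@le_trans _ _ S0); last first.
  by rewrite (le_trans hN0) // lerD2r; exact: sqsum_mono.
rewrite -lee_fin -E; apply: ge_ereal_sup => _ [r /= /andP[r0 r1] <-].
rewrite circle_meanE // lee_fin.
move: r0; rewrite le_eqVlt => /predU1P[<-|r0].
  have -> : msq 0 0 f = normc (coef f 0) ^+ 2.
    have c0 : coef f 0 = f 0.
      rewrite -(@mean_value R f 0 2^-1) ?invr_gt0 ?invf_lt1 ?ltr1n //.
      apply: cmean_ext => [|z _]; first by rewrite invr_ge0.
      by rewrite expr0 divr1.
    rewrite c0 /msq /rmean (rInt_eq (g := fun=> normc (f 0) ^+ 2)).
      by rewrite rInt_cst ?add0r ?(ltW pi2) // subr0 mulrC mulfK // gt_eqF.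
    by move=> t _; rewrite mul0r.
  by have := hS 1%N; rewrite /sqsum big_ord1.
apply/ler_addgt0Pl => d d0.
have d1 : 0 < Num.min 1 d by rewrite lt_min ltr01.
have [N1 hN1] := taylor_unif hf (ltW r0) r1 d1.
rewrite (msq_pythagoras N1 hf r0 r1); apply: lerD.
  apply: msq_le; first exact: ltW.
    exact: (hol_circ 0 (holB hf (@hol_psum R (coef f) N1)) (ltW r0) r1).
  move=> z zr; have := hN1 N1 z (leqnn _); rewrite zr lexx => /(_ isT).
  rewrite le_min => /andP[h1 h2]; rewrite expr2 (le_trans _ h2) //.
  by rewrite -[leRHS]mul1r; apply: ler_wpM2r => //; exact: normc_ge0.
by rewrite (le_trans _ (hS N1)) //; apply: weighted_le; exact: ltW.
Qed.

Lemma hardy_psum c N : hardy_space (psum c N).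
Proof.
split; first exact: hol_psum.
pose B := \sum_(n < N) normc (c n).
apply: (@le_lt_trans _ _ (B ^+ 2)%:E); last exact: ltry.
apply: ge_ereal_sup => _ [r /= /andP[r0 r1] <-].
rewrite circle_meanE //; last exact: hol_psum.
rewrite lee_fin; apply: msq_le => // [|z zr].
  exact: (hol_circ 0 (@hol_psum R c N)).
have B0 : 0 <= B by apply: sumr_ge0 => n _; exact: normc_ge0.
rewrite ler_pXn2r // ?nnegrE ?normc_ge0 //.
rewrite (le_trans (normc_sum _ _ _)) //; apply: ler_sum => n _.
rewrite normcM normcX zr -[leRHS]mulr1; apply: ler_wpM2l; first exact: normc_ge0.
by apply: exprn_ile1 => //; exact: ltW.
Qed.

(** Coefficients of z^N conj(p(1/conj z)) for p of degree N. *)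
Definition conj_rev c N n : R[i] := conjc (c (N - n)%N).

Lemma sqsum_conj_rev c N : sqsum (conj_rev c N) N.+1 = sqsum c N.+1.
Proof.
rewrite /sqsum (reindex_inj rev_ord_inj) /=; apply: eq_bigr => n _.
by rewrite /conj_rev normc_conj subSS subKn // -ltnS.
Qed.

Lemma coef_mul_psum u c N k : holomorphic u ->
  coef (fun z => u z * psum c N z) k =
  \sum_(n < N) c n * coef (fun z => u z * z ^+ n) k.
Proof.
move=> hu; have h2 : 0 <= 2^-1 :> R by rewrite invr_ge0.
have h3 : 2^-1 < 1 :> R by rewrite invf_lt1 // ltr1n.
have nz t : (2^-1)%:C * expi t != 0 :> R[i].
  by rewrite -normc_gt0 normc_polar normr_gt0 invr_eq0 pnatr_eq0.
have ck n : on_circ 0 2^-1 (fun z => u z * z ^+ n / z ^+ k).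
  apply: ccontM.
    by apply: ccontM; [exact: hol_circ|exact: circ_mono].
  by apply: ccontV => [t _|]; [exact: expf_neq0|exact: circ_mono].
rewrite /coef; transitivity (\sum_(n < N) cmean 0 2^-1
  (fun z => c n * (u z * z ^+ n / z ^+ k))); last first.
  by apply: eq_bigr => n _; rewrite cmeanZ.
rewrite -(@cmean_sum _ _ _ _ _ (fun (n : 'I_N) z => c n * (u z * z ^+ n / z ^+ k))).
  apply: cmean_ext => // z _; rewrite /psum mulr_sumr mulr_suml.
  by apply: eq_bigr => n _; rewrite mulrCA -!mulrA.
by move=> n; exact: (ccontZ _ (ck n)).
Qed.

(** Approximate orthogonality.  If f is orthogonal to u H^2, then truncating f
    at degree N makes the part of conj(f) u of nonpositive frequency small: by
    the tail of f, up to the bound of u.  Its coefficients are the first N+1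
    Taylor coefficients of u(z) z^N conj(f_N(1/conj z)); they are tested against
    the polynomial h that they define. *)
Lemma model_tail u f M T N : holomorphic u ->
  (forall z, unit_disk z -> normc (u z) <= M) -> hardy_space f ->
  (forall r, 0 <= r -> r < 1 -> msq 0 r f <= T) ->
  (forall g, hardy_space g -> hardy_orthogonal f (u \* g)) ->
  sqsum (coef (fun z => u z * psum (conj_rev (coef f) N) N.+1 z)) N.+1 <=
    M ^+ 2 * (T - sqsum (coef f) N.+1).
Proof.
move=> hu uM [hf _] hT orth; set p := coef f; set q := psum (conj_rev p N) N.+1.
set U := coef _; set X := sqsum U N.+1.
pose h := psum (conj_rev U N) N.+1; pose G z := u z * h z.
have hG : holomorphic G := holM hu (@hol_psum R _ _).
pose P := psum p N.+1; have hP : holomorphic P := @hol_psum R _ _.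
pose E r := \sum_(j < N.+1) conjc (p j) * (r ^+ (2 * j))%:C * coef G j.
have X0 : 0 <= X by exact: sqsum_ge0.
(* E r is the mean of conj(P) u h over |z| = r, by ED below; at r = 1 the
   choice of h turns it into the sum of squares X. *)
have shift m j : (m <= N)%N -> (j <= N)%N ->
    coef (fun z => u z * z ^+ m) j = coef (fun z => u z * z ^+ (N - j)) (N - m).
  move=> mN jN; apply: cmean_ext => [|z zr]; first by rewrite invr_ge0.
  have z0 : z != 0 by rewrite -normc_gt0 zr invr_gt0.
  have zn n : z ^+ n != 0 by exact: expf_neq0.
  rewrite -!mulrA; congr (_ * _); apply: (mulIf (zn j)); rewrite divfK //.
  by apply: (mulIf (zn (N - m)%N)); rewrite mulrAC divfK // -!exprD subnKC // subnK.
have E1 : E 1 = X%:C.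
  rewrite /E rc_sum.
  have EG (j : 'I_N.+1) : coef G j =
      \sum_(m < N.+1) conj_rev U N m * coef (fun z => u z * z ^+ (N - j)) (N - m).
    rewrite coef_mul_psum //; apply: eq_bigr => m _.
    by rewrite shift // -ltnS.
  under eq_bigr => j _ do rewrite expr1n mulr1 EG mulr_sumr.
  rewrite exchange_big /= (reindex_inj rev_ord_inj) /=; apply: eq_bigr => m _.
  have mN : (m <= N)%N by rewrite -ltnS.
  rewrite subSS /conj_rev (subKn mN).
  have UE : U m = \sum_(j < N.+1) conj_rev p N j * coef (fun z => u z * z ^+ j) m.
    exact: coef_mul_psum.
  have -> : (normc (U m) ^+ 2)%:C = conjc (U m) * \sum_(j < N.+1)
      conj_rev p N j * coef (fun z => u z * z ^+ j) m by rewrite -UE -mulJc mulrC.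
  rewrite mulr_sumr (reindex_inj rev_ord_inj) /=.
  apply: eq_bigr => j _; rewrite subSS /conj_rev.
  have jN : (j <= N)%N by rewrite -ltnS.
  by rewrite (subKn jN) mulrCA.
have ED r : 0 < r -> r < 1 -> E r = cmean 0 r (fun z => conjc (P z) * G z).
  move=> r0 r1; have r0' := ltW r0.
  have cG := hol_circ 0 hG r0' r1.
  have cj j : on_circ 0 r (fun z => G z * conjc (z ^+ j)).
    exact: (ccontM cG (cont_on_conj (circ_mono 0 j r0' r1))).
  have -> : cmean 0 r (fun z => conjc (P z) * G z) =
      cmean 0 r (fun z => \sum_(j < N.+1) conjc (p j) * (G z * conjc (z ^+ j))).
    apply: cmean_ext => // z _; rewrite conjc_sum mulr_suml.
    by apply: eq_bigr => j _; rewrite conjcM -mulrA (mulrC (G z)).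
  rewrite cmean_sum => [|j]; last exact: (ccontZ _ (cj j)).
  by apply: eq_bigr => j _; rewrite cmeanZ // coef_conj // mulrA.
pose tau r := T - \sum_(n < N.+1) normc (p n) ^+ 2 * r ^+ (2 * n).
(* f is orthogonal to u h in the limit, so only the tail f - P contributes. *)
have key r : 0 < r -> r < 1 ->
    normc (E r - conjc (circle_dot f (u \* h) r)) ^+ 2 <= tau r * (M ^+ 2 * X).
  move=> r0 r1; have r0' := ltW r0.
  have cG := hol_circ 0 hG r0' r1; have cf := hol_circ 0 hf r0' r1.
  have cP := hol_circ 0 hP r0' r1.
  have hfP : holomorphic (fun z => f z - P z) := holB hf hP.
  have cfP : on_circ 0 r (fun z => f z - P z) := hol_circ 0 hfP r0' r1.
  have -> : circle_dot f (u \* h) r = cmean 0 r (fun z => f z * conjc (G z)).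
    by rewrite /circle_dot /cmean /cInt /rInt add0r.
  rewrite ED // -cmean_conj; last exact: (ccontM cf (cont_on_conj cG)).
  rewrite -cmeanB; last 2 first.
  - exact: (ccontM (cont_on_conj cP) cG).
  - exact: (cont_on_conj (ccontM cf (cont_on_conj cG))).
  have -> : cmean 0 r (fun z => conjc (P z) * G z - conjc (f z * conjc (G z))) =
      cmean 0 r (fun z => (- conjc (f z - P z)) * G z).
    apply: cmean_ext => // z _; rewrite conjcM conjc_invol -mulrBl; congr (_ * _).
    by rewrite -conjcN opprB conjcD conjcN.
  have cc : on_circ 0 r (fun z => - conjc (f z - P z)).
    exact: (ccontN (cont_on_conj cfP)).
  rewrite (le_trans (cmean_CauchySchwarz cc cG)) //.
  have -> : msq 0 r (fun z => - conjc (f z - P z)) = msq 0 r (fun z => f z - P z).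
    congr (_ * _); apply: rInt_eq => t _; by rewrite normcN normc_conj.
  apply: ler_pM; [exact: msq_ge0|exact: msq_ge0| |].
    by rewrite /tau lerBrDr -(msq_pythagoras N.+1 hf r0 r1) hT.
  have hh : holomorphic h := @hol_psum R _ _.
  rewrite (le_trans (msq_leM (M := M) (psi := h) r0' cG (hol_circ 0 hh r0' r1) _)) //.
    move=> z zr; rewrite normcM; apply: ler_wpM2r; first exact: normc_ge0.
    by apply: uM; rewrite /unit_disk /mkset zr.
  apply: ler_wpM2l; first exact: sqr_ge0.
  by rewrite /h msq_psum // /X -sqsum_conj_rev; apply: weighted_le => //; exact: ltW.
have lim : X ^+ 2 <= (T - sqsum p N.+1) * (M ^+ 2 * X).
  have cE : {for 1, continuous E}.
    have : cont_on 1 1 E.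
      apply: ccont_sum => j; apply: ccontM; last exact: ccont_cst.
      apply: ccontZ; apply: (cont_on_comp (h := fun r : R => r ^+ (2 * j))).
        by move=> *; exact: real_complex_continuous.
      by apply: cont_onX; apply/cont_onP => x _; exact: cvg_id.
    by move/cont_onP; apply; rewrite lexx.
  have c1 : E r - conjc (circle_dot f (u \* h) r) @[r --> (1 : R)^'-] --> X%:C.
    have c1a : E r @[r --> (1 : R)^'-] --> E 1.
      by apply: cvg_at_left_filter; exact: cE.
    have c1b : conjc (circle_dot f (u \* h) r) @[r --> (1 : R)^'-] --> conjc (0 : R[i]).
      have o := orth h (@hardy_psum _ _).
      exact: (continuous_cvg _ (@conjc_continuous R 0) o).
    have -> : X%:C = E 1 - conjc 0 by rewrite E1 (conjc0 R) subr0.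
    exact: (cvgB c1a c1b).
  have c2 : normc (E r - conjc (circle_dot f (u \* h) r)) ^+ 2 @[r --> (1 : R)^'-]
      --> X ^+ 2.
    have -> : X ^+ 2 = normc X%:C * normc X%:C.
      by rewrite normc_real ger0_norm // expr2.
    under eq_fun do rewrite expr2.
    by apply: cvgM; apply: continuous_cvg => //; exact: normc_continuous.
  have c3 : tau r * (M ^+ 2 * X) @[r --> (1 : R)^'-] -->
      (T - sqsum p N.+1) * (M ^+ 2 * X).
    apply: cvgMl; apply: cvgB; first exact: cvg_cst.
    rewrite -weighted1; apply: cvg_at_left_filter; exact: weighted_cont.
  apply: (ler_cvg_to c2 c3); near=> r; apply: key.
    by near: r; exact: nbhs_left_gt.
  by near: r; exact: nbhs_left_lt.
move: X0; rewrite le_eqVlt => /predU1P[X0|X0]; last first.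
  by move: lim; rewrite expr2 mulrA ler_pM2r // mulrC.
rewrite -X0 mulr_ge0 ?sqr_ge0 // subr_ge0.
apply: sqsum_coef_le => // r r0 r1; apply: hT => //; exact: ltW.
Unshelve. all: by end_near. Qed.

End HardySpace.

(** * The kernel of the derivative and growth estimates *)

Section LocalBound.
Variable R : realType.
Implicit Types (a r t x : R) (f g h u : R[i] -> R[i]) (z w : R[i]) (c : nat -> R[i]).

Let pi2 : 0 < 2 * pi :> R. Proof. by rewrite mulr_gt0 // pi_gt0. Qed.
Let pi2a a : a <= a + 2 * pi. Proof. by rewrite lerDl (ltW pi2). Qed.

(** The kernel of the functional f |-> f'(w) on the Hardy space. *)
Definition dkernel w z : R[i] := z / (1 - conjc w * z) ^+ 2.

Lemma den_derivable (k : R[i]) z : derivable (fun v => 1 - k * v) z 1.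
Proof.
apply: (@cderB R (fun=> 1) (fun v => k * v)); first exact: cder_cst.
by apply: (@cderM R (fun=> k) id); [exact: cder_cst|exact: cder_id].
Qed.

Lemma dkernel_derivable w z : 1 - conjc w * z != 0 -> derivable (dkernel w) z 1.
Proof.
move=> nz; apply: (@cderM R id (fun z => ((1 - conjc w * z) ^+ 2)^-1)).
  exact: cder_id.
apply: cderV; first exact: expf_neq0.
by apply: cderX; exact: den_derivable.
Qed.

Lemma dkernel_den w z : 1 - normc w * normc z <= normc (1 - conjc w * z).
Proof.
by rewrite -(normc_conj w) -normcM -{1}(normc1 R) (le_trans (le_normcB _ _)).
Qed.

Lemma dkernel_den_neq0 w z : normc w < 1 -> normc z <= 1 -> 1 - conjc w * z != 0.
Proof.
move=> w1 z1; rewrite -normc_gt0 (lt_le_trans _ (dkernel_den w z)) // subr_gt0.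
by rewrite (le_lt_trans _ w1) // -[leRHS]mulr1 ler_wpM2l // normc_ge0.
Qed.

Lemma dkernel_hol w : normc w < 1 -> holomorphic (dkernel w).
Proof.
move=> w1 z z1; apply: dkernel_derivable; apply: dkernel_den_neq0 => //.
exact: ltW z1.
Qed.

Lemma dkernel_le w z (d : R) : 0 < d -> d <= normc (1 - conjc w * z) -> normc z <= 1 ->
  normc (dkernel w z) <= (d ^+ 2)^-1.
Proof.
move=> d0 hd z1; rewrite normcM normcV normcX -[leRHS]mul1r.
have D0 : 0 < normc (1 - conjc w * z) := lt_le_trans d0 hd.
apply: ler_pM => //; [exact: normc_ge0|by rewrite invr_ge0 exprn_ge0 // ltW|].
rewrite lef_pV2 ?posrE ?exprn_gt0 // ler_pXn2r // nnegrE; exact: ltW.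
Qed.

Lemma circ_inv a r n : 0 < r -> r < 1 -> on_circ a r (fun z => (z ^+ n)^-1).
Proof.
move=> r0 r1; apply: ccontV => [t _|]; last exact: circ_mono (ltW r0) r1.
by apply: expf_neq0; rewrite -normc_gt0 normc_polar normr_gt0 gt_eqF.
Qed.

Lemma cmean_neg a r k : (0 < k)%N -> 0 < r -> r < 1 ->
  cmean a r (fun z => (z ^+ k)^-1) = 0.
Proof.
move=> k0 r0 r1; have r0' := ltW r0.
have rk : (r ^+ (2 * k))%:C != 0 :> R[i].
  by rewrite -normc_gt0 normc_real normr_gt0 expf_neq0 // gt_eqF.
apply: (mulfI rk); rewrite mulr0 -cmeanZ; last exact: circ_inv.
transitivity (cmean a r (fun z => z ^+ 0 * conjc (z ^+ k))).
  by apply: cmean_ext => // z zr; rewrite mul1r (conj_mono _ r0 zr).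
by rewrite cmean_orth // eq_sym -leqn0 leqNgt k0 mul0r.
Qed.

Lemma dkernel_coef a r w j : 0 < r -> r < 1 -> normc w < 1 ->
  cmean a r (fun z => dkernel w z / z ^+ j) = j%:R * conjc w ^+ j.-1.
Proof.
move=> r0 r1 w1; have r0' := ltW r0; have hk := dkernel_hol w1.
have ck n : on_circ a r (fun z => dkernel w z / z ^+ n).
  exact: (ccontM (hol_circ a hk r0' r1) (circ_inv a n r0 r1)).
have znz z : normc z = r -> z != 0 by move=> zr; rewrite -normc_gt0 zr.
suff H n : cmean a r (fun z => dkernel w z / z ^+ n) = n%:R * conjc w ^+ n.-1 /\
    cmean a r (fun z => dkernel w z / z ^+ n.+1) = n.+1%:R * conjc w ^+ n.
  by case: (H j).
elim: n => [|n [IH0 IH1]].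
  split.
    transitivity (cmean a r (dkernel w)).
      by apply: cmean_ext => // z _; rewrite expr0 divr1.
    by rewrite (mean_value a hk r0 r1) /dkernel !mul0r.
  transitivity (cmean a r (fun z => (1 - conjc w * z) ^- 2)).
    apply: cmean_ext => // z zr; rewrite /dkernel expr1 mulrAC divff ?mul1r //.
    exact: znz.
  have hD : holomorphic (fun z => (1 - conjc w * z) ^- 2).
    move=> z z1; apply: cderV.
      by apply: expf_neq0; exact: (dkernel_den_neq0 w1 (ltW z1)).
    by apply: cderX; exact: den_derivable.
  by rewrite (mean_value a hD r0 r1) mulr0 subr0 expr1n invr1 expr0 mulr1.
split => //.
have -> : cmean a r (fun z => dkernel w z / z ^+ n.+2) =
    cmean a r (fun z => (z ^+ n.+1)^-1 +
      (2 * conjc w * (dkernel w z / z ^+ n.+1) -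
       conjc w ^+ 2 * (dkernel w z / z ^+ n))).
  apply: cmean_ext => // z zr; have z0 := znz z zr.
  have D0 : 1 - conjc w * z != 0.
    by apply: dkernel_den_neq0 => //; rewrite zr ltW.
  rewrite /dkernel !exprS; have zn : z ^+ n != 0 by exact: expf_neq0.
  move: (conjc w) (z ^+ n) zn D0 => v q q0 D0.
  by rewrite expr0; field; rewrite z0 q0 D0.
have c1 : on_circ a r (fun z => 2 * conjc w * (dkernel w z / z ^+ n.+1)).
  exact: (ccontZ _ (ck n.+1)).
have c2 : on_circ a r (fun z => conjc w ^+ 2 * (dkernel w z / z ^+ n)).
  exact: (ccontZ _ (ck n)).
rewrite cmeanD; [|exact: circ_inv|exact: (ccontB c1 c2)].
rewrite cmeanB // cmeanZ // cmeanZ // IH0 IH1 cmean_neg // add0r.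
case: n {IH0 IH1 c1 c2} => [|n] /=; first by rewrite mul0r mulr0 subr0 !expr0 expr1; ring.
have nS k : k.+1%:R = 1 + k%:R :> R[i] by rewrite mulrS.
by rewrite (nS n.+2) (nS n.+1) (nS n) !exprS expr0; move: (conjc w) (n%:R) (_ ^+ n) => v q k; ring.
Qed.

Lemma derive1_psum c N w :
  derive1 (psum c N) w = \sum_(n < N) c n * (n%:R * w ^+ n.-1).
Proof.
have dX n : is_derive w 1 (fun z : R[i] => z ^+ n) (n%:R * w ^+ n.-1).
  have := @is_deriveX R[i] R[i] id n w 1 1 (is_derive_id _ _).
  by rewrite /GRing.scale /= mulr1 exprfctE.
have : is_derive w 1 (psum c N) (\sum_(n < N) c n * (n%:R * w ^+ n.-1)).
  elim: N => [|N IH].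
    rewrite big_ord0 (_ : psum c 0 = cst 0); first exact: is_derive_cst.
    by apply/funext => z; rewrite /psum big_ord0.
  rewrite big_ord_recr /= (_ : psum c N.+1 =
      (fun z => psum c N z + c N * z ^+ N)); last first.
    by apply/funext => z; rewrite /psum big_ord_recr.
  apply: (is_deriveD IH).
by move=> h; rewrite derive1E derive_val.
Qed.

Lemma psum_conj_rev c N z : z != 0 ->
  psum (conj_rev c N) N.+1 z / z ^+ N = \sum_(j < N.+1) conjc (c j) / z ^+ j.
Proof.
move=> z0; rewrite /psum mulr_suml (reindex_inj rev_ord_inj) /=.
apply: eq_bigr => j _; have jN : (j <= N)%N by rewrite -ltnS.
rewrite subSS /conj_rev (subKn jN) -mulrA; congr (_ * _).
have zn n : z ^+ n != 0 by exact: expf_neq0.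
apply: (mulIf (zn N)); rewrite divfK //.
have -> : z ^+ N = z ^+ (N - j) * z ^+ j by rewrite -exprD subnK.
by rewrite mulrCA mulVf // mulr1.
Qed.

(** Cauchy's formula for the derivative of a polynomial, conjugated: on the
    unit circle conj(p) is a Laurent polynomial. *)
Lemma conj_derive1_psum a r w c N : 0 < r -> r < 1 -> normc w < 1 ->
  conjc (derive1 (psum c N.+1) w) =
  cmean a r (fun z => psum (conj_rev c N) N.+1 z / z ^+ N * dkernel w z).
Proof.
move=> r0 r1 w1; have r0' := ltW r0.
have ck n : on_circ a r (fun z => dkernel w z / z ^+ n).
  exact: (ccontM (hol_circ a (dkernel_hol w1) r0' r1) (circ_inv a n r0 r1)).
have -> : cmean a r (fun z => psum (conj_rev c N) N.+1 z / z ^+ N * dkernel w z) =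
    cmean a r (fun z => \sum_(j < N.+1) conjc (c j) * (dkernel w z / z ^+ j)).
  apply: cmean_ext => // z zr; rewrite psum_conj_rev -?normc_gt0 ?zr // mulr_suml.
  by apply: eq_bigr => j _; rewrite mulrAC -mulrA.
rewrite cmean_sum => [|j]; last exact: (ccontZ _ (ck j)).
rewrite derive1_psum conjc_sum; apply: eq_bigr => j _.
by rewrite cmeanZ // dkernel_coef // !conjcM conjcX (conjc_nat R j).
Qed.

Lemma rInt_normc_le a r phi : on_circ a r phi ->
  rInt a (a + 2 * pi) (fun t => normc (phi (r%:C * expi t))) <=
  2 * pi * Num.sqrt (msq a r phi).
Proof.
move=> h; set X := rInt _ _ _.
have X0 : 0 <= X by apply: rInt_ge0 => t _; exact: normc_ge0.
have := rInt_CauchySchwarz (cont_on_normc h) (cont_on_cst a (a + 2 * pi) (1 : R)).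
rewrite (rInt_eq (g := fun t => normc (phi (r%:C * expi t)))) => [|t _]; last first.
  by rewrite mulr1.
rewrite -/X [X in _ * X](rInt_eq (g := fun=> 1)) => [|t _]; last by rewrite expr1n.
rewrite rInt_cst // mul1r addrAC subrr add0r => CS.
have E : rInt a (a + 2 * pi) (fun t => normc (phi (r%:C * expi t)) ^+ 2) =
    2 * pi * msq a r phi.
  by rewrite /msq /rmean mulrA divff ?mul1r // gt_eqF.
rewrite E mulrAC -expr2 in CS.
rewrite -(@ler_pXn2r _ 2) // ?nnegrE.
  by rewrite exprMn sqr_sqrtr ?msq_ge0.
by rewrite mulr_ge0 ?sqrtr_ge0 // ltW.
Qed.

Lemma rInt_sub (a b c d : R) (g : R -> R) : a <= c -> c <= d -> d <= b ->
  cont_on a b g -> (forall t, 0 <= g t) -> rInt c d g <= rInt a b g.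
Proof.
move=> ac cd db hg g0; have ad := le_trans ac cd; have cb := le_trans cd db.
rewrite (rInt_split ac cb hg) (rInt_split cd db (cont_onS ac (lexx _) hg)).
rewrite addrCA lerDl addr_ge0 //; exact: rInt_ge0.
Qed.

Lemma sin_le_normc (eta s x : R) : cos s <= cos eta -> 0 <= x ->
  sin eta <= normc (1 - x%:C * expi s).
Proof.
move=> cs x0; rewrite (le_trans (ler_norm _)) //.
rewrite -(@ler_pXn2r _ 2) ?nnegrE ?normc_ge0 // real_normK ?num_real //.
rewrite normc_sqr /expi /= !mul0r subr0 addr0 sub0r sqrrN.
have s1 := cos2Dsin2 s; have e1 := cos2Dsin2 eta.
have -> : (1 - x * cos s) ^+ 2 + (x * sin s) ^+ 2 =
    1 - 2 * x * cos s + x ^+ 2 * (cos s ^+ 2 + sin s ^+ 2) by ring.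
have -> : sin eta ^+ 2 = 1 - cos eta ^+ 2 by rewrite -e1; ring.
rewrite s1 mulr1; have := sqr_ge0 (x - cos eta); nra.
Qed.

Lemma cos_le_out (eta s : R) : 0 <= eta -> eta <= s -> s <= 2 * pi - eta ->
  cos s <= cos eta.
Proof.
move=> e0 es se; have [sp|ps] := leP s pi.
  by rewrite leNgt ltr_cos -?leNgt // in_itv /=; apply/andP; split; lra.
have -> : cos s = cos (2 * pi - s).
  by rewrite mulr_natl cosB cos2pi sin2pi mul0r addr0 mul1r.
rewrite leNgt ltr_cos -?leNgt ?in_itv /=; first lra; by apply/andP; split; lra.
Qed.

Lemma sum_CauchySchwarz n (F G : 'I_n -> R) :
  (\sum_(i < n) F i * G i) ^+ 2 <= (\sum_(i < n) F i ^+ 2) * (\sum_(i < n) G i ^+ 2).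
Proof.
apply: discr_le => [|l]; first by apply: sumr_ge0 => i _; exact: sqr_ge0.
rewrite !mulr_sumr -!big_split /=; apply: sumr_ge0 => i _.
rewrite (_ : _ + _ = (F i + l * G i) ^+ 2) ?sqr_ge0 //; by ring.
Qed.

(** The Cauchy-Schwarz inequality for the tail of the Taylor series, compared
    with a geometric series that starts at |z|^N. *)
Lemma tail_growth f (B : R) N z : holomorphic f -> unit_disk z -> 0 <= B ->
  (forall K, sqsum (coef f) K <= B ^+ 2) ->
  normc (f z - psum (coef f) N.+1 z) <= B * normc z ^+ N / Num.sqrt (1 - normc z).
Proof.
move=> hf z1 B0 hB; set rho := normc z; have rho1 : rho < 1 by [].
have rho0 : 0 <= rho by exact: normc_ge0.
have d0 : 0 < 1 - rho by rewrite subr_gt0.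
have s0 : 0 < Num.sqrt (1 - rho) by rewrite sqrtr_gt0.
apply/ler_addgt0Pl => e e0.
have [K0 hK] := taylor_unif hf rho0 rho1 e0.
have h1 := hK (N.+1 + K0)%N z (leq_addl _ _) (lexx _).
have -> : f z - psum (coef f) N.+1 z = (f z - psum (coef f) (N.+1 + K0) z) +
    \sum_(i < K0) coef f (N.+1 + i) * z ^+ (N.+1 + i).
  by rewrite {2}/psum big_split_ord /= -/(psum _ _ _) opprD addrA subrK.
rewrite (le_trans (le_normcD _ _)) // lerD //.
set S := \sum_(i < K0) _.
have S1 : normc S <= \sum_(i < K0) normc (coef f (N.+1 + i)) * rho ^+ (N.+1 + i).
  rewrite (le_trans (normc_sum _ _ _)) //; apply: ler_sum => i _.
  by rewrite normcM normcX.
rewrite (le_trans S1) //; set X := \sum_(i < K0) _.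
have X0 : 0 <= X.
  by apply: sumr_ge0 => i _; rewrite mulr_ge0 ?normc_ge0 ?exprn_ge0.
have G : \sum_(i < K0) (rho ^+ (N.+1 + i)) ^+ 2 <= (rho ^+ N) ^+ 2 / (1 - rho).
  have gs : \sum_(i < K0) rho ^+ i <= (1 - rho)^-1.
    rewrite -(ler_pM2r d0) mulVf ?gt_eqF //.
    have := subrX1 rho K0; rewrite mulrC => E.
    rewrite -(opprB rho 1) mulrN -E opprB lerBlDr lerDl; exact: exprn_ge0.
  apply: (@le_trans _ _ ((rho ^+ N) ^+ 2 * \sum_(i < K0) rho ^+ i)); last first.
    by apply: ler_wpM2l => //; exact: sqr_ge0.
  rewrite mulr_sumr; apply: ler_sum => i _.
  have -> : (rho ^+ (N.+1 + i)) ^+ 2 = (rho ^+ N) ^+ 2 * rho ^+ i * rho ^+ (i + 2).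
    by rewrite -!exprM -!exprD; congr (_ ^+ _); lia.
  rewrite -[leRHS]mulr1; apply: ler_wpM2l.
    by rewrite mulr_ge0 ?sqr_ge0 ?exprn_ge0.
  by apply: exprn_ile1 => //; exact: ltW.
have CS := sum_CauchySchwarz (fun i : 'I_K0 => normc (coef f (N.+1 + i)))
  (fun i => rho ^+ (N.+1 + i)).
have C1 : \sum_(i < K0) normc (coef f (N.+1 + i)) ^+ 2 <= B ^+ 2.
  rewrite (le_trans _ (hB (N.+1 + K0)%N)) // /sqsum big_split_ord /= lerDr.
  by apply: sumr_ge0 => i _; exact: sqr_ge0.
have C2 : X ^+ 2 <= (B * rho ^+ N / Num.sqrt (1 - rho)) ^+ 2.
  rewrite (le_trans CS) // exprMn exprVn sqr_sqrtr ?(ltW d0) // exprMn -mulrA.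
  apply: ler_pM => //; apply: sumr_ge0 => i _; exact: sqr_ge0.
by rewrite -(@ler_pXn2r _ 2) // nnegrE // divr_ge0 ?mulr_ge0 ?exprn_ge0.
Qed.

Lemma rInt_inv_sqrt (x1 x2 : R) : x1 <= x2 -> x2 < 1 ->
  rInt x1 x2 (fun x => (Num.sqrt (1 - x))^-1) <= 2 * Num.sqrt (1 - x1).
Proof.
move=> x12 x21.
have pos x : x1 <= x <= x2 -> 0 < 1 - x by move=> /andP[_ h]; lra.
have dF x : x1 <= x <= x2 -> is_derive x 1 (fun y : R => - 2 * Num.sqrt (1 - y))
    (Num.sqrt (1 - x))^-1.
  move=> /pos px.
  have d1 : is_derive x 1 (fun y : R => 1 - y) (- 1) by apply: is_derive_eq; ring.
  have d2 := is_derive1_sqrt px.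
  have d3 : is_derive x 1 (fun y : R => Num.sqrt (1 - y)) ((2 * Num.sqrt (1 - x))^-1 * - 1).
    exact: (@is_derive1_comp _ Num.sqrt (fun y : R => 1 - y) x).
  apply: is_derive_eq; rewrite /GRing.scale /=; field.
  by rewrite gt_eqF // sqrtr_gt0.
have cF : cont_on x1 x2 (fun x : R => (Num.sqrt (1 - x))^-1).
  apply: cont_onV => [x /pos px|]; first by rewrite gt_eqF // sqrtr_gt0.
  apply/cont_onP => x /pos px; apply: (@continuous_comp _ _ _ (fun y : R => 1 - y)).
    by apply: cvgB; [exact: cvg_cst|exact: cvg_id].
  exact: sqrt_continuous.
rewrite (rInt_FTC x12 cF dF); have := sqrtr_ge0 (1 - x2); lra.
Qed.

End LocalBound.

(** * Derivatives of the model space off the spectrum *)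

Section LocalBoundMain.
Variable R : realType.
Implicit Types (r t x : R) (f g h u : R[i] -> R[i]) (z w : R[i]).

Let pi2 : 0 < 2 * pi :> R. Proof. by rewrite mulr_gt0 // pi_gt0. Qed.

Lemma pow_near1 (rho : R) N : rho < 1 ->
  exists r, [/\ rho < r, r < 1 & 2^-1 <= r ^+ N].
Proof.
move=> rho1; apply: contrapT => H.
suff : (1 : R) ^+ N <= 2^-1.
  by rewrite expr1n leNgt invf_lt1 ?ltr1n.
have c : {for 1, continuous (fun r : R => r ^+ N)}.
  have : cont_on 1 1 (fun r : R => r ^+ N).
    by apply: cont_onX; apply/cont_onP => x _; exact: cvg_id.
  by move/cont_onP; apply; rewrite lexx.
apply: (left1_le c rho1) => r h1 h2; rewrite leNgt; apply/negP => h3.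
by apply: H; exists r; split => //; exact: ltW.
Qed.

Lemma sqrt_le4 (m v : R) : m <= 2 ^+ 2 * v -> Num.sqrt m <= 2 * Num.sqrt v.
Proof.
move=> h; rewrite (le_trans (ler_wsqrtr h)) // sqrtrM ?sqr_ge0 // sqrtr_sqr.
by rewrite ger0_norm.
Qed.

Lemma msq_div_pow a r phi N : 0 < r -> r < 1 -> 2^-1 <= r ^+ N ->
  on_circ a r phi ->
  msq a r (fun z => phi z / z ^+ N) <= 2 ^+ 2 * msq a r phi.
Proof.
move=> r0 r1 rN c; have r0' := ltW r0.
apply: msq_leM => //; first exact: (ccontM c (circ_inv a N r0 r1)).
move=> z zr; rewrite normcM normcV normcX zr mulrC.
apply: ler_wpM2r; first exact: normc_ge0.
by rewrite -[leRHS]invrK lef_pV2 // posrE ?exprn_gt0 ?invr_gt0.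
Qed.

(** For p a truncation of a function of the model space, near a point of the
    circle where u stays away from 0.  The conjugate of p'(w) is the mean of Q k,
    with Q = z^-N q(z), equal to conj(p) on the unit circle, and k the derivative
    kernel.  Off the arc around the point k is bounded.  On the arc, u Q splits
    into its part g of positive frequency and a Laurent polynomial.  Goursat's
    theorem moves the integral of g k / u into the disk, where everything is
    bounded by the growth of g; the Laurent part is small by [model_tail], with a
    constant that may depend on w. *)
Lemma local_bound u (M cu t0 eta : R) :
  holomorphic u -> 0 <= M -> (forall z, unit_disk z -> normc (u z) <= M) ->
  0 < eta -> eta <= 2^-1 -> 0 < cu ->
  (forall x t, 1 - eta <= x -> x < 1 -> t0 - eta <= t <= t0 + eta ->
     cu <= normc (u (x%:C * expi t))) ->
  exists2 C : R, 0 <= C & exists2 dl : R, 0 < dl &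
  forall w, unit_disk w -> normc (w - expi t0) <= dl ->
  exists2 Cw : R, 0 <= Cw & forall (p : nat -> R[i]) N,
    normc (derive1 (psum p N.+1) w) <= C * Num.sqrt (sqsum p N.+1) +
      Cw * Num.sqrt (sqsum (coef (fun z => u z * psum (conj_rev p N) N.+1 z)) N.+1).
Proof.
move=> hu M0 uM eta0 eta1 cu0 ucu.
have pi3 : 2 <= pi :> R := pi_ge2 R.
have eta_pi : 0 < eta < pi by apply/andP; split => //; lra.
have sin0 : 0 < sin eta := sin_gt0_pi eta_pi.
have [d d0 [d_sin d_eta]] : exists2 d : R, 0 < d & 2 * d <= sin eta /\ 2 * d <= eta.
  exists (Num.min (sin eta) eta / 2); first by rewrite divr_gt0 // lt_min sin0.
  by rewrite mulrCA divff // mulr1 !ge_min !lexx orbT.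
have [K K0 KE] : exists2 K, 0 < K & K = (d ^+ 2)^-1.
  by exists (d ^+ 2)^-1 => //; rewrite invr_gt0 exprn_gt0.
have [s s0 sE] : exists2 s, 0 < s & s = Num.sqrt eta.
  by exists (Num.sqrt eta) => //; rewrite sqrtr_gt0.
pose A1 := K * (2 * pi * 2).
pose A2 := M / s * K / cu * (2 * eta) + 2 * (2 * (M * K / cu) * (2 * s)).
have A10 : 0 <= A1 by rewrite !mulr_ge0 ?pi_ge0 // ltW.
have A20 : 0 <= A2.
  by rewrite addr_ge0 ?mulr_ge0 ?invr_ge0 // ltW.
exists ((A1 + A2) / (2 * pi)); first by apply: divr_ge0; [exact: addr_ge0|exact: ltW].
exists d => // w w1 wd; have w1' : normc w < 1 := w1.
have iw0 : 0 < 1 - normc w by rewrite subr_gt0.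
have [Kw Kw0 KwE] : exists2 Kw, 0 < Kw & Kw = ((1 - normc w) ^+ 2)^-1.
  by exists ((1 - normc w) ^+ 2)^-1 => //; rewrite invr_gt0 exprn_gt0.
exists (Kw / cu * 2) => [|p N].
  by rewrite !mulr_ge0 ?invr_ge0 // ltW.
set S := Num.sqrt (sqsum p N.+1); set q := psum (conj_rev p N) N.+1.
pose U z := u z * q z; rewrite -[fun z => u z * q z]/U.
set Y := Num.sqrt _.
have S0 : 0 <= S by exact: sqrtr_ge0.
have Y0 : 0 <= Y by exact: sqrtr_ge0.
have hq : holomorphic q := @hol_psum R _ _.
have hU : holomorphic U := holM hu hq.
pose V := psum (coef U) N.+1; have hV : holomorphic V := @hol_psum R _ _.
have UB k : sqsum (coef U) k <= (M * S) ^+ 2.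
  apply: sqsum_coef_le => // r r0 r1; have r0' := ltW r0.
  rewrite (le_trans (msq_leM (M := M) (psi := q) r0' (hol_circ 0 hU r0' r1)
    (hol_circ 0 hq r0' r1) _)) //.
    move=> z zr; rewrite normcM; apply: ler_wpM2r; first exact: normc_ge0.
    by apply: uM; rewrite /unit_disk /mkset zr.
  rewrite exprMn; apply: ler_wpM2l; first exact: sqr_ge0.
  rewrite sqr_sqrtr ?sqsum_ge0 // msq_psum // -(sqsum_conj_rev p N).
  by apply: weighted_le => //; exact: ltW.
(* r is so close to 1 that dividing by z^N costs a factor at most 2. *)
have [r [rho_r r1 rN]] := @pow_near1 (1 - eta) N ltac:(by rewrite ltrBlDr ltrDl).
have r0 : 0 < r by lra.
have r0' := ltW r0.
pose a := t0 - eta; pose t1 := t0 + eta; pose b := a + 2 * pi.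
have at1 : a <= t1 by rewrite /a /t1; lra.
have t1b : t1 <= b by rewrite /t1 /b /a; lra.
(* On the circle u Q = g + n, where g extends into the disk. *)
pose Q z := q z / z ^+ N; pose n z := V z / z ^+ N; pose g z := (U z - V z) / z ^+ N.
pose k := dkernel w; have hk : holomorphic k := dkernel_hol w1.
have cq : on_circ a r q := hol_circ a hq r0' r1.
have cQ : on_circ a r Q := ccontM cq (circ_inv a N r0 r1).
have ck : on_circ a r k := hol_circ a hk r0' r1.
have cQk : on_circ a r (fun z => Q z * k z) := ccontM cQ ck.
have rep : (2 * pi)%:C * conjc (derive1 (psum p N.+1) w) =
    cInt a b (fun t => Q (r%:C * expi t) * k (r%:C * expi t)).
  rewrite (conj_derive1_psum a p N r0 r1 w1') /cmean mulrA -rcM mulfV ?gt_eqF //.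
  by rewrite mul1r.
have split : cInt a b (fun t => Q (r%:C * expi t) * k (r%:C * expi t)) =
    cInt a t1 (fun t => Q (r%:C * expi t) * k (r%:C * expi t)) +
    cInt t1 b (fun t => Q (r%:C * expi t) * k (r%:C * expi t)).
  exact: (cInt_split at1 t1b cQk).
have QS : rInt a b (fun t => normc (Q (r%:C * expi t))) <= 2 * pi * 2 * S.
  rewrite (le_trans (rInt_normc_le cQ)) // -[leRHS]mulrA; apply: ler_wpM2l; first exact: ltW.
  apply: sqrt_le4.
  rewrite (le_trans (msq_div_pow r0 r1 rN cq)) //; apply: ler_wpM2l; first exact: sqr_ge0.
  rewrite msq_psum // -(sqsum_conj_rev p N).
  by apply: weighted_le => //; exact: ltW.
(* If w is replaced by the boundary point expi t0, the distance is at least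
   2 d; the replacement changes it by at most d. *)
have den x t : 0 <= x -> x <= 1 ->
    (cos (t - t0) <= cos eta) \/ (x <= 1 - eta) ->
    d <= normc (1 - conjc w * (x%:C * expi t)).
  move=> x0 x1 far.
  have far2 : 2 * d <= normc (1 - x%:C * expi (t - t0)).
    case: far => far; first exact: le_trans (sin_le_normc far x0).
    rewrite (le_trans d_eta) //.
    by rewrite (le_trans _ (le_normcB _ _)) // normc1 normc_polar ger0_norm //; lra.
  have E : 1 - x%:C * expi (t - t0) =
      (1 - conjc w * (x%:C * expi t)) + conjc (w - expi t0) * (x%:C * expi t).
    rewrite conjcD conjcN conj_expi addrC expiD mulrDl mulNr; ring.
  have := le_normcD (1 - conjc w * (x%:C * expi t))
    (conjc (w - expi t0) * (x%:C * expi t)).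
  rewrite -E normcM normc_conj normc_polar ger0_norm // => h.
  have h2 : normc (w - expi t0) * x <= d * 1 by apply: ler_pM => //; exact: normc_ge0.
  lra.
have kK x t : 0 <= x -> x <= 1 ->
    (cos (t - t0) <= cos eta) \/ (x <= 1 - eta) -> normc (k (x%:C * expi t)) <= K.
  move=> x0 x1 far; rewrite KE; apply: dkernel_le => //; first exact: den.
  by rewrite normc_polar ger0_norm.
(* Off the arc the kernel is at most K. *)
have off : normc (cInt t1 b (fun t => Q (r%:C * expi t) * k (r%:C * expi t))) <= A1 * S.
  have cQk' := cont_onS at1 (lexx b) cQk.
  have cQ' := cont_onS at1 (lexx b) cQ.
  rewrite (le_trans (cInt_le cQk')) //.
  rewrite (@le_trans _ _ (rInt t1 b (fun t => K * normc (Q (r%:C * expi t))))) //.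
    apply: rInt_le; first exact: cont_on_normc cQk'.
      by apply: cont_onM; [exact: cont_on_cst|exact: cont_on_normc cQ'].
    move=> t /andP[ht1 ht2]; rewrite normcM mulrC.
    apply: ler_wpM2r; first exact: normc_ge0.
    apply: kK => //; first exact: ltW.
    left; apply: cos_le_out; move: ht1 ht2; rewrite /t1 /b /a; lra.
  rewrite rIntZ; last exact: cont_on_normc cQ'.
  rewrite /A1 -mulrA; apply: ler_wpM2l; first exact: ltW.
  rewrite (le_trans _ QS) //; apply: rInt_sub => //; first exact: cont_on_normc cQ.
  by move=> t; exact: normc_ge0.
have u_neq0 x t : 1 - eta <= x -> x < 1 -> a <= t <= t1 -> u (x%:C * expi t) != 0.
  by move=> h1 h2 h3; rewrite -normc_gt0 (lt_le_trans cu0) // ucu.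
have cu' : cont_on a t1 (fun t => (u (r%:C * expi t))^-1).
  apply: ccontV => [t ht|]; first by apply: u_neq0 => //; exact: ltW.
  exact: hol_circle.
have cV : on_circ a r V := hol_circ a hV r0' r1.
have cn : on_circ a r n := ccontM cV (circ_inv a N r0 r1).
have cU : on_circ a r U := hol_circ a hU r0' r1.
have cg : on_circ a r g := ccontM (ccontB cU cV) (circ_inv a N r0 r1).
have cn' := cont_onS (lexx a) t1b cn.
have cg' := cont_onS (lexx a) t1b cg.
have ck' := cont_onS (lexx a) t1b ck.
pose phi z := g z * k z / u z.
have on_split : cInt a t1 (fun t => Q (r%:C * expi t) * k (r%:C * expi t)) =
    cInt a t1 (fun t => phi (r%:C * expi t)) +
    cInt a t1 (fun t => n (r%:C * expi t) * k (r%:C * expi t) / u (r%:C * expi t)).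
  rewrite -cIntD; last 2 first.
  - exact: (ccontM (ccontM cg' ck') cu').
  - exact: (ccontM (ccontM cn' ck') cu').
  apply: eq_cInt => t ht; rewrite /phi /g /n /Q /U.
  have un := u_neq0 r t (ltW rho_r) r1 ht.
  move: (u _) (q _) (V _) (k _) ((_ ^+ N)^-1) un => u' q' V' k' e' un.
  by field.
(* The only bound on the kernel that depends on w. *)
have on_n : normc (cInt a t1 (fun t => n (r%:C * expi t) * k (r%:C * expi t) /
      u (r%:C * expi t))) <= Kw / cu * (2 * pi * 2 * Y).
  have cnn := ccontM (ccontM cn' ck') cu'.
  rewrite (le_trans (cInt_le cnn)) //.
  rewrite (@le_trans _ _ (rInt a t1 (fun t => Kw / cu * normc (n (r%:C * expi t))))) //.
    apply: rInt_le; first exact: cont_on_normc cnn.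
      by apply: cont_onM; [exact: cont_on_cst|exact: cont_on_normc cn'].
    move=> t ht; rewrite normcM normcM -mulrA mulrC.
    apply: ler_wpM2r; first exact: normc_ge0.
    apply: ler_pM; rewrite ?normc_ge0 //.
      rewrite KwE; apply: dkernel_le => //; last by rewrite normc_polar ger0_norm // ltW.
      rewrite (le_trans _ (dkernel_den _ _)) // normc_polar ger0_norm // lerB //.
      by rewrite -[leRHS]mulr1 ler_wpM2l ?normc_ge0 // ltW.
    rewrite normcV lef_pV2 ?posrE // ?ucu ?(ltW rho_r) //.
    by rewrite normc_gt0 u_neq0 // ltW.
  rewrite rIntZ; last exact: cont_on_normc cn'.
  apply: ler_wpM2l; first by rewrite divr_ge0 // ltW.
  rewrite (@le_trans _ _ (rInt a b (fun t => normc (n (r%:C * expi t))))) //.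
    apply: rInt_sub => //; first exact: cont_on_normc cn.
    by move=> t; exact: normc_ge0.
  rewrite (le_trans (rInt_normc_le cn)) // -[leRHS]mulrA; apply: ler_wpM2l; first exact: ltW.
  apply: sqrt_le4.
  rewrite (le_trans (msq_div_pow r0 r1 rN cV)) //; apply: ler_wpM2l; first exact: sqr_ge0.
  by rewrite msq_psum //; apply: weighted_le => //; exact: ltW.
(* The factor |z|^N in the growth of the tail U - V cancels the z^-N in g, so
   that the bound is uniform in N. *)
have gB x t : 0 < x -> x < 1 ->
    normc (g (x%:C * expi t)) <= M * S / Num.sqrt (1 - x).
  move=> x0 x1; have x0' := ltW x0.
  have := tail_growth N hU (disk_polar t x0' x1) (mulr_ge0 M0 S0) UB.
  rewrite normc_polar ger0_norm // => h.
  rewrite /g normcM normcV normcX normc_polar ger0_norm //.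
  by rewrite ler_pdivrMr ?exprn_gt0 // mulrAC.
have phiB x t : 1 - eta <= x -> x < 1 -> a <= t <= t1 ->
    (cos (t - t0) <= cos eta) \/ (x <= 1 - eta) ->
    normc (phi (x%:C * expi t)) <= M * S * K / cu * (Num.sqrt (1 - x))^-1.
  move=> h1 h2 h3 h4; have x0 : 0 < x by lra.
  rewrite /phi normcM normcM normcV.
  have -> : M * S * K / cu * (Num.sqrt (1 - x))^-1 =
      M * S / Num.sqrt (1 - x) * K * cu^-1 by ring.
  apply: ler_pM; rewrite ?mulr_ge0 ?invr_ge0 ?normc_ge0 //.
    by apply: ler_pM; rewrite ?normc_ge0 ?gB ?kK // ltW.
  by rewrite lef_pV2 ?posrE ?normc_gt0 ?u_neq0 ?ucu.
have dphi x t : 1 - eta <= x <= r -> a <= t <= t1 -> derivable phi (x%:C * expi t) 1.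
  move=> /andP[h1 h2] h3; have x0 : 0 < x by lra.
  have x1 : x < 1 by lra.
  have D : unit_disk (x%:C * expi t) by apply: disk_polar => //; exact: ltW.
  apply: (@cderM R (fun z => g z * k z) (fun z => (u z)^-1)).
    apply: (@cderM R g k); last exact: hk.
    apply: (@cderM R (fun z => U z - V z) (fun z => (z ^+ N)^-1)).
      by apply: cderB; [exact: hU|exact: hV].
    apply: cderV; last by apply: cderX; exact: cder_id.
    by apply: expf_neq0; rewrite -normc_gt0 normc_polar normr_gt0 gt_eqF.
  by apply: cderV; [exact: u_neq0|exact: hu].
have x10 : 0 < 1 - eta by lra.
have G := @goursat_sector R phi (1 - eta) r a t1 x10 (ltW rho_r) at1 dphi.
have inner_arc : normc (cInt a t1 (fun t => phi ((1 - eta)%:C * expi t))) <=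
    M / s * K / cu * (2 * eta) * S.
  rewrite (le_trans (cInt_le_cst (K := M * S * K / cu * s^-1) at1 _ _)) //.
  - apply: cont_on_circle => t ht; apply: derivable_continuous_pt; apply: dphi => //.
    by rewrite lexx ltW.
  - move=> t ht; have -> : s = Num.sqrt (1 - (1 - eta)) by rewrite sE; congr Num.sqrt; ring.
    by apply: phiB => //; [lra|right].
  - by rewrite /t1 /a le_eqVlt; apply/orP; left; apply/eqP; ring.
(* The edges stay at angle eta from t0, and (1 - x)^(-1/2) is integrable. *)
have edge t : a <= t <= t1 -> cos (t - t0) <= cos eta ->
    normc (cInt (1 - eta) r (fun x => phi (x%:C * expi t) / x%:C)) <=
    2 * (M * K / cu) * (2 * s) * S.
  move=> ht far.
  have rr x : 1 - eta <= x <= r -> 0 < x /\ x < 1 by move=> /andP[]; lra.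
  have cphi : cont_on (1 - eta) r (fun x => phi (x%:C * expi t) / x%:C).
    apply: ccontM.
      apply: (cont_on_comp (h := fun x => x%:C * expi t) (g := phi)).
        by move=> x hx; apply: derivable_continuous_pt; exact: dphi.
      by apply: ccontM; [exact: ccont_real|exact: ccont_cst].
    apply: ccontV => [x /rr[x0 _]|]; last exact: ccont_real.
    by rewrite -normc_gt0 normc_real normr_gt0 gt_eqF.
  have cs : cont_on (1 - eta) r (fun x => (Num.sqrt (1 - x))^-1).
    apply: cont_onV => [x /rr[_ x1]|]; first by rewrite gt_eqF // sqrtr_gt0 subr_gt0.
    apply/cont_onP => x _; apply: (@continuous_comp _ _ _ (fun y : R => 1 - y)).
      by apply: cvgB; [exact: cvg_cst|exact: cvg_id].
    exact: sqrt_continuous.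
  rewrite (le_trans (cInt_le cphi)) //.
  rewrite (@le_trans _ _ (rInt (1 - eta) r
    (fun x => 2 * (M * S * K / cu) * (Num.sqrt (1 - x))^-1))) //.
    apply: rInt_le; first exact: cont_on_normc cphi.
      by apply: cont_onM => //; exact: cont_on_cst.
    move=> x hx; have [x0 x1] := rr x hx; rewrite normcM normcV normc_real mulrC -mulrA.
    apply: ler_pM; rewrite ?invr_ge0 ?normc_ge0 //.
      rewrite gtr0_norm // -[leRHS]invrK lef_pV2 ?posrE ?invr_gt0 //.
      by case/andP: hx; lra.
    by apply: phiB => //; [case/andP: hx|left].
  rewrite rIntZ //.
  have -> : 2 * (M * K / cu) * (2 * s) * S = 2 * (M * S * K / cu) * (2 * s) by ring.
  apply: ler_wpM2l.
    by rewrite !mulr_ge0 ?invr_ge0 // ltW.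
  have -> : s = Num.sqrt (1 - (1 - eta)) by rewrite sE; congr Num.sqrt; ring.
  by apply: rInt_inv_sqrt => //; exact: ltW.
have on_phi : normc (cInt a t1 (fun t => phi (r%:C * expi t))) <= A2 * S.
  have ni : normc ('i : R[i]) = 1 by rewrite /= expr0n expr1n add0r sqrtr1.
  have e1 : normc (cInt (1 - eta) r (fun x => phi (x%:C * expi t1) / x%:C)) <=
      2 * (M * K / cu) * (2 * s) * S.
    by apply: edge; rewrite ?at1 ?lexx // /t1 addrAC subrr add0r.
  have e2 : normc (cInt (1 - eta) r (fun x => phi (x%:C * expi a) / x%:C)) <=
      2 * (M * K / cu) * (2 * s) * S.
    by apply: edge; rewrite ?at1 ?lexx // /a addrAC subrr add0r cosN.
  move: G e1 e2 inner_arc.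
  set I1 := cInt a t1 _; set I0 := cInt a t1 _; set J1 := cInt _ _ _; set J2 := cInt _ _ _.
  move=> G e1 e2 e3.
  have -> : I1 = I0 + (I1 - I0) by ring.
  have E : normc (I1 - I0) = normc (J1 - J2) by rewrite -G normcM ni mul1r.
  rewrite (le_trans (le_normcD _ _)) // E /A2 mulrDl lerD // (le_trans (le_normcD _ _)) //.
  by rewrite normcN; lra.
have total : 2 * pi * normc (derive1 (psum p N.+1) w) <=
    (A1 + A2) * S + Kw / cu * (2 * pi * 2 * Y).
  have -> : 2 * pi * normc (derive1 (psum p N.+1) w) =
      normc ((2 * pi)%:C * conjc (derive1 (psum p N.+1) w)).
    by rewrite normcM normc_conj normc_real gtr0_norm.
  rewrite rep split on_split (le_trans (le_normcD _ _)) //.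
  have h := le_normcD (cInt a t1 (fun t => phi (r%:C * expi t)))
    (cInt a t1 (fun t => n (r%:C * expi t) * k (r%:C * expi t) / u (r%:C * expi t))).
  by lra.
rewrite -(ler_pM2l pi2) (le_trans total) // le_eqVlt; apply/orP; left; apply/eqP.
have pn : 2 * pi != 0 :> R by rewrite gt_eqF.
have alg (P A X W Z : R) : P != 0 ->
    A * X + W * (P * 2 * Z) = P * (A / P * X + W * 2 * Z) by move=> P0; field.
exact: alg.
Qed.

End LocalBoundMain.

Section ModelDerivative.
Variable R : realType.
Implicit Types (r t x : R) (f g u : R[i] -> R[i]) (z w : R[i]).

Lemma spectrum_compl u l : unit_circle l -> ~ boundary_spectrum u l ->
  exists2 e : R, 0 < e & forall z, unit_disk z -> normc (z - l) < e ->
    2^-1 <= normc (u z).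
Proof.
move=> l1 nl.
have {nl} : (1 <= limf_einf (fun z => (normc (u z))%:E) (within unit_disk (nbhs l)))%E.
  by rewrite leNgt; apply/negP => h; apply: nl.
rewrite limf_einfE => h.
have h2 : ((2^-1 : R)%:E < ereal_sup [set ereal_inf ((fun z => (normc (u z))%:E) @` V) |
    V in within unit_disk (nbhs l)])%E.
  by rewrite (lt_le_trans _ h) // lte_fin invf_lt1 ?ltr1n.
move/ereal_sup_gt : h2 => [_ [V hV <-] hinf].
move: hV => /nbhs_normcP [e e0 he]; exists e => // z z1 zl.
rewrite -lee_fin (le_trans (ltW hinf)) //; apply: ereal_inf_lbound.
by exists z => //; apply: he.
Qed.

(** Pass to the limit of Taylor polynomials in [local_bound]: for fixed w its
    second term tends to 0 by [model_tail]. *)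
Lemma model_derivative_bound u t0 : inner u -> ~ boundary_spectrum u (expi t0) ->
  exists2 C : R, 0 <= C & exists2 dl : R, 0 < dl &
  forall f (T : R), model_space u f -> hardy_normsq f = T%:E ->
  forall w, unit_disk w -> normc (w - expi t0) <= dl ->
    normc (derive1 f w) ^+ 2 <= C * T.
Proof.
move=> [hu [M uM] _] nsp.
have M0 : 0 <= M.
  by rewrite (le_trans (normc_ge0 (u 0))) // uM // /unit_disk /mkset normc0.
have [e e0 he] := spectrum_compl (normc_expi t0) nsp.
have e20 : 0 < e / 2 by rewrite divr_gt0.
have [d d0 hd] : exists2 d : R, 0 < d & forall t, `|t - t0| < d ->
    normc (expi t - expi t0) < e / 2.
  have := @expi_continuous R t0 => /cvg_normcP /(_ _ e20).
  move=> /nbhs_ballP [d /= d0 hd]; exists d => // t ht; apply: hd.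
  by rewrite -ball_normE /= distrC.
have [eta [eta0 eta1 eta2 eta3]] : exists eta : R,
    [/\ 0 < eta, eta <= 2^-1, eta < e / 2 & eta < d].
  exists (Num.min 2^-1 (Num.min (e / 4) (d / 2))); split.
  - by rewrite !lt_min !divr_gt0 // invr_gt0 ltr0n.
  - by rewrite ge_min lexx.
  - by rewrite !gt_min; apply/orP; right; apply/orP; left; lra.
  - by rewrite !gt_min; apply/orP; right; apply/orP; right; lra.
have h20 : 0 < 2^-1 :> R by rewrite invr_gt0.
have ucu x t : 1 - eta <= x -> x < 1 -> t0 - eta <= t <= t0 + eta ->
    2^-1 <= normc (u (x%:C * expi t)).
  move=> x0 x1 /andP[h1 h2]; have x00 : 0 <= x by lra.
  apply: he; first exact: disk_polar.
  have -> : x%:C * expi t - expi t0 = (x - 1)%:C * expi t + (expi t - expi t0).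
    by rewrite rmorphB /= mulrBl mul1r addrA subrK.
  rewrite (le_lt_trans (le_normcD _ _)) // normc_polar (splitr e) ltrD //.
    by rewrite ler0_norm; lra.
  by apply: hd; rewrite (le_lt_trans _ eta3) // ler_norml; apply/andP; split; lra.
have [C C0 [dl dl0 H]] := local_bound hu M0 uM eta0 eta1 h20 ucu.
exists (C ^+ 2); first exact: sqr_ge0.
exists dl => // f T [hf orth] fT w w1 wd.
have [T' []] := hardy_parseval hf; rewrite fT => -[<-] hS hmsq hlim.
have T0 : 0 <= T := le_trans (sqsum_ge0 _ 0) (hS 0%N).
have [Cw Cw0 Hw] := H w w1 wd.
suff : normc (derive1 f w) <= C * Num.sqrt T.
  move=> h; rewrite (@le_trans _ _ ((C * Num.sqrt T) ^+ 2)) //.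
    by rewrite ler_pXn2r // nnegrE ?normc_ge0 // mulr_ge0 ?sqrtr_ge0.
  by rewrite exprMn sqr_sqrtr.
apply/ler_addgt0Pl => ep ep0.
have ep2 : 0 < ep / 2 by rewrite divr_gt0.
have CM : 0 < Cw * M + 1 by rewrite ltr_wpDl // mulr_ge0.
have e10 : 0 < (ep / 2 / (Cw * M + 1)) ^+ 2 by rewrite exprn_gt0 // divr_gt0.
have [N1 hN1] := taylor_deriv hf.1 w1 ep2.
have [N2 hN2] := hlim _ e10.
pose N := maxn N1 N2.
have a1 := hN1 N.+1 (leq_trans (leq_maxl _ _) (leqnSn _)).
have a2 := hN2 N.+1 (leq_trans (leq_maxr _ _) (leqnSn _)).
have tail := model_tail N hu uM hf hmsq orth.
have b1 : C * Num.sqrt (sqsum (coef f) N.+1) <= C * Num.sqrt T.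
  by apply: ler_wpM2l => //; exact: ler_wsqrtr.
have b2 : Cw * Num.sqrt (sqsum (coef
    (fun z => u z * psum (conj_rev (coef f) N) N.+1 z)) N.+1) <= ep / 2.
  apply: (@le_trans _ _ (Cw * (M * (ep / 2 / (Cw * M + 1))))).
    apply: ler_wpM2l => //; apply: (@le_trans _ _ (Num.sqrt
      ((M * (ep / 2 / (Cw * M + 1))) ^+ 2))).
      apply: ler_wsqrtr; rewrite (le_trans tail) // exprMn.
      by apply: ler_wpM2l; [exact: sqr_ge0|rewrite lerBlDr addrC].
    by rewrite sqrtr_sqr ger0_norm // mulr_ge0 // divr_ge0 // ltW.
  rewrite mulrA mulrA ler_pdivrMr // mulrC; apply: ler_wpM2l; first exact: ltW.
  by rewrite lerDl.
have -> : derive1 f w = (derive1 f w - derive1 (psum (coef f) N.+1) w) +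
    derive1 (psum (coef f) N.+1) w by rewrite subrK.
rewrite (le_trans (le_normcD _ _)) //.
have := Hw (coef f) N; rewrite (splitr ep); lra.
Qed.

End ModelDerivative.

(** * Area measure under dilations and rotations *)

Section Planar.
Variable R : realType.
Local Open Scope ereal_scope.
Notation leb := (@lebesgue_measure R).
Notation leb2 := (leb \x leb).
Notation TR := (measurableTypeR R).
Implicit Types (G : TR * TR -> \bar R) (F : TR -> \bar R) (a c : R).

Lemma lebesgue_translation c A : measurable A ->
  leb A = pushforward leb (fun x : TR => (x + c)%R : TR) A.
Proof.
move=> mA; apply: lebesgue_measure_unique => //=; first exact: measurable_funD.
move=> _ _ [[a b] _ <-]; rewrite /pushforward /=.
rewrite (_ : _ @^-1` _ = `](a - c)%R, (b - c)%R]%classic); last first.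
  by apply/seteqP; split => x /=; rewrite !in_itv /= ltrBlDr lerBrDr.
rewrite !lebesgue_measure_itv /= !lte_fin ltrD2r; case: ifPn => // _.
by rewrite -!EFinB; congr EFin; ring.
Qed.

Lemma lebesgue_dilation (c : {posnum R}) A : measurable A ->
  leb A = pushforward (mscale (c%:num%:nng)%R leb) (fun x : TR => (c%:num * x)%R : TR) A.
Proof.
move=> mA; apply: lebesgue_measure_unique => //=; first exact: measurable_funM.
move=> _ _ [[a b] _ <-]; rewrite /pushforward /mscale /=.
rewrite (_ : _ @^-1` _ = `](a / c%:num)%R, (b / c%:num)%R]%classic); last first.
  by apply/seteqP; split => x /=;
    rewrite !in_itv /= ltr_pdivrMr // ler_pdivlMr // (mulrC x).
rewrite !lebesgue_measure_itv /= !lte_fin ltr_pM2r ?invr_gt0 //.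
case: ifPn => // _; last by rewrite mule0.
by rewrite -!EFinB -EFinM -mulrBl mulrC divfK.
Qed.

Lemma ge0_integral_translation F c : measurable_fun setT F -> (forall x, 0 <= F x) ->
  \int[leb]_x F (x + c)%R = \int[leb]_x F x.
Proof.
move=> mF F0.
have mphi : measurable_fun setT (fun x : TR => (x + c)%R : TR) by exact: measurable_funD.
rewrite [RHS](eq_measure_integral (pushforward leb (fun x : TR => (x + c)%R : TR))).
  by rewrite ge0_integral_pushforward.
by move=> A mA _; exact: lebesgue_translation.
Qed.

Lemma ge0_integral_dilation F c : (0 < c)%R -> measurable_fun setT F ->
  (forall x, 0 <= F x) ->
  c%:E * \int[leb]_x F (c * x)%R = \int[leb]_x F x.
Proof.
move=> c0 mF F0; pose cp := PosNum c0.
have mphi : measurable_fun setT (fun x : TR => (cp%:num * x)%R : TR).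
  exact: measurable_funM.
rewrite [RHS](eq_measure_integral
  (pushforward (mscale (cp%:num%:nng)%R leb) (fun x : TR => (cp%:num * x)%R : TR))).
  rewrite ge0_integral_pushforward // preimage_setT ge0_integral_mscale //.
    exact: (measurableT_comp mF mphi).
  by move=> x _; exact: F0.
by move=> A mA _; exact: lebesgue_dilation.
Qed.

Lemma measurable_affine2 a c : measurable_fun setT
  (fun p : TR * TR => (a * p.1 + c * p.2)%R : TR).
Proof.
by apply: measurable_funD; apply: measurable_funM.
Qed.

Lemma measurable_linear2 a b c d G : measurable_fun setT G ->
  measurable_fun setT (fun p : TR * TR =>
    G ((a * p.1 + b * p.2)%R, (c * p.1 + d * p.2)%R)).
Proof.
move=> mG; apply: (measurableT_comp mG).
by apply: measurable_fun_pair; exact: measurable_affine2.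
Qed.

Lemma ge0_integral_shear1 G a : measurable_fun setT G -> (forall p, 0 <= G p) ->
  \int[leb2]_p G ((p.1 + a * p.2)%R, p.2) = \int[leb2]_p G p.
Proof.
move=> mG G0.
have mS : measurable_fun setT (fun p : TR * TR => G ((p.1 + a * p.2)%R, p.2)).
  have := measurable_linear2 1 a 0 1 mG.
  by apply: eq_measurable_fun => p _; rewrite !mul1r mul0r add0r.
rewrite (fubini_tonelli2 _ mS) // (fubini_tonelli2 _ mG) //.
apply: eq_integral => y _; rewrite /fubini_G /=.
apply: (ge0_integral_translation (F := fun x => G (x, y))) => //.
exact: measurable_fun_pair1.
Qed.

Lemma ge0_integral_shear2 G a : measurable_fun setT G -> (forall p, 0 <= G p) ->
  \int[leb2]_p G (p.1, (p.2 + a * p.1)%R) = \int[leb2]_p G p.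
Proof.
move=> mG G0.
have mS : measurable_fun setT (fun p : TR * TR => G (p.1, (p.2 + a * p.1)%R)).
  have := measurable_linear2 1 0 a 1 mG.
  by apply: eq_measurable_fun => p _; rewrite !mul1r mul0r addr0 addrC.
rewrite (fubini_tonelli1 _ mS) // (fubini_tonelli1 _ mG) //.
apply: eq_integral => x _; rewrite /fubini_F /=.
apply: (ge0_integral_translation (F := fun y => G (x, y))) => //.
exact: measurable_fun_pair2.
Qed.

(** A rotation is a product of three shears, with parameters -tan(b), sin(2b),
    -tan(b); each shear preserves area by Tonelli's theorem. *)
Lemma ge0_integral_rotation G b : cos b != 0%R -> measurable_fun setT G ->
  (forall p, 0 <= G p) ->
  \int[leb2]_p G ((cos (b *+ 2) * p.1 - sin (b *+ 2) * p.2)%R,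
                  (sin (b *+ 2) * p.1 + cos (b *+ 2) * p.2)%R) = \int[leb2]_p G p.
Proof.
move=> cb mG G0; pose t := tan b; pose s := sin (b *+ 2).
pose G1 (p : TR * TR) := G ((p.1 + - t * p.2)%R, p.2).
pose G2 (p : TR * TR) := G1 (p.1, (p.2 + s * p.1)%R).
have mG1 : measurable_fun setT G1.
  have := measurable_linear2 1 (- t) 0 1 mG.
  by apply: eq_measurable_fun => p _; rewrite /G1 !mul1r mul0r add0r.
have mG2 : measurable_fun setT G2.
  have := measurable_linear2 1 0 s 1 mG1.
  by apply: eq_measurable_fun => p _; rewrite /G2 /= !mul1r mul0r addr0 addrC.
rewrite -(ge0_integral_shear1 (- t) mG G0) -/G1.
rewrite -(ge0_integral_shear2 s mG1 (fun p => G0 _)).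
rewrite -(ge0_integral_shear1 (- t) mG2 (fun p => G0 _)).
apply: eq_integral => p _; rewrite /G2 /G1 /=.
have c2 : cos (b *+ 2) = (1 - sin b ^+ 2 *+ 2)%R.
  by have := cos2Dsin2 b; rewrite cos_mulr2n mulr2n => h; rewrite -h; ring.
have s2 : s = (2 * cos b * sin b)%R by rewrite /s sin_mulr2n; ring.
have tb : (t * cos b = sin b)%R by rewrite /t /tan divfK.
have cs := cos2Dsin2 b.
have st : (s * t = sin b ^+ 2 *+ 2)%R by rewrite s2 -tb; ring.
have tc : (t * cos (b *+ 2) = s - t)%R.
  rewrite c2 -st mulrBr mulr1; apply: (mulIf cb); rewrite mulrBl.
  have -> : (t * (s * t) * cos b = s * t * (t * cos b))%R by ring.
  have cc : (cos b ^+ 2 = 1 - sin b ^+ 2)%R by rewrite -cs; ring.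
  rewrite tb st mulrBl tb s2.
  have -> : (2 * cos b * sin b * cos b = 2 * sin b * cos b ^+ 2)%R by ring.
  by rewrite cc; ring.
congr (G (_, _)); last first.
  by rewrite -/s c2 -st; ring.
have -> : (p.1 + - t * p.2 + - t * (p.2 + s * (p.1 + - t * p.2)) =
  (1 - s * t) * p.1 - (t + t * (1 - s * t)) * p.2)%R by ring.
by rewrite st -c2 tc (addrC t) subrK.
Qed.

Lemma ge0_integral_dilation2 G c : (0 < c)%R -> measurable_fun setT G ->
  (forall p, 0 <= G p) ->
  (c ^+ 2)%:E * \int[leb2]_p G ((c * p.1)%R, (c * p.2)%R) = \int[leb2]_p G p.
Proof.
move=> c0 mG G0.
have mS : measurable_fun setT (fun p : TR * TR => G ((c * p.1)%R, (c * p.2)%R)).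
  have := measurable_linear2 c 0 0 c mG.
  by apply: eq_measurable_fun => p _; rewrite !mul0r addr0 add0r.
rewrite (fubini_tonelli1 _ mS) // (fubini_tonelli1 _ mG) //.
have mF := measurable_fun_fubini_tonelli_F (m2 := leb) _ mG G0.
have F0 x : 0 <= fubini_F leb G x by exact: integral_ge0.
rewrite -(ge0_integral_dilation c0 mF F0) expr2 EFinM -muleA; congr (_ * _).
have mF2 := measurable_fun_fubini_tonelli_F (m2 := leb) _ mS (fun p => G0 _).
rewrite -ge0_integralZl //; last 2 first.
- by move=> x _; exact: integral_ge0.
- by rewrite lee_fin ltW.
apply: eq_integral => x _; rewrite /fubini_F /=.
apply: (ge0_integral_dilation (F := fun y => G ((c * x)%R, y))) => //.
exact: measurable_fun_pair2.
Qed.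

End Planar.

(** * Moments of the disk *)

Section Disk.
Variable R : realType.
Local Open Scope ereal_scope.
Notation leb := (@lebesgue_measure R).
Notation leb2 := (leb \x leb).
Notation TR := (measurableTypeR R).
Notation TP := (TR * TR)%type.
Implicit Types (p : TP) (F G : TP -> \bar R).

Definition cplx (p : R * R) : R[i] := p.1 +i* p.2.

Definition nsq (p : R * R) : R := (p.1 ^+ 2 + p.2 ^+ 2)%R.

Definition disk : set TP := [set p | nsq p < 1]%R.

Lemma normc_cplx p : (normc (cplx p) ^+ 2)%R = nsq p.
Proof. by rewrite normc_sqr. Qed.

Lemma nsq_ge0 p : (0 <= nsq p)%R.
Proof. by rewrite addr_ge0 ?sqr_ge0. Qed.

Lemma unit_disk_cplx p : unit_disk (cplx p) <-> disk p.
Proof.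
rewrite /unit_disk /disk /mkset -normc_cplx -[X in _ <-> (_ < X)%R](expr1n _ 2).
by rewrite ltr_pXn2r ?nnegrE ?normc_ge0.
Qed.

Lemma unit_disk_planeE : [set p : R * R | unit_disk (p.1 +i* p.2)] = disk.
Proof. by apply/seteqP; split => p /unit_disk_cplx. Qed.

Lemma measurable_nsq : measurable_fun [set: TP] (nsq : TP -> TR).
Proof. by apply: measurable_funD; apply: measurable_funX. Qed.

Lemma measurable_nsq_lt (r : R) : measurable [set p : TP | nsq p < r]%R.
Proof.
have := measurable_nsq measurableT (measurable_itv `]-oo, r[).
by rewrite setTI; congr measurable; apply/seteqP; split => p /=; rewrite in_itv.
Qed.

Lemma measurable_disk : measurable disk.
Proof. exact: measurable_nsq_lt. Qed.

Lemma measurable_nsqX n : measurable_fun [set: TP] (fun p => (nsq p ^+ n)%:E).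
Proof. by apply/measurable_EFinP; apply: measurable_funX; exact: measurable_nsq. Qed.

Lemma disk_finite : leb2 disk < +oo.
Proof.
have mI : measurable (`[(-1)%R, 1%R]%classic : set TR) by exact: measurable_itv.
have sub : disk `<=` `[(-1)%R, 1%R]%classic `*` `[(-1)%R, 1%R]%classic.
  move=> [x y]; rewrite /disk /nsq /mkset /= => h.
  have hx := sqr_ge0 x; have hy := sqr_ge0 y.
  by split; rewrite /= in_itv /=; apply/andP; split; nra.
have l : leb `[(-1)%R, 1%R]%classic = (1 - (-1))%:E.
  by apply: (etrans (lebesgue_measure_itv _)); rewrite /= lte_fin gtrN.
have E : leb2 (`[(-1)%R, 1%R]%classic `*` `[(-1)%R, 1%R]%classic) =
    leb `[(-1)%R, 1%R]%classic * leb `[(-1)%R, 1%R]%classic.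
  exact: product_measure1E.
apply: (@le_lt_trans _ _ (leb `[(-1)%R, 1%R]%classic * leb `[(-1)%R, 1%R]%classic)).
  rewrite -E; apply: le_measure => //; rewrite ?inE; first exact: measurable_disk.
  exact: measurableX.
by rewrite l -EFinM ltry.
Qed.

(** The moments of area measure on the disk: comparing the integral over the
    disk of radius l < 1, known by dilation, with the thin remaining annulus
    and letting l tend to 1 gives area / (n + 1). *)
Lemma disk_moment n :
  \int[leb2]_(p in disk) (nsq p ^+ n)%:E = (fine (leb2 disk) / n.+1%:R)%:E.
Proof.
have mD := measurable_disk.
have F0 m p : 0 <= (nsq p ^+ m)%:E by rewrite lee_fin exprn_ge0 // nsq_ge0.
pose J m := \int[leb2]_(p in disk) (nsq p ^+ m)%:E.
have J_fin m : J m \is a fin_num.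
  rewrite ge0_fin_numE; last by apply: integral_ge0 => p _; exact: F0.
  apply: le_lt_trans disk_finite.
  rewrite -[leRHS]mul1e -integral_cst //; apply: ge0_le_integral => //.
  - exact: measurable_funTS (measurable_nsqX m).
  - by move=> p hp; rewrite lee_fin; apply: exprn_ile1; [exact: nsq_ge0|exact: ltW].
have JE m : J m = (fine (J m))%:E by rewrite fineK.
have J0 : fine (J 0%N) = fine (leb2 disk).
  congr fine; rewrite /J; under eq_integral do rewrite expr0.
  by rewrite integral_cst // mul1e.
pose ann (l : R) := [set p : TP | disk p /\ (l ^+ 2 <= nsq p)%R].
have mann l : measurable (ann l).
  have -> : ann l = disk `\` [set p | nsq p < l ^+ 2]%R.
    apply/seteqP; split => p [h1 h2]; split => //.
      by move=> /=; apply/negP; rewrite -leNgt.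
    by move/negP : h2; rewrite -leNgt.
  by apply: measurableD => //; exact: measurable_nsq_lt.
pose W m l := \int[leb2]_(p in ann l) (nsq p ^+ m)%:E.
have split (l : R) m : (0 < l)%R -> (l < 1)%R ->
    J m = (l ^+ (2 * m.+1))%:E * J m + W m l.
  move=> l0 l1; pose Dl := [set p : TP | nsq p < l ^+ 2]%R.
  have mDl : measurable Dl by exact: measurable_nsq_lt.
  have DE : disk = Dl `|` ann l.
    apply/seteqP; split => p.
      by move=> hp; have [h|h] := ltP (nsq p) (l ^+ 2)%R; [left|right].
    move=> [h|[] //]; apply: (lt_trans h); rewrite -(expr1n _ 2).
    by rewrite ltr_pXn2r ?nnegrE // ltW.
  rewrite {1}/J DE ge0_integral_setU //=; last 2 first.
  - exact: measurable_funTS (measurable_nsqX m).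
  - by apply/disj_setPS => p [h [_ h2]]; move: h; rewrite /Dl /= ltNge h2.
  congr (_ + _); rewrite integral_mkcond.
  have mG : measurable_fun setT (((fun p : TP => (nsq p ^+ m)%:E) \_ Dl)).
    by apply/(measurable_restrictT _ mDl); exact: measurable_funTS (measurable_nsqX m).
  have G0 p : 0 <= ((fun p : TP => (nsq p ^+ m)%:E) \_ Dl) p.
    by apply: erestrict_ge0 => q _; exact: F0.
  rewrite -(ge0_integral_dilation2 l0 mG G0).
  have -> : (l ^+ (2 * m.+1))%:E * J m = (l ^+ 2)%:E * ((l ^+ (2 * m))%:E * J m).
    by rewrite muleA -EFinM -exprD mulnS.
  congr (_ * _).
  rewrite -ge0_integralZl //; last 2 first.
  - exact: measurable_funTS (measurable_nsqX m).
  - by rewrite lee_fin exprn_ge0 // ltW.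
  rewrite [RHS]integral_mkcond; apply: eq_integral => p _; rewrite /patch.
  have nl : nsq (l * p.1, l * p.2)%R = (l ^+ 2 * nsq p)%R by rewrite /nsq /=; ring.
  have l2 : (0 < l ^+ 2)%R by rewrite exprn_gt0.
  have -> : ((l * p.1)%R, (l * p.2)%R) \in Dl = (p \in disk).
    apply/idP/idP; rewrite !inE /Dl /disk /mkset nl => h.
      by rewrite -(ltr_pM2l l2) mulr1.
    by rewrite -[ltRHS]mulr1 ltr_pM2l.
  case: ifPn => // _; rewrite nl exprMn EFinM -exprM; congr (_ * _).
have Wle l m : W m l <= W 0%N l.
  apply: ge0_le_integral => //.
  - exact: measurable_funTS (measurable_nsqX m).
  - exact: measurable_funTS (measurable_nsqX 0).
  - move=> p [hp _]; rewrite lee_fin expr0; apply: exprn_ile1; first exact: nsq_ge0.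
    exact: ltW.
have Wge (l : R) m : (0 < l)%R -> (l ^+ (2 * m))%:E * W 0%N l <= W m l.
  move=> l0; rewrite /W -ge0_integralZl //; last 2 first.
  - exact: measurable_funTS (measurable_nsqX 0).
  - by rewrite lee_fin exprn_ge0 // ltW.
  apply: ge0_le_integral => //.
  - by move=> p _; rewrite mule_ge0 // lee_fin exprn_ge0 // ltW.
  - by apply: measurable_funTS; apply: measurable_funeM; exact: measurable_nsqX.
  - exact: measurable_funTS (measurable_nsqX m).
  - move=> p [_ hp]; rewrite -EFinM lee_fin expr0 mulr1 exprM.
    by apply: lerXn2r => //; rewrite nnegrE ?nsq_ge0 // exprn_ge0 // ltW.
have W_fin l m : W m l \is a fin_num.
  rewrite ge0_fin_numE; last by apply: integral_ge0 => p _; exact: F0.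
  apply: le_lt_trans (Wle l m) _; rewrite -ge0_fin_numE; last first.
    by apply: integral_ge0 => p _; exact: F0.
  have := J_fin 0%N; rewrite !ge0_fin_numE //; try by apply: integral_ge0 => p _; exact: F0.
  apply: le_lt_trans; apply: ge0_subset_integral => //.
  - exact: measurable_funTS (measurable_nsqX 0).
  - by move=> p [].
(* Dilation relates each moment to its part on the annulus, and
   S l = (1 - l^(2n+2)) / (1 - l^2). *)
pose j := fine (J n); pose A := fine (J 0%N).
pose S (l : R) : R := (\sum_(k < n.+1) (l ^+ 2) ^+ k)%R.
have key (l : R) : (0 < l)%R -> (l < 1)%R -> (S l * j <= A)%R /\ (l ^+ (2 * n) * A <= S l * j)%R.
  move=> l0 l1; have l2 : (0 < 1 - l ^+ 2)%R.
    by rewrite subr_gt0 expr_lt1 // ltW.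
  pose v m := fine (W m l).
  have WE m : W m l = (v m)%:E by rewrite /v fineK.
  have e1 : (j = l ^+ (2 * n.+1) * j + v n)%R.
    by apply: EFin_inj; have := split l n l0 l1; rewrite JE WE -EFinM -EFinD.
  have e0 : (A = l ^+ 2 * A + v 0%N)%R.
    by apply: EFin_inj; have := split l 0%N l0 l1; rewrite JE WE -EFinM -EFinD.
  have h1 : (v n <= v 0%N)%R by rewrite -lee_fin -!WE.
  have h2 : (l ^+ (2 * n) * v 0%N <= v n)%R by rewrite -lee_fin EFinM -!WE; exact: Wge.
  have gs : ((1 - l ^+ 2) * S l = 1 - l ^+ (2 * n.+1))%R.
    by rewrite exprM -opprB mulNr -subrX1 opprB.
  have vn : (v n = (1 - l ^+ 2) * (S l * j))%R by rewrite mulrA gs mulrBl mul1r [X in (X - _)%R]e1 addrAC subrr add0r.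
  have v0 : (v 0%N = (1 - l ^+ 2) * A)%R by rewrite mulrBl mul1r [X in (X - _)%R]e0 addrAC subrr add0r.
  split; first by move: h1; rewrite vn v0 (ler_pM2l l2).
  by move: h2; rewrite vn v0 mulrCA (ler_pM2l l2).
have cS : {for 1%R, continuous (fun l : R => S l * j)%R}.
  have : cont_on 1%R 1%R (fun l : R => S l * j)%R.
    apply: cont_onM; last exact: cont_on_cst.
    apply: cont_on_sum => k; apply: cont_onX; apply: cont_onX.
    by apply/cont_onP => x _; exact: cvg_id.
  by move/cont_onP; apply; rewrite lexx.
have S1 : S 1%R = n.+1%:R.
  rewrite /S; under eq_bigr do rewrite !expr1n.
  by rewrite sumr_const card_ord.
have up : (n.+1%:R * j <= A)%R.
  rewrite -S1; apply: (left1_le cS ltr01) => l l0 l1.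
  by case: (key l l0 l1).
have j0 : (0 <= j)%R.
  by rewrite fine_ge0 //; apply: integral_ge0 => p _; exact: F0.
have lo : (A <= n.+1%:R * j)%R.
  have cA : {for 1%R, continuous (fun l : R => l ^+ (2 * n) * A)%R}.
    have : cont_on 1%R 1%R (fun l : R => l ^+ (2 * n) * A)%R.
      apply: cont_onM; last exact: cont_on_cst.
      by apply: cont_onX; apply/cont_onP => x _; exact: cvg_id.
    by move/cont_onP; apply; rewrite lexx.
  have -> : A = (1 ^+ (2 * n) * A)%R by rewrite expr1n mul1r.
  apply: (left1_le cA ltr01) => l l0 l1.
  have [_ h] := key l l0 l1; rewrite (le_trans h) // ler_wpM2r //.
  rewrite -S1; apply: ler_sum => k _; rewrite !expr1n -exprM.
  by apply: exprn_ile1; exact: ltW.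
rewrite -/(J n) JE -/j -J0 -/A; congr EFin.
have E : (n.+1%:R * j = A)%R by apply/eqP; rewrite eq_le up lo.
by rewrite -E mulrAC divff ?mul1r // pnatr_eq0.
Qed.

Lemma disk_weighted_moment n :
  \int[leb2]_(p in disk) (nsq p ^+ n * (1 - nsq p))%:E =
  (fine (leb2 disk) / (n.+1%:R * n.+2%:R))%:E.
Proof.
have mD := measurable_disk.
have F0 m p : 0 <= (nsq p ^+ m)%:E by rewrite lee_fin exprn_ge0 // nsq_ge0.
have mW : measurable_fun disk (fun p => (nsq p ^+ n * (1 - nsq p))%:E).
  apply: measurable_funTS; apply/measurable_EFinP; apply: measurable_funM.
    by apply: measurable_funX; exact: measurable_nsq.
  by apply: measurable_funB => //; exact: measurable_nsq.
have W0 p : disk p -> 0 <= (nsq p ^+ n * (1 - nsq p))%:E.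
  by move=> hp; rewrite lee_fin mulr_ge0 ?exprn_ge0 ?nsq_ge0 // subr_ge0 ltW.
have E : \int[leb2]_(p in disk) (nsq p ^+ n)%:E =
    \int[leb2]_(p in disk) (nsq p ^+ n * (1 - nsq p))%:E +
    \int[leb2]_(p in disk) (nsq p ^+ n.+1)%:E.
  rewrite -ge0_integralD //.
  - apply: eq_integral => p _; rewrite -EFinD; congr EFin.
    by rewrite exprS; ring.
  - exact: measurable_funTS (measurable_nsqX n.+1).
move: E; rewrite !disk_moment; set X := \int[_]_(p in _) _ => E.
have -> : X = (fine (leb2 disk) / n.+1%:R)%:E - (fine (leb2 disk) / n.+2%:R)%:E.
  by rewrite E addeK.
rewrite -EFinB; congr EFin.
have n1 : (n.+1%:R != 0 :> R)%R by rewrite pnatr_eq0.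
have n2 : (n.+2%:R = n.+1%:R + 1 :> R)%R by rewrite -natr1.
have n3 : (n.+1%:R + 1 != 0 :> R)%R by rewrite -n2 pnatr_eq0.
have alg (a b : R) : (b != 0)%R -> (b + 1 != 0)%R -> (a / b - a / (b + 1) = a / (b * (b + 1)))%R.
  by move=> b0 b1; field; rewrite b0 b1.
by rewrite n2 alg.
Qed.

End Disk.

(** * Averages over rotations *)

Section Rotation.
Variable R : realType.
Local Open Scope ereal_scope.
Notation leb := (@lebesgue_measure R).
Notation leb2 := (leb \x leb).
Notation TR := (measurableTypeR R).
Notation TP := (TR * TR)%type.
Implicit Types (p : TP) (F : R[i] -> \bar R) (w z : R[i]).

Lemma expi_surj w : normc w = 1%R -> exists t : R, [/\ (0 <= t)%R, (t <= 2 * pi)%R & w = expi t].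
Proof.
move=> w1; have := normc_sqr w; rewrite w1 expr1n => e.
have hx : (-1 <= complex.Re w <= 1)%R.
  by have h := sqr_ge0 (complex.Im w); apply/andP; split; nra.
have a0 := acos_ge0 hx; have a1 := acos_lepi hx.
have c : cos (acos (complex.Re w)) = complex.Re w by rewrite acosK // in_itv.
have s : sin (acos (complex.Re w)) = `|complex.Im w|%R.
  rewrite sin_acos // -sqrtr_sqr; congr Num.sqrt; rewrite e; ring.
have pi0 := pi_ge0 R.
have [y0|y0] := leP 0%R (complex.Im w).
  exists (acos (complex.Re w)); split => //; first by lra.
  by rewrite /expi c s ger0_norm //; case: (w).
exists (- acos (complex.Re w) + 2 * pi)%R; split; [by lra|by lra|].
rewrite expiD2pi -conj_expi /expi c s ltr0_norm //=.
by rewrite opprK; case: (w).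
Qed.

(** Any rotation is the composite of three rotations of angle at most 2 pi / 3,
    for which the factorization into shears is available. *)
Lemma ge0_integral_unimodular F w : normc w = 1%R ->
  measurable_fun setT (fun p : TP => F (cplx p)) -> (forall z, 0 <= F z) ->
  \int[leb2]_p F (w * cplx p)%R = \int[leb2]_p F (cplx p).
Proof.
move=> w1 mF F0.
have mrot v : measurable_fun setT (fun p : TP => F (v * cplx p)%R).
  case: v => a b.
  have := measurable_linear2 a (- b) b a mF.
  apply: eq_measurable_fun => p _; congr F; rewrite /cplx /=.
  by congr (_ +i* _)%C; ring.
have [t [t0 t2 ->]] := expi_surj w1.
have pi0 := pi_gt0 R.
pose b := (t / 6)%R.
have cb : cos b != 0%R by rewrite gt_eqF // cos_gt0_pihalf // /b; apply/andP; split; lra.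
have step v : \int[leb2]_p F (v * expi (b *+ 2) * cplx p)%R = \int[leb2]_p F (v * cplx p)%R.
  rewrite -(ge0_integral_rotation cb (mrot v)) //; apply: eq_integral => p _.
  by rewrite -mulrA; congr (F (_ * _)%R); rewrite /cplx /expi /=; congr (_ +i* _)%C; ring.
have -> : t = ((b *+ 2) + (b *+ 2) + (b *+ 2))%R by rewrite /b !mulr2n; lra.
rewrite (expiD (b *+ 2 + b *+ 2)) (expiD (b *+ 2)) !step -[expi (b *+ 2)]mul1r step.
by apply: eq_integral => p _; rewrite mul1r.
Qed.

Lemma ge0_integral_disk_unimodular F w : normc w = 1%R ->
  measurable_fun (@disk R) (fun p : TP => F (cplx p)) ->
  (forall z, unit_disk z -> 0 <= F z) ->
  \int[leb2]_(p in @disk R) F (w * cplx p)%R = \int[leb2]_(p in @disk R) F (cplx p).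
Proof.
move=> w1 mF F0.
pose G z := if `[< unit_disk z >] then F z else 0.
have GE p : G (cplx p) = ((fun p => F (cplx p)) \_ (@disk R)) p.
  rewrite /G /patch; case: asboolP => [/unit_disk_cplx h|h]; first by rewrite mem_set.
  by rewrite memNset // => /unit_disk_cplx.
have mG : measurable_fun setT (fun p : TP => G (cplx p)).
  apply: (eq_measurable_fun ((fun p => F (cplx p)) \_ (@disk R))).
    by move=> p _; rewrite GE.
  by apply/(measurable_restrictT _ (@measurable_disk R)).
have G0 z : 0 <= G z by rewrite /G; case: asboolP => // /F0.
rewrite [RHS]integral_mkcond; under [RHS]eq_integral do rewrite -GE.
rewrite -(ge0_integral_unimodular w1 mG G0) integral_mkcond.
apply: eq_integral => p _; rewrite /patch /G.
have -> : `[< unit_disk (w * cplx p)%R >] = (p \in @disk R) => //.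
have E : unit_disk (w * cplx p)%R <-> disk p.
  by rewrite -unit_disk_cplx /unit_disk /mkset normcM w1 mul1r.
by apply/asboolP/idP; rewrite inE => /E.
Qed.

End Rotation.

Section DiscreteParseval.
Variable R : realType.
Implicit Types (z w : R[i]) (c : nat -> R[i]).

Lemma expi_neq1 (t : R) : 0 < t -> t < 2 * pi -> expi t <> 1.
Proof.
move=> t0 t1 /(congr1 (@complex.Re R)) /= h.
have : t = (t / 2) *+ 2 by rewrite mulr2n; field.
move=> tE; have := sin_gt0_pi (x := t / 2); rewrite divr_gt0 //= => s.
have s0 : 0 < sin (t / 2) by apply: s; lra.
have h2 := cos2Dsin2 (t / 2).
have s2 : 0 < sin (t / 2) ^+ 2 by rewrite exprn_gt0.
by move: h; rewrite {1}tE cos_mulr2n !mulr2n => h; lra.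
Qed.

Lemma root_of_unity_inj K m n : (m < K)%N -> (n < K)%N ->
  expi (2 * pi / K%:R : R) ^+ m = expi (2 * pi / K%:R) ^+ n -> m = n.
Proof.
have H a b : (a < b)%N -> (b < K)%N ->
    expi (2 * pi / K%:R : R) ^+ a <> expi (2 * pi / K%:R) ^+ b.
  move=> ab bK e.
  have K0 : 0 < K%:R :> R by rewrite ltr0n (leq_ltn_trans _ bK).
  have pi0 := pi_gt0 R.
  apply: (@expi_neq1 ((2 * pi / K%:R) *+ (b - a))).
  - by rewrite pmulrn_lgt0 ?subn_gt0 // divr_gt0 // mulr_gt0.
  - rewrite -mulr_natr mulrAC ltr_pdivrMr // ltr_pM2l ?mulr_gt0 //.
    by rewrite ltr_nat (leq_ltn_trans (leq_subr _ _)).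
  - rewrite expiMn; apply: (mulfI (expf_neq0 a (expi_neq0 (2 * pi / K%:R : R)))).
    by rewrite mulr1 -exprD subnKC ?(ltnW ab).
move=> mK nK e; have [h|h|//] := ltngtP m n; first by case: (H m n h nK).
by case: (H n m h mK).
Qed.

(** Averaging over the K-th roots of unity separates the first K powers. *)
Lemma roots_parseval K c N z : (0 < K)%N -> (N <= K)%N ->
  \sum_(k < K) normc (psum c N (expi (2 * pi / K%:R) ^+ k * z)) ^+ 2 =
  K%:R * \sum_(n < N) normc (c n) ^+ 2 * (normc z ^+ 2) ^+ n.
Proof.
move=> K0 NK; pose o := expi (2 * pi / K%:R : R).
have Kn0 : K%:R != 0 :> R by rewrite pnatr_eq0 -lt0n.
have oK : o ^+ K = 1.
  rewrite /o -expiMn -[RHS](@expi2pi R); congr expi.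
  by rewrite -[LHS]mulr_natr divfK.
have oc : o * conjc o = 1 by rewrite mulJc normc_expi expr1n.
have orth (m n : 'I_N) : \sum_(k < K) (o ^+ k) ^+ m * conjc ((o ^+ k) ^+ n) =
    (if m == n then K%:R else 0).
  have E (k : nat) : (o ^+ k) ^+ m * conjc ((o ^+ k) ^+ n) = (o ^+ m * conjc o ^+ n) ^+ k.
    by rewrite !conjcX exprMn -!exprM (mulnC m) (mulnC n).
  under eq_bigr do rewrite E.
  case: eqVneq => [->|mn].
    rewrite -exprMn oc expr1n; under eq_bigr do rewrite expr1n.
    by rewrite sumr_const card_ord.
  set x := o ^+ m * _.
  have x1 : x != 1.
    apply: contra_neq mn => h; apply/val_inj/(@root_of_unity_inj K).
    - exact: leq_trans (ltn_ord m) NK.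
    - exact: leq_trans (ltn_ord n) NK.
    - rewrite -/o -[RHS]mul1r -h /x -mulrA -exprMn (mulrC (conjc o)) oc.
      by rewrite expr1n mulr1.
  have xK : x ^+ K = 1.
    by rewrite /x exprMn -!exprM mulnC exprM oK expr1n mul1r mulnC exprM -conjcX oK conjc1 expr1n.
  apply: (mulfI (_ : x - 1 != 0)); first by rewrite subr_eq0.
  by rewrite -subrX1 xK subrr mulr0.
apply: (@complexI R); rewrite rmorphM !rmorph_sum /=.
have L (k : 'I_K) : (normc (psum c N (o ^+ k * z)) ^+ 2)%:C =
    \sum_(m < N) \sum_(n < N) c m * conjc (c n) * (z ^+ m * conjc (z ^+ n)) *
      ((o ^+ k) ^+ m * conjc ((o ^+ k) ^+ n)).
  rewrite -mulJc /psum conjc_sum mulr_suml; apply: eq_bigr => m _.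
  rewrite mulr_sumr; apply: eq_bigr => n _.
  by rewrite !exprMn !conjcM; ring.
under eq_bigr do rewrite L.
rewrite exchange_big /= mulr_sumr; apply: eq_bigr => m _.
rewrite exchange_big /= (bigD1 m) //= [X in _ + X]big1 ?addr0.
  rewrite -mulr_sumr orth eqxx !mulJc normcX -rcM mulrC -[in RHS]exprM mulnC exprM.
  by congr (_ * _); rewrite rmorph_nat.
move=> n nm; rewrite -mulr_sumr orth eq_sym (negbTE nm) mulr0 //.
Qed.

End DiscreteParseval.

(** * The area integral of (1 - |z|^2) |f'|^2 *)

Section ComplexMeasurable.
Variable R : realType.
Context {d : measure_display} {T : measurableType d}.
Notation TR := (measurableTypeR R).
Implicit Types (D : set T) (g h : T -> R[i]).

Definition cmeasurable D g :=
  measurable_fun D (fun x => complex.Re (g x) : TR) /\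
  measurable_fun D (fun x => complex.Im (g x) : TR).

Lemma cmeasurable_cst D z : cmeasurable D (fun=> z).
Proof. by split; exact: measurable_cst. Qed.

Lemma cmeasurableD D g h : cmeasurable D g -> cmeasurable D h ->
  cmeasurable D (fun x => g x + h x).
Proof.
move=> [g1 g2] [h1 h2]; split.
  apply: eq_measurable_fun (measurable_funD g1 h1) => x _.
  by rewrite raddfD.
apply: eq_measurable_fun (measurable_funD g2 h2) => x _.
by rewrite raddfD.
Qed.

Lemma cmeasurableM D g h : cmeasurable D g -> cmeasurable D h ->
  cmeasurable D (fun x => g x * h x).
Proof.
move=> [g1 g2] [h1 h2]; split.
  apply: eq_measurable_fun (measurable_funB (measurable_funM g1 h1) (measurable_funM g2 h2)) => x _.
  by move=> /=; case: (g x) => a b; case: (h x).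
apply: eq_measurable_fun (measurable_funD (measurable_funM g1 h2) (measurable_funM g2 h1)) => x _.
by move=> /=; case: (g x) => a b; case: (h x) => u v /=; rewrite (mulrC b).
Qed.

Lemma cmeasurableN D g : cmeasurable D g -> cmeasurable D (fun x => - g x).
Proof.
move=> mg; have -> : (fun x => - g x) = (fun x => -1 * g x).
  by apply/funext => x; rewrite mulN1r.
exact: cmeasurableM (cmeasurable_cst _ _) mg.
Qed.

Lemma cmeasurableX D g n : cmeasurable D g -> cmeasurable D (fun x => g x ^+ n).
Proof.
move=> mg; elim: n => [|n IH]; first exact: cmeasurable_cst.
have -> : (fun x => g x ^+ n.+1) = (fun x => g x * g x ^+ n).
  by apply/funext => x; rewrite exprS.
exact: cmeasurableM.
Qed.

Lemma cmeasurable_sum D n (g : nat -> T -> R[i]) : (forall k, cmeasurable D (g k)) ->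
  cmeasurable D (fun x => \sum_(k < n) g k x).
Proof.
move=> mg; elim: n => [|n IH].
  have -> : (fun x => \sum_(k < 0) g k x) = (fun=> 0).
    by apply/funext => x; rewrite big_ord0.
  exact: cmeasurable_cst.
have -> : (fun x => \sum_(k < n.+1) g k x) = (fun x => \sum_(k < n) g k x + g n x).
  by apply/funext => x; rewrite big_ord_recr.
exact: cmeasurableD.
Qed.

Lemma measurable_normc2 D g : cmeasurable D g ->
  measurable_fun D (fun x => normc (g x) ^+ 2 : TR).
Proof.
move=> [g1 g2].
have := measurable_funD (measurable_funX 2 g1) (measurable_funX 2 g2).
by apply: eq_measurable_fun => x _; rewrite normc_sqr.
Qed.

End ComplexMeasurable.

Section LittlewoodPaley.
Variable R : realType.
Local Open Scope ereal_scope.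
Notation leb := (@lebesgue_measure R).
Notation leb2 := (leb \x leb).
Notation TR := (measurableTypeR R).
Notation TP := (TR * TR)%type.
Notation area := (fine (leb2 (@disk R))).
Implicit Types (p : TP) (c : nat -> R[i]) (w z : R[i]).

Lemma cmeasurable_cplx (D : set TP) : cmeasurable D (fun p => cplx p).
Proof. by split; apply: measurable_funTS; [exact: measurable_fst|exact: measurable_snd]. Qed.

Lemma cmeasurable_psum (D : set TP) c N : cmeasurable D (fun p => psum c N (cplx p)).
Proof.
apply: (@cmeasurable_sum _ _ _ _ N (fun n p => c n * cplx p ^+ n)%R) => n.
by apply: cmeasurableM; [exact: cmeasurable_cst|apply: cmeasurableX; exact: cmeasurable_cplx].
Qed.

Lemma area_ge0 : (0 <= area)%R.
Proof. exact: fine_ge0. Qed.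

(** Averaging the integrand over the rotations by K-th roots of unity, K at
    least N, leaves the moments of the disk. *)
Lemma disk_parseval c N :
  \int[leb2]_(p in @disk R) (normc (psum c N (cplx p)) ^+ 2 * (1 - nsq p))%:E =
  (\sum_(n < N) normc (c n) ^+ 2 * (area / (n.+1%:R * n.+2%:R)))%:E.
Proof.
have mD := @measurable_disk R.
pose F z := (normc (psum c N z) ^+ 2 * (1 - normc z ^+ 2))%:E.
have FE p : (normc (psum c N (cplx p)) ^+ 2 * (1 - nsq p))%:E = F (cplx p).
  by rewrite /F normc_cplx.
have F0 z : unit_disk z -> 0 <= F z.
  rewrite /unit_disk /mkset => z1.
  by rewrite lee_fin mulr_ge0 ?sqr_ge0 // subr_ge0 expr_le1 ?normc_ge0 // ltW.
have mW : measurable_fun (@disk R) (fun p : TP => (1 - nsq p)%R : TR).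
  by apply: measurable_funTS; apply: measurable_funB => //; exact: measurable_nsq.
have mF v : measurable_fun (@disk R) (fun p : TP => F (v * cplx p)%R).
  apply/measurable_EFinP; apply: measurable_funM.
    apply: measurable_normc2; apply: (@cmeasurable_sum _ _ _ _ N (fun n p => c n * (v * cplx p) ^+ n)%R) => n.
    apply: cmeasurableM; first exact: cmeasurable_cst.
    apply: cmeasurableX; apply: cmeasurableM; first exact: cmeasurable_cst.
    exact: cmeasurable_cplx.
  apply: measurable_funB => //.
  apply: measurable_normc2; apply: cmeasurableM; first exact: cmeasurable_cst.
  exact: cmeasurable_cplx.
have mF1 : measurable_fun (@disk R) (fun p : TP => F (cplx p)).
  by have := mF 1%R; apply: eq_measurable_fun => p _; rewrite mul1r.
under eq_integral do rewrite FE.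
pose K := N.+1; pose o := expi (2 * pi / K%:R : R).
have o1 k : normc (o ^+ k)%R = 1%R by rewrite normcX normc_expi expr1n.
have W0 n p : disk p -> 0 <= (nsq p ^+ n * (1 - nsq p))%:E.
  by move=> hp; rewrite lee_fin mulr_ge0 ?exprn_ge0 ?nsq_ge0 // subr_ge0 ltW.
have mM n : measurable_fun (@disk R) (fun p : TP => (nsq p ^+ n * (1 - nsq p))%:E).
  apply/measurable_EFinP; apply: measurable_funM => //.
  by apply: measurable_funTS; apply: measurable_funX; exact: measurable_nsq.
have avg : \sum_(k < K) \int[leb2]_(p in @disk R) F (o ^+ k * cplx p)%R =
    \sum_(k < K) \int[leb2]_(p in @disk R) F (cplx p).
  by apply: eq_bigr => k _; apply: ge0_integral_disk_unimodular.
have rhs : \sum_(k < K) \int[leb2]_(p in @disk R) F (o ^+ k * cplx p)%R =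
    (K%:R * \sum_(n < N) normc (c n) ^+ 2 * (area / (n.+1%:R * n.+2%:R)))%:E.
  rewrite -ge0_integral_sum //; last first.
    move=> k p /unit_disk_cplx hp; apply: F0.
    by move: hp; rewrite /unit_disk /mkset normcM o1 mul1r.
  transitivity (\int[leb2]_(p in @disk R) \sum_(n < N)
      ((K%:R * normc (c n) ^+ 2)%:E * (nsq p ^+ n * (1 - nsq p))%:E)).
    apply: eq_integral => p _; rewrite sumEFin.
    under [RHS]eq_bigr do rewrite -EFinM.
    rewrite sumEFin; congr EFin.
    under eq_bigr do rewrite normcM o1 mul1r.
    rewrite -mulr_suml roots_parseval // normc_cplx -mulrA mulr_suml mulr_sumr.
    by apply: eq_bigr => n _; ring.
  rewrite ge0_integral_sum //; last first.
    move=> n p hp; rewrite mule_ge0 ?W0 // lee_fin.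
    by rewrite mulr_ge0 ?sqr_ge0.
    by move=> n; apply: measurable_funeM.
  rewrite mulr_sumr -sumEFin; apply: eq_bigr => n _.
  rewrite ge0_integralZl //; last first.
    by rewrite lee_fin mulr_ge0 ?sqr_ge0.
    by move=> p hp; exact: W0.
  by rewrite disk_weighted_moment -EFinM mulrA.
move: avg; rewrite rhs.
rewrite sumr_const card_ord => e0.
have e : K%:R%:E * \int[leb2]_(p in @disk R) F (cplx p) = (K%:R * \sum_(n < N) normc (c n) ^+ 2 * (area / (n.+1%:R * n.+2%:R)))%:E.
  by rewrite e0; exact: mule_natl.
have K0 : K%:R != 0%R :> R by rewrite pnatr_eq0.
rewrite -[LHS]mul1e -(mulVf K0) EFinM -muleA e -EFinM mulrA mulVf // mul1r //.
Qed.

Lemma derive1_psumS c N w :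
  derive1 (psum c N.+1) w = psum (fun n => c n.+1 * n.+1%:R)%R N w.
Proof.
rewrite derive1_psum /psum big_ord_recl /= mul0r mulr0 add0r.
by apply: eq_bigr => n _; rewrite mulrA.
Qed.

Lemma measurable_derive1_psum (D : set TP) c N :
  measurable_fun D (fun p => normc (derive1 (psum c N) (cplx p)) ^+ 2 : TR)%R.
Proof.
apply: measurable_normc2; case: N => [|N].
  have -> : (fun p => derive1 (psum c 0) (cplx p)) = (fun=> 0%R).
    by apply/funext => p; rewrite derive1_psum big_ord0.
  exact: cmeasurable_cst.
have -> : (fun p => derive1 (psum c N.+1) (cplx p)) =
    (fun p => psum (fun n => c n.+1 * n.+1%:R)%R N (cplx p)).
  by apply/funext => p; rewrite derive1_psumS.
exact: cmeasurable_psum.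
Qed.

(** The coefficient of z^n in the derivative gains a factor n + 1, the weighted
    moment loses (n + 1) (n + 2). *)
Lemma littlewood_paley_psum c N (T : R) : (forall N, sqsum c N <= T)%R ->
  \int[leb2]_(p in @disk R) (normc (derive1 (psum c N) (cplx p)) ^+ 2 * (1 - nsq p))%:E
  <= (area * T)%:E.
Proof.
move=> cT; have T0 : (0 <= T)%R by rewrite (le_trans _ (cT 0%N)) // sqsum_ge0.
case: N => [|N].
  rewrite integral0_eq ?lee_fin ?mulr_ge0 ?area_ge0 // => p _.
  by rewrite derive1_psum big_ord0 normc0 expr0n mul0r.
under eq_integral do rewrite derive1_psumS.
rewrite disk_parseval lee_fin.
apply: (@le_trans _ _ (area * \sum_(n < N) normc (c n.+1) ^+ 2)%R).
  rewrite mulr_sumr; apply: ler_sum => n _.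
  have alg (a x y : R) : (0 <= a -> 0 <= x -> 0 < y ->
      (x * y) ^+ 2 * (a / (y * (y + 1))) <= a * x ^+ 2)%R.
    move=> a0 x0 y0; have -> : ((x * y) ^+ 2 * (a / (y * (y + 1))) =
        (a * x ^+ 2) * (y / (y + 1)))%R.
      by field; rewrite !gt_eqF //; lra.
    rewrite ler_piMr ?mulr_ge0 ?sqr_ge0 // ler_pdivrMr ?mul1r; lra.
  have nE : (n.+1%:R = n%:R + 1 :> R)%R by rewrite natr1.
  have -> : (n.+2%:R = (n%:R + 1) + 1 :> R)%R by rewrite !natr1.
  have cE : normc (n.+1%:R : R[i]) = (n%:R + 1)%R.
    by rewrite -(rmorph_nat (real_complex R)) normc_real ger0_norm ?ler0n.
  rewrite normcM cE nE.
  by apply: alg; rewrite ?area_ge0 ?normc_ge0 // ltr_wpDl.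
rewrite ler_wpM2l ?area_ge0 //; apply: le_trans (cT N.+1).
by rewrite /sqsum big_ord_recl lerDr sqr_ge0.
Qed.

Lemma cvg_sqr (a : nat -> R) (l : R) : a @ \oo --> l ->
  (fun N => a N ^+ 2)%R @ \oo --> (l ^+ 2)%R.
Proof. by move=> al; exact: (cvgM al al). Qed.

(** Fatou's lemma along the Taylor polynomials. *)
Lemma littlewood_paley f (T : R) : holomorphic f -> (forall N, sqsum (coef f) N <= T)%R ->
  measurable_fun (@disk R) (fun p => normc (derive1 f (cplx p)) ^+ 2 : TR)%R /\
  \int[leb2]_(p in @disk R) (normc (derive1 f (cplx p)) ^+ 2 * (1 - nsq p))%:E
  <= (area * T)%:E.
Proof.
move=> hf fT; have mD := @measurable_disk R.
have cv p : disk p -> (fun N => normc (derive1 (psum (coef f) N) (cplx p)) ^+ 2)%R @ \oo -->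
    (normc (derive1 f (cplx p)) ^+ 2)%R.
  move=> /unit_disk_cplx hp.
  have c1 : (fun N => normc (derive1 (psum (coef f) N) (cplx p))) @ \oo -->
      normc (derive1 f (cplx p)).
    apply/cvgrPdist_le => e e0; have [N0 h] := taylor_deriv hf hp e0.
    exists N0 => // N /= hN; apply: le_trans (h N hN).
    rewrite ler_norml lerNl opprB; apply/andP; split.
      by rewrite normcB; exact: le_normcB.
    exact: le_normcB.
  exact: (cvg_sqr c1).
split.
  apply: (measurable_fun_cvg _ cv) => N; exact: measurable_derive1_psum.
pose g N p := (normc (derive1 (psum (coef f) N) (cplx p)) ^+ 2 * (1 - nsq p))%:E.
have mg N : measurable_fun (@disk R) (g N).
  apply/measurable_EFinP; apply: measurable_funM; first exact: measurable_derive1_psum.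
  by apply: measurable_funTS; apply: measurable_funB => //; exact: measurable_nsq.
have g0 N p : disk p -> 0 <= g N p.
  by move=> hp; rewrite lee_fin mulr_ge0 ?sqr_ge0 // subr_ge0 ltW.
have -> : \int[leb2]_(p in @disk R) (normc (derive1 f (cplx p)) ^+ 2 * (1 - nsq p))%:E =
    \int[leb2]_(p in @disk R) limn_einf (g^~ p).
  apply: eq_integral => p; rewrite inE => hp; apply/esym.
  have : g^~ p @ \oo --> (normc (derive1 f (cplx p)) ^+ 2 * (1 - nsq p))%:E.
    apply: cvg_EFin; first by near=> N.
    by apply: cvgM; [exact: cv|exact: cvg_cst].
  by move/cvg_limn_einf_sup => [].
apply: le_trans (fatou _ mD mg g0) _.
rewrite limn_einf_lim; apply: lime_le; first exact: is_cvg_einfs.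
apply: nearW => N; apply: le_trans (littlewood_paley_psum N fT).
by apply: ereal_inf_lbound; exists N => /=.
Unshelve. all: by end_near. Qed.

End LittlewoodPaley.

(** * The Poisson kernel over the disk *)

Section Poisson.
Variable R : realType.
Local Open Scope ereal_scope.
Notation leb := (@lebesgue_measure R).
Notation leb2 := (leb \x leb).
Notation TR := (measurableTypeR R).
Notation TP := (TR * TR)%type.
Implicit Types (p : TP) (w z : R[i]).

Definition poisson_kernel w z : R := ((1 - normc z ^+ 2) / normc (w - z) ^+ 2)%R.

Lemma poisson_kernel_ge0 w z : unit_disk z -> (0 <= poisson_kernel w z)%R.
Proof.
rewrite /unit_disk /mkset => z1.
by rewrite divr_ge0 ?sqr_ge0 // subr_ge0 expr_le1 ?normc_ge0 // ltW.
Qed.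

Lemma measurable_poisson_kernel d (T : measurableType d) (D : set T) (g h : T -> R[i]) :
  cmeasurable D g -> cmeasurable D h ->
  measurable_fun D (fun x => (poisson_kernel (g x) (h x))%:E).
Proof.
move=> mg mh; apply/measurable_EFinP; apply: measurable_funM.
  apply: measurable_funB; first exact: measurable_cst.
  exact: measurable_normc2 mh.
(* Inversion is the power -1 on nonnegative reals, 0 included. *)
have m := measurable_normc2 (cmeasurableD mg (cmeasurableN mh)).
have := measurableT_comp (@measurable_powR R (-1)) m.
apply: eq_measurable_fun => x _.
by rewrite /= powR_inv1 // sqr_ge0.
Qed.

(** On the vertical chord at abscissa x the kernel of the point 1 is dominated
    by the derivative of (1 + x) atan (y / (1 - x)). *)
Lemma poisson_chord (x : R) : (-1 <= x)%R -> (x < 1)%R ->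
  \int[leb]_(y in `[(-1)%R, 1%R]) ((1 - x ^+ 2) / ((1 - x) ^+ 2 + y ^+ 2))%:E
    <= (2 * pi)%:E.
Proof.
move=> x0 x1; have a0 : (0 < 1 - x)%R by rewrite subr_gt0.
have den y : (0 < (1 - x) ^+ 2 + y ^+ 2)%R by rewrite ltr_wpDr ?sqr_ge0 ?exprn_gt0.
pose f (y : R) : R := ((1 - x ^+ 2) / ((1 - x) ^+ 2 + y ^+ 2))%R.
pose F (y : R) : R := ((1 + x) * atan ((1 - x)^-1 * y))%R.
have dF (y : R) : is_derive y 1%R F (f y).
  have d1 : is_derive y 1%R (fun t : R => (1 - x)^-1 * t)%R (1 - x)^-1%R.
    by apply: is_derive_eq; rewrite /GRing.scale /= mulr1.
  have d2 := is_derive1_atan ((1 - x)^-1 * y)%R.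
  have d3 : is_derive y 1%R (fun t : R => atan ((1 - x)^-1 * t))%R
      ((1 + ((1 - x)^-1 * y) ^+ 2)^-1 * (1 - x)^-1)%R.
    exact: (@is_derive1_comp _ atan (fun t : R => (1 - x)^-1 * t)%R y).
  apply: is_derive_eq; rewrite /GRing.scale /=.
  have alg (a b : R) : (0 < a -> 0 < a ^+ 2 + b ^+ 2 -> (2 - a) * ((1 + (a^-1 * b) ^+ 2)^-1 * a^-1) =
      (1 - (1 - a) ^+ 2) / (a ^+ 2 + b ^+ 2))%R.
    by move=> h1 h2; field; rewrite !gt_eqF // mulr1.
  have e1 : (2 - (1 - x) = 1 + x)%R by ring.
  have e2 : (1 - (1 - x) = x)%R by ring.
  by have := alg (1 - x)%R y a0 (den y); rewrite e1 e2 /f => <-.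
have cf : cont_on (-1) 1 f.
  apply: cont_onM; first exact: cont_on_cst.
  apply: cont_onV => [t _|]; first by rewrite gt_eqF.
  apply: cont_onD; first exact: cont_on_cst.
  by apply: cont_onX; apply/cont_onP => t _; exact: cvg_id.
have E := @rInt_FTC R (-1) 1 f F (ltac:(lra)) cf (fun t _ => dF t).
have fin : \int[leb]_(y in `[(-1)%R, 1%R]) (f y)%:E \is a fin_num.
  by apply: integrable_fin_num; [exact: measurable_itv|exact: (cont_on_integrable cf)].
have -> : \int[leb]_(y in `[(-1)%R, 1%R]) (f y)%:E = (rInt (-1) 1 f)%:E.
  by rewrite /rInt /Rintegral fineK.
rewrite lee_fin E /F mulrN mulr1 atanN.
have h := atan_ltpi2 (1 - x)^-1%R.
have h2 : (0 <= atan (1 - x)^-1)%R.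
  by rewrite -(@atan0 R) le_atan // invr_ge0 ltW.
nra.
Qed.

(** Each point of the circle carries a bounded Poisson mass over the disk: by
    rotation invariance it suffices to consider the point 1, where each of the chords of
    [poisson_chord] contributes at most 2 pi. *)
Lemma poisson_kernel_mass w : normc w = 1%R ->
  \int[leb2]_(p in @disk R) (poisson_kernel w (cplx p))%:E <= (4 * pi)%:E.
Proof.
move=> w1; have mD := @measurable_disk R.
have mK v : measurable_fun (@disk R) (fun p : TP => (poisson_kernel v (cplx p))%:E).
  apply: measurable_poisson_kernel; first exact: cmeasurable_cst.
  exact: cmeasurable_cplx.
have K0 v z : unit_disk z -> 0 <= (poisson_kernel v z)%:E.
  by move=> hz; rewrite lee_fin poisson_kernel_ge0.
rewrite -(ge0_integral_disk_unimodular (F := fun z => (poisson_kernel w z)%:E) w1) //; last exact: K0.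
have -> : \int[leb2]_(p in @disk R) (poisson_kernel w (w * cplx p))%:E =
    \int[leb2]_(p in @disk R) (poisson_kernel 1 (cplx p))%:E.
  apply: eq_integral => p _; rewrite /poisson_kernel.
  by rewrite -{2}[w]mulr1 -mulrBr !normcM w1 !mul1r.
rewrite integral_mkcond.
set H := _ \_ _.
have mH : measurable_fun setT H by apply/(measurable_restrictT _ mD); exact: mK.
have H0 p : 0 <= H p.
  by apply: erestrict_ge0 => q /unit_disk_cplx; exact: K0.
rewrite (fubini_tonelli1 _ mH) //.
have pi0 := pi_gt0 R.
have l : leb `[(-1)%R, 1%R]%classic = 2%:E.
  by apply: (etrans (lebesgue_measure_itv _)); rewrite /= lte_fin gtrN // opprK.
have -> : (4 * pi)%:E = (2 * pi)%:E * leb `[(-1)%R, 1%R]%classic.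
  by rewrite l -EFinM; congr EFin; ring.
have mI : measurable (`[(-1)%R, 1%R]%classic : set TR) by exact: measurable_itv.
have Hx (x y : R) : disk (x, y) -> (-1 <= x <= 1)%R /\ (-1 <= y <= 1)%R /\ (x < 1)%R.
  rewrite /disk /nsq /mkset /= => h.
  have hx := sqr_ge0 x; have hy := sqr_ge0 y.
  by split; [apply/andP; split; nra|split; [apply/andP; split; nra|nra]].
rewrite -integral_cst // [leRHS]integral_mkcond.
apply: ge0_le_integral => //.
- by move=> x _; exact: integral_ge0.
- exact: measurable_fun_fubini_tonelli_F.
- by apply/(measurable_restrictT _ mI); exact: measurable_cst.
move=> x _; rewrite /fubini_F /patch.
case: ifPn => [|hx]; last first.
  rewrite integral0_eq // => y _; rewrite /H patchE ifN //.
  apply: contra hx; rewrite !inE => /Hx [h _]; rewrite /= in_itv //.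
rewrite inE /= in_itv => /andP[x0 x1].
have [x1'|x1'] := ltP x 1%R; last first.
  rewrite integral0_eq ?lee_fin ?mulr_ge0 ?(ltW pi0) // => y _.
  rewrite /H patchE ifN //; apply/negP; rewrite inE => /Hx [_ [_]]; rewrite ltNge x1' //.
apply: le_trans (poisson_chord x0 x1'); rewrite [leRHS]integral_mkcond.
have mf : measurable_fun (setT : set TR) (fun y : TR => (((1 - x ^+ 2) / ((1 - x) ^+ 2 + y ^+ 2))%:E)).
  apply/measurable_EFinP; apply: measurable_funM; first exact: measurable_cst.
  have m : measurable_fun (setT : set TR) (fun y : TR => ((1 - x) ^+ 2 + y ^+ 2)%R : TR).
    by apply: measurable_funD => //; exact: measurable_funX.
  have := measurableT_comp (@measurable_powR R (-1)) m.
  apply: eq_measurable_fun => y _.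
  by rewrite /= powR_inv1 // addr_ge0 ?sqr_ge0.
apply: ge0_le_integral => //.
- exact: measurable_fun_pair2.
- by apply/(measurable_restrictT _ mI); exact: measurable_funTS mf.
move=> y _; rewrite /H /patch; case: ifPn => [|_]; last first.
  case: ifPn => // _; rewrite lee_fin; apply: divr_ge0; last by rewrite addr_ge0 ?sqr_ge0.
  have -> : (1 - x ^+ 2 = (1 - x) * (1 + x))%R by ring.
  by apply: mulr_ge0; [rewrite subr_ge0|rewrite -lerBlDl sub0r].
rewrite inE => hp; have [_ [hy _]] := Hx _ _ hp; rewrite mem_set; last by rewrite /= in_itv.
rewrite lee_fin /poisson_kernel normc_cplx normc_sqr /nsq /=.
rewrite sub0r sqrrN ler_wpM2r ?invr_ge0 ?addr_ge0 ?sqr_ge0 //.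
by have := sqr_ge0 y; lra.
Qed.

End Poisson.

(** * Poisson integrals of a measure on the circle *)

Section PlanarMeasure.
Variable R : realType.
Local Open Scope ereal_scope.
Notation leb := (@lebesgue_measure R).
Notation leb2 := (leb \x leb).
Notation TR := (measurableTypeR R).
Notation TP := (TR * TR)%type.

(** Area measure as a sigma-finite measure, as Tonelli's theorem for the
    product of the area with a measure on the circle requires. *)
Definition planar : set TP -> \bar R := leb2.

HB.instance Definition _ := Measure.copy planar leb2.

Lemma planar_sigma_finite : sigma_finite setT planar.
Proof.
pose I (n : nat) : set TR := `[(- n%:R)%R, n%:R]%classic.
have mI n : measurable (I n) by exact: measurable_itv.
exists (fun n => I n `*` I n).
  apply/seteqP; split => // -[x y] _.
  exists (Num.bound (`|x| + `|y|)%R) => //.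
  have h : (`|x| + `|y| < (Num.bound (`|x| + `|y|))%:R)%R.
    by apply: archi_boundP; rewrite addr_ge0.
  by split; rewrite /I /= in_itv /= -ler_norml; apply: le_trans (ltW h);
    rewrite ?lerDl ?lerDr.
move=> n; split; first exact: measurableX.
have E : leb2 (I n `*` I n) = leb (I n) * leb (I n) by exact: product_measure1E.
have l : leb (I n) < +oo.
  have -> : leb (I n) = (if (- n%:R < n%:R :> R)%R then (n%:R - - n%:R)%:E else 0).
    by apply: (etrans (lebesgue_measure_itv _)); rewrite /= lte_fin.
  by case: ifP => _; rewrite ltry.
by rewrite /planar E lte_mul_pinfty // ge0_fin_numE.
Qed.

HB.instance Definition _ := Measure_isSigmaFinite.Build _ _ _ planar planar_sigma_finite.

End PlanarMeasure.

Section CircleMeasure.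
Variable R : realType.
Variable mu : {finite_measure set (borelC R) -> \bar R}.
Local Open Scope ereal_scope.
Notation leb := (@lebesgue_measure R).
Notation leb2 := (leb \x leb).
Notation TR := (measurableTypeR R).
Notation TP := (TR * TR)%type.
Notation TC := (borelC R).
Implicit Types (p : TP) (w z l : R[i]) (E : set R[i]).

Lemma measurable_openC E : open E -> measurable (E : set TC).
Proof. by move=> oE; exact: sub_sigma_algebra. Qed.

Lemma measurable_continuousC (g : R[i] -> R) : continuous g ->
  measurable_fun (setT : set TC) (g : TC -> TR).
Proof.
move=> cg; apply: (measurability _ (RGenOpens.measurableE R)).
move=> /= _ [_ [a [b ->]] <-]; rewrite setTI; apply: measurable_openC.
by apply: open_comp; [move=> z _; exact: cg|exact: interval_open].
Qed.

Lemma cmeasurable_idC : cmeasurable (setT : set TC) (fun w => w : R[i]).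
Proof.
by split; apply: measurable_continuousC; [exact: Re_continuous|exact: Im_continuous].
Qed.

Definition ballC l (r : R) : set R[i] := [set w | normc (w - l) < r]%R.

Lemma open_ballC l r : open (ballC l r).
Proof.
rewrite openE => w hw; apply/nbhs_normcP.
exists (r - normc (w - l))%R; first by rewrite subr_gt0.
move=> v hv; rewrite /ballC /mkset.
have -> : (v - l = (v - w) + (w - l))%R by rewrite addrA subrK.
by rewrite (le_lt_trans (le_normcD _ _)) // -ltrBrDr.
Qed.

Lemma measurable_ballC l r : measurable (ballC l r : set TC).
Proof. by apply: measurable_openC; exact: open_ballC. Qed.

Lemma measurable_unit_circle : measurable (unit_circle : set TC).
Proof.
have m := measurable_continuousC (@normc_continuous R).
have := m measurableT [set 1%R] (measurable_set1 _).
by rewrite setTI; congr measurable; apply/seteqP; split.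
Qed.

Lemma measurable_poissonC (D : set TC) z :
  measurable_fun D (fun w : TC => (poisson_kernel w z)%:E).
Proof.
apply: measurable_funTS; apply: measurable_poisson_kernel; first exact: cmeasurable_idC.
exact: cmeasurable_cst.
Qed.

Definition poisson_on E z : \bar R :=
  \int[mu]_(w in E `&` unit_circle) (poisson_kernel w z)%:E.

Lemma poisson_onE z : poisson mu z = poisson_on setT z.
Proof. by rewrite /poisson_on setTI. Qed.

Lemma poisson_on_ge0 E z : unit_disk z -> 0 <= poisson_on E z.
Proof.
by move=> hz; apply: integral_ge0 => w _; rewrite lee_fin poisson_kernel_ge0.
Qed.

Lemma poisson_on_mono E E' z : measurable (E : set TC) -> measurable (E' : set TC) ->
  unit_disk z -> E `<=` E' -> poisson_on E z <= poisson_on E' z.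
Proof.
move=> mE mE' hz EE; have mC := measurable_unit_circle.
apply: ge0_subset_integral; [exact: measurableI|exact: measurableI|..].
- exact: measurable_poissonC.
- by move=> w _; rewrite lee_fin poisson_kernel_ge0.
- exact: setSI.
Qed.

Lemma poisson_onU E E' z : measurable (E : set TC) -> measurable (E' : set TC) ->
  unit_disk z -> poisson_on (E `|` E') z <= poisson_on E z + poisson_on E' z.
Proof.
move=> mE mE' hz; have mC := measurable_unit_circle.
have -> : E `|` E' = E `|` (E' `\` E).
  by rewrite setUDr setUC setDv setD0 setUC.
apply: (@le_trans _ _ (poisson_on E z + poisson_on (E' `\` E) z)); last first.
  apply: leeD => //; apply: poisson_on_mono => //; exact: measurableD.
rewrite /poisson_on setIUl ge0_integral_setU //.
- exact: measurableI.
- by apply: measurableI => //; exact: measurableD.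
- exact: measurable_poissonC.
- by move=> w _; rewrite lee_fin poisson_kernel_ge0.
- by apply/disj_setPS => w [[h _] [[_ h2] _]].
Qed.

Lemma poisson_on_null E z : measurable (E : set TC) -> mu E = 0 -> poisson_on E z = 0.
Proof.
move=> mE E0; have mC := measurable_unit_circle.
apply: null_set_integral; first exact: measurableI.
  exact: measurable_poissonC.
apply/eqP; rewrite eq_le measure_ge0 andbT -E0.
by apply: le_measure; rewrite ?inE //; exact: measurableI.
Qed.

Notation mass := (fine (mu setT)).

Lemma massE : mu setT = mass%:E.
Proof. by rewrite fineK // fin_num_measure. Qed.

Lemma mass_ge0 : (0 <= mass)%R.
Proof. exact: fine_ge0. Qed.

Lemma poisson_on_le E z (b : R) : measurable (E : set TC) -> unit_disk z -> (0 <= b)%R ->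
  (forall w, E w -> normc w = 1%R -> poisson_kernel w z <= b)%R ->
  poisson_on E z <= (b * mass)%:E.
Proof.
move=> mE hz b0 h; have mC := measurable_unit_circle.
apply: (@le_trans _ _ (\int[mu]_(w in E `&` unit_circle) b%:E)).
  apply: ge0_le_integral; first exact: measurableI.
  - by move=> w _; rewrite lee_fin poisson_kernel_ge0.
  - exact: measurable_poissonC.
  - exact: measurable_cst.
  - by move=> w [hE hw]; rewrite lee_fin h.
rewrite integral_cst; last exact: measurableI.
rewrite EFinM -massE; apply: lee_wpmul2l; first by rewrite lee_fin.
by apply: le_measure; rewrite ?inE //; exact: measurableI.
Qed.

(** Tonelli's theorem: the Poisson integral of mu is measurable over the disk,
    with total mass at most 4 pi mu(C). *)
Lemma poisson_mass :
  measurable_fun (@disk R) (fun p : TP => poisson mu (cplx p)) /\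
  \int[leb2]_(p in @disk R) poisson mu (cplx p) <= (4 * pi * mass)%:E.
Proof.
have mC := measurable_unit_circle; have mD := @measurable_disk R.
pose D : set (TP * TC) := @disk R `*` unit_circle.
have mDD : measurable D by exact: measurableX.
pose H := (fun q : TP * TC => (poisson_kernel q.2 (cplx q.1))%:E) \_ D.
have mH : measurable_fun setT H.
  apply/(measurable_restrictT _ mDD); apply: measurable_funTS.
  apply: measurable_poisson_kernel.
    by have [m1 m2] := cmeasurable_idC; split; exact: measurableT_comp measurable_snd.
  have [m1 m2] := @cmeasurable_cplx R setT.
  by split; exact: measurableT_comp measurable_fst.
have H0 q : 0 <= H q.
  by apply: erestrict_ge0 => -[p w] [/unit_disk_cplx hp _]; rewrite lee_fin poisson_kernel_ge0.
have FE p : disk p -> fubini_F mu H p = poisson mu (cplx p).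
  move=> hp; rewrite /fubini_F /poisson [RHS]integral_mkcond.
  apply: eq_integral => w _; rewrite /H /patch.
  have -> // : ((p, w) \in D) = (w \in (unit_circle : set R[i])).
  by apply/idP/idP; rewrite !inE; [case|split].
have mF := measurable_fun_fubini_tonelli_F (m2 := mu) _ mH H0.
split.
  apply: (eq_measurable_fun (fubini_F mu H)); last exact: measurable_funTS mF.
  by move=> p; rewrite inE => hp; rewrite FE.
have -> : \int[leb2]_(p in @disk R) poisson mu (cplx p) =
    \int[leb2]_p fubini_F mu H p.
  rewrite integral_mkcond; apply: eq_integral => p _; rewrite /patch.
  case: ifPn => [|hp]; first by rewrite inE => hp; rewrite FE.
  rewrite /fubini_F integral0_eq // => w _; rewrite /H patchE ifN //.
  by apply: contra hp; rewrite !inE => -[].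
have -> : \int[leb2]_p fubini_F mu H p = \int[mu]_w fubini_G (@planar R) H w.
  rewrite -(fubini_tonelli2 (m1 := @planar R) (m2 := mu) H mH H0).
  by rewrite (fubini_tonelli1 (m1 := @planar R) (m2 := mu) H mH H0).
apply: (@le_trans _ _ (\int[mu]_(w in setT) (4 * pi)%:E)); last first.
  by rewrite integral_cst // [X in _ * X <= _]massE -EFinM.
have pi0 := pi_ge0 R.
apply: ge0_le_integral => //.
- by move=> w _; exact: integral_ge0.
- exact: measurable_fun_fubini_tonelli_G.
move=> w _; rewrite /fubini_G.
have [w1|w1] := eqVneq (normc w) 1%R.
  apply: le_trans (poisson_kernel_mass w1).
  rewrite [leRHS]integral_mkcond le_eqVlt; apply/orP; left; apply/eqP.
  apply: eq_integral => p _; rewrite /H /patch.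
  have -> // : ((p, w) \in D) = (p \in @disk R).
  by apply/idP/idP; rewrite !inE; [case|split].
rewrite integral0_eq ?lee_fin ?mulr_ge0 // => p _; rewrite /H patchE ifN //.
by apply/negP; rewrite inE => -[_] /= h; rewrite h eqxx in w1.
Qed.

End CircleMeasure.

(** * The embedding *)

Section Embedding.
Variable R : realType.
Variable mu : {finite_measure set (borelC R) -> \bar R}.
Variable u : R[i] -> R[i].
Local Open Scope ereal_scope.
Notation leb := (@lebesgue_measure R).
Notation leb2 := (leb \x leb).
Notation TR := (measurableTypeR R).
Notation TP := (TR * TR)%type.
Notation TC := (borelC R).
Notation mass := (fine (mu setT)).
Implicit Types (p : TP) (w z l : R[i]) (E : set R[i]).

(** A bound for the part of the Dirichlet integral that is carried by the points
    of E: over the disk the first term on the right has a finite integral by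
    [poisson_mass], the second one by [littlewood_paley].  Stated pointwise in z
    so that it passes to finite unions. *)
Definition absorbed E := exists C K : R, [/\ (0 <= C)%R, (0 <= K)%R &
  forall f (T : R) z, model_space u f -> hardy_normsq f = T%:E -> unit_disk z ->
    (normc (derive1 f z) ^+ 2)%:E * poisson_on mu E z <=
    (C * T)%:E * poisson mu z + (K * (normc (derive1 f z) ^+ 2 * (1 - normc z ^+ 2)))%:E].

Lemma hardy_normsq_ge0 f (T : R) : hardy_space f -> hardy_normsq f = T%:E -> (0 <= T)%R.
Proof.
move=> /hardy_parseval [T' [-> h _ _]] [<-].
by rewrite (le_trans _ (h 0%N)) // sqsum_ge0.
Qed.

Lemma one_sub_normc2_ge0 z : unit_disk z -> (0 <= 1 - normc z ^+ 2)%R.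
Proof.
by rewrite /unit_disk /mkset => z1; rewrite subr_ge0 expr_le1 ?normc_ge0 // ltW.
Qed.

Lemma absorbedU E E' : measurable (E : set TC) -> measurable (E' : set TC) ->
  absorbed E -> absorbed E' -> absorbed (E `|` E').
Proof.
move=> mE mE' [C [K [C0 K0 h]]] [C' [K' [C0' K0' h']]].
exists (C + C')%R, (K + K')%R; split; [exact: addr_ge0|exact: addr_ge0|].
move=> f T z hf fT hz.
have T0 : (0 <= T)%R by case: hf => hf _; exact: hardy_normsq_ge0 fT.
have d0 : 0 <= (normc (derive1 f z) ^+ 2)%:E by rewrite lee_fin sqr_ge0.
apply: (le_trans (lee_wpmul2l d0 (poisson_onU mu mE mE' hz))).
rewrite ge0_muleDr; [|exact: poisson_on_ge0..].
apply: (le_trans (leeD (h f T z hf fT hz) (h' f T z hf fT hz))).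
rewrite !mulrDl !EFinD ge0_muleDl ?lee_fin ?mulr_ge0 //.
by rewrite addeACA.
Qed.

Lemma absorbed_null E : measurable (E : set TC) -> mu E = 0 -> absorbed E.
Proof.
move=> mE E0; exists 0%R, 0%R; split => // f T z hf fT hz.
by rewrite poisson_on_null // mule0 !mul0r mul0e adde0.
Qed.

(** Near a point off the spectrum: f' is bounded on a neighbourhood of it, and
    for z outside a larger neighbourhood the kernel is at most a multiple of
    1 - |z|^2. *)
Lemma absorbed_near (t : R) : inner u -> ~ boundary_spectrum u (expi t) ->
  exists2 r : R, (0 < r)%R & absorbed (ballC (expi t) r).
Proof.
move=> hu nsp; have [C C0 [dl dl0 h]] := model_derivative_bound hu nsp.
have r0 : (0 < dl / 2)%R by rewrite divr_gt0.
exists (dl / 2)%R => //.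
have b0 : (0 < ((dl / 2) ^+ 2)^-1)%R by rewrite invr_gt0 exprn_gt0.
exists C, (((dl / 2) ^+ 2)^-1 * mass)%R; split => //.
  by rewrite mulr_ge0 ?mass_ge0 // ltW.
move=> f T z hf fT hz.
have T0 : (0 <= T)%R by case: hf => hf _; exact: hardy_normsq_ge0 fT.
have d0 : 0 <= (normc (derive1 f z) ^+ 2)%:E by rewrite lee_fin sqr_ge0.
have z0 := one_sub_normc2_ge0 hz.
have P0 : 0 <= poisson mu z by rewrite poisson_onE poisson_on_ge0.
have mB := measurable_ballC (expi t) (dl / 2).
have [near|far] := leP (normc (z - expi t)%R) dl.
  have le1 : (normc (derive1 f z) ^+ 2 <= C * T)%R by exact: h.
  apply: (@le_trans _ _ ((C * T)%:E * poisson mu z)).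
    apply: lee_pmul => //; first exact: poisson_on_ge0.
    by rewrite poisson_onE; apply: poisson_on_mono => //; exact: measurableT.
  rewrite leeDl // lee_fin; apply: mulr_ge0; first by rewrite mulr_ge0 ?mass_ge0 // ltW.
  by rewrite mulr_ge0 ?sqr_ge0.
apply: (@le_trans _ _ ((normc (derive1 f z) ^+ 2)%:E *
    (((1 - normc z ^+ 2) / (dl / 2) ^+ 2) * mass)%:E)).
  apply: lee_wpmul2l => //; apply: poisson_on_le => //.
    by rewrite mulr_ge0 // ltW.
  move=> w; rewrite /ballC /mkset => hw _; rewrite /poisson_kernel.
  rewrite ler_wpM2l // lef_pV2 ?posrE ?exprn_gt0 //; last first.
    rewrite normc_gt0 subr_eq0; apply: contraTneq far => <-.
    by rewrite -leNgt (le_trans (ltW hw)) // ler_pdivrMr // ler_peMr ?ler1n // ltW.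
  rewrite ler_pXn2r ?nnegrE ?normc_ge0 ?(ltW r0) //.
  have : (normc (z - expi t) <= normc (z - w) + normc (w - expi t))%R.
    by rewrite (le_trans _ (le_normcD _ _)) // addrA subrK.
  by rewrite (normcB w z) => tri; lra.
apply: (@le_trans _ _ (((dl / 2) ^+ 2)^-1 * mass *
    (normc (derive1 f z) ^+ 2 * (1 - normc z ^+ 2)))%:E); last first.
  by rewrite leeDr // mule_ge0 // lee_fin mulr_ge0.
by rewrite -EFinM lee_fin le_eqVlt; apply/orP; left; apply/eqP; ring.
Qed.

(** Compactness of the circle: each point has a mu-null neighbourhood or lies off
    the spectrum of u. *)
Lemma absorbed_circle : inner u -> measure_support mu `&` boundary_spectrum u = set0 ->
  absorbed setT.
Proof.
move=> hu disj.
have loc (t : R) : exists r : R, (0 < r)%R /\ absorbed (ballC (expi t) r).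
  have [hs|ns] := pselect (measure_support mu (expi t)).
    have nsp : ~ boundary_spectrum u (expi t).
      move=> hb; have : (measure_support mu `&` boundary_spectrum u) (expi t) by split.
      by rewrite disj.
    by have [r r0 hr] := absorbed_near hu nsp; exists r.
  have [U [oU Ut nU]] : exists U : set R[i], [/\ open U, U (expi t) & ~ (0 < mu U)].
    apply: contrapT => nex; apply: ns => U oU Ut; apply: contrapT => h; apply: nex.
    by exists U.
  have muU : mu U = 0.
    apply/eqP; rewrite eq_le measure_ge0 andbT leNgt; exact/negP.
  have [r r0 hr] : exists2 r : R, (0 < r)%R & ballC (expi t) r `<=` U.
    by move: oU; rewrite openE => /(_ _ Ut) /nbhs_normcP.
  exists r; split => //; apply: absorbed_null; first exact: measurable_ballC.
  apply/eqP; rewrite eq_le measure_ge0 andbT -muU.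
  apply: le_measure => //; rewrite inE; [exact: measurable_ballC|exact: measurable_openC].
have [r hr] := choice loc.
have cpt := @segment_compact R 0%R (2 * pi)%R.
rewrite compact_cover in cpt.
pose V (t : R) := @expi R @^-1` ballC (expi t) (r t).
have oV t : setT t -> open (V t).
  move=> _; apply: open_comp; last exact: open_ballC.
  by move=> s _; exact: expi_continuous.
have cV : `[0%R, (2 * pi)%R]%classic `<=` cover setT V.
  move=> t _; exists t => //.
  have -> : V t t = (normc (expi t - expi t) < r t)%R by [].
  rewrite subrr normc0.
  by case: (hr t).
have [D' _ cov] := cpt R setT V oV cV.
have fin (s : seq R) : exists2 E, measurable (E : set TC) &
    absorbed E /\ forall t, t \in s -> ballC (expi t) (r t) `<=` E.
  elim: s => [|t s [E mE [aE sE]]].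
    by exists set0 => //; split=> //; apply: absorbed_null; rewrite ?measure0.
  have mB := measurable_ballC (expi t) (r t).
  exists (ballC (expi t) (r t) `|` E); first exact: measurableU.
  split; first by apply: absorbedU => //; case: (hr t).
  move=> t'; rewrite inE => /predU1P[->|/sE h]; first by move=> w; left.
  by move=> w /h; right.
have [E mE [[C [K [C0 K0 h]]] sE]] := fin (finmap.enum_fset D').
exists C, K; split => // f T z hf fT hz.
apply: le_trans (h f T z hf fT hz); apply: lee_wpmul2l; first by rewrite lee_fin sqr_ge0.
rewrite /poisson_on.
have -> // : setT `&` unit_circle = E `&` unit_circle.
apply/seteqP; split => w [hw w1]; split => //.
have [t [t0 t2 wt]] := expi_surj w1.
have : `[0%R, (2 * pi)%R]%classic t by rewrite /= in_itv /= t0 t2.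
by move=> /cov [s hs hV]; rewrite wt; exact: (sE s hs (expi t) hV).
Qed.

Lemma dirichlet_bound : inner u -> measure_support mu `&` boundary_spectrum u = set0 ->
  exists2 C : R, (0 <= C)%R & forall f (T : R), model_space u f -> hardy_normsq f = T%:E ->
    dirichlet_integral mu f <= (C * T)%:E.
Proof.
move=> hu disj; have [C [K [C0 K0 h]]] := absorbed_circle hu disj.
have pi0 := pi_ge0 R; have m0 := mass_ge0 mu; have A0 := area_ge0 R.
set A := fine (leb2 (@disk R)) in A0.
exists (pi^-1 * (C * (4 * pi * mass) + K * A))%R.
  by rewrite mulr_ge0 ?invr_ge0 // addr_ge0 ?mulr_ge0.
move=> f T hf fT; have [Hf _] := hf.
have T0 := hardy_normsq_ge0 Hf fT.
have [mP PI] := poisson_mass mu.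
have [mf fI] : measurable_fun (@disk R) (fun p => normc (derive1 f (cplx p)) ^+ 2 : TR)%R /\
  \int[leb2]_(p in @disk R) (normc (derive1 f (cplx p)) ^+ 2 * (1 - nsq p))%:E <= (A * T)%:E.
  apply: littlewood_paley; first by case: Hf.
  by have [T' [e sq _ _]] := hardy_parseval Hf; move: e; rewrite fT => -[->].
have mD := @measurable_disk R.
have P0 p : disk p -> 0 <= poisson mu (cplx p).
  by move=> /unit_disk_cplx hp; rewrite poisson_onE poisson_on_ge0.
have W0 p : disk p -> 0 <= (normc (derive1 f (cplx p)) ^+ 2 * (1 - nsq p))%:E.
  by move=> hp; rewrite lee_fin mulr_ge0 ?sqr_ge0 // subr_ge0 ltW.
have mW : measurable_fun (@disk R) (fun p => (normc (derive1 f (cplx p)) ^+ 2 * (1 - nsq p))%:E).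
  apply/measurable_EFinP; apply: measurable_funM => //.
  by apply: measurable_funTS; apply: measurable_funB => //; exact: measurable_nsq.
have CT : (0 <= C * T)%R by rewrite mulr_ge0.
rewrite /dirichlet_integral unit_disk_planeE -[(_ * T)%R]mulrA [X in _ <= X]EFinM.
apply: lee_wpmul2l; first by rewrite lee_fin invr_ge0.
apply: (@le_trans _ _ (\int[leb2]_(p in @disk R) ((C * T)%:E * poisson mu (cplx p) +
    K%:E * (normc (derive1 f (cplx p)) ^+ 2 * (1 - nsq p))%:E))).
  apply: ge0_le_integral => //.
  - by move=> p hp; rewrite mule_ge0 ?P0 // lee_fin sqr_ge0.
  - by apply: emeasurable_funM => //; exact/measurable_EFinP.
  - by apply: emeasurable_funD; apply: measurable_funeM.
  - move=> p /unit_disk_cplx hp; rewrite -EFinM -normc_cplx.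
    by have := h f T (cplx p) hf fT hp; rewrite -poisson_onE.
rewrite ge0_integralD //; first last.
- by apply: measurable_funeM.
- by move=> p hp; rewrite mule_ge0 ?W0 // lee_fin.
- by apply: measurable_funeM.
- by move=> p hp; rewrite mule_ge0 ?P0.
rewrite !ge0_integralZl //.
apply: (@le_trans _ _ ((C * T)%:E * (4 * pi * mass)%:E + K%:E * (A * T)%:E)).
  by apply: leeD; apply: lee_wpmul2l; rewrite ?lee_fin.
rewrite -!EFinM -EFinD lee_fin le_eqVlt; apply/orP; left; apply/eqP.
ring.
Qed.

End Embedding.

Theorem theorem1p3 (R : realType) (mu : {finite_measure set (borelC R) -> \bar R})
    (u : R[i] -> R[i]) (hmu : on_circle mu) (hu : inner u)
    (hdisj : measure_support mu `&` boundary_spectrum u = set0) :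
  embeds u mu.
Proof.
have [C C0 h] := dirichlet_bound hu hdisj.
have fin f : model_space u f -> exists T : R, hardy_normsq f = T%:E.
  by move=> [/hardy_parseval [T [-> _ _ _]] _]; exists T.
split=> [f hf|].
  have [T fT] := fin f hf; split; first by case: hf => -[].
  exact: le_lt_trans (h f T hf fT) (ltry _).
exists (1 + C); first exact: ltr_wpDr.
move=> f hf; have [T fT] := fin f hf; rewrite fT -EFinM mulrDl mul1r EFinD.
by apply: leeD => //; exact: h.
Qed.
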